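(* Let $\eta\in C(\mathbb{S}^1,Q_0)$ be a loop with class $[\eta]=n_1[\eta_1]+n_2[\eta_2]\in\pi_1(Q_0)$, $n_1,n_2\in\mathbb{Z}$. Then the first Chern numbers of the Bloch line bundle $\mathcal{E}_{\mathrm{B}}(\eta)\to\mathbb{T}^3$ are $$C_{1,2}([\eta])=0,\qquad C_{1,3}([\eta])=n_1,\qquad C_{2,3}([\eta])=n_2,$$ i.e. the antisymmetric matrix of Chern numbers is $C([\eta])=n_1C([\eta_1])+n_2C([\eta_2])$ with $C([\eta_1])=\begin{pmatrix}0&0&1\\0&0&0\\-1&0&0\end{pmatrix}$ and $C([\eta_2])=\begin{pmatrix}0&0&0\\0&0&1\\0&-1&0\end{pmatrix}$.
   Context: Uniaxial strain model: for $q=(q_1,q_2,q_3)\in Q=[0,2]\times[0,2]\times[-1,1]$ and $k=(k_1,k_2)\in\mathbb{T}^2$, $H(k;q)=\mathrm{Re}\,\varpi(k;q)\,\sigma_1+\mathrm{Im}\,\varpi(k;q)\,\sigma_2+q_3\sigma_3$ with $\varpi(k;q)=1+q_1e^{-ik_1}+q_2e^{-ik_2}$ and $\sigma_j$ the Pauli matrices. $Q_0=\{q\in Q:0\notin\sigma(H(q)),\ 1_{(-\infty,0)}(H(q))\neq0\}$, where $\sigma(H(q))=\bigcup_k\sigma(H(k;q))$. The generators of $\pi_1(Q_0)\simeq\mathbb{Z}^2$ are $\eta_1(t)=(1+\varepsilon\cos t,0,-\varepsilon\sin t)$ and $\eta_2(t)=(0,1+\varepsilon\cos t,-\varepsilon\sin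 t)$ for small $\varepsilon>0$. For a loop $\eta$ in $Q_0$ and $T>0$, let $P_\eta(k,t)=1_{(-\infty,0)}(H(k;\eta(2\pi t/T)))$ and let $\mathcal{E}_{\mathrm{B}}(\eta)=\bigsqcup_{(k,t)\in\mathbb{T}^3}\mathrm{ran}\,P_\eta(k,t)$ be the Bloch line bundle over $\mathbb{T}^3$ with coordinates $x=(x_1,x_2,x_3)=(k_1,k_2,t)$. For $1\le j<n\le3$, $\mathbb{T}^2_{j,n}\subset\mathbb{T}^3$ is the 2-torus obtained by fixing the remaining coordinate at an arbitrary value, oriented by $(x_j,x_n)$, and $C_{j,n}([\eta])=\int_{\mathbb{T}^2_{j,n}}c_1(\mathcal{E}_{\mathrm{B}}(\eta))\in\mathbb{Z}$; the matrix $C([\eta])$ has entries $C_{j,n}$ for $j<n$, $C_{n,j}=-C_{j,n}$, and zero diagonal. *)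

(* Defs.v *)
From HB Require Import structures.
From mathcomp Require Import all_boot all_order all_algebra.
From mathcomp Require Import all_classical all_reals all_analysis.
From mathcomp Require Import complex.
Import Order.TTheory GRing.Theory Num.Theory.
Import numFieldNormedType.Exports.

Set Implicit Arguments.
Unset Strict Implicit.
Unset Printing Implicit Defensive.

Local Open Scope ring_scope.
Local Open Scope classical_set_scope.

Section UniaxialStrain.
Context {R : realType}.

Definition i0 : 'I_3 := @Ordinal 3 0 isT.
Definition i1 : 'I_3 := @Ordinal 3 1 isT.
Definition i2 : 'I_3 := @Ordinal 3 2 isT.

Definition crd (x : 'rV[R]_3) (j : 'I_3) : R := x ord0 j.
Definition mkv (a b c : R) : 'rV[R]_3 := \row_(j < 3) [:: a; b; c]`_j.
Definition ev (j : 'I_3) : 'rV[R]_3 := delta_mx ord0 j.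

Definition rc (x : R) : R[i] := Complex x 0.
Definition iC : R[i] := Complex 0 1.
Definition expi (x : R) : R[i] := Complex (cos x) (sin x).
Definition adjoint (A : 'M[R[i]]_2) : 'M[R[i]]_2 := (map_mx (@conjc R) A)^T.

Definition sigma1 : 'M[R[i]]_2 :=
  \matrix_(a < 2, b < 2) (if a == b then 0 else 1).
Definition sigma2 : 'M[R[i]]_2 :=
  \matrix_(a < 2, b < 2)
    (if a == b then 0 else if (a : nat) == 0%N then - iC else iC).
Definition sigma3 : 'M[R[i]]_2 :=
  \matrix_(a < 2, b < 2)
    (if a == b then (if (a : nat) == 0%N then 1 else -1) else 0).

Definition varpi (k1 k2 : R) (q : 'rV[R]_3) : R[i] :=
  1 + rc (crd q i0) * expi (- k1) + rc (crd q i1) * expi (- k2).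

Definition Hmat (k1 k2 : R) (q : 'rV[R]_3) : 'M[R[i]]_2 :=
  rc (complex.Re (varpi k1 k2 q)) *: sigma1
  + rc (complex.Im (varpi k1 k2 q)) *: sigma2
  + rc (crd q i2) *: sigma3.

(* Spectral projection 1_{(-oo,0)}(H) of a hermitian 2x2 matrix, by the
   functional calculus: if H = U diag(d) U^* with U unitary and d real,
   then 1_{(-oo,0)}(H) = U diag(1_{d<0}) U^*. *)
Definition negproj (H : 'M[R[i]]_2) : 'M[R[i]]_2 :=
  xget 0 [set P | exists (U : 'M[R[i]]_2) (d : 'I_2 -> R),
     [/\ U *m adjoint U = 1%:M,
         H = U *m diag_mx (\row_a rc (d a)) *m adjoint U &
         P = U *m diag_mx (\row_a (if d a < 0 then 1 else 0)) *m adjoint U]].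

Definition Qbox : set 'rV[R]_3 :=
  [set q | [/\ 0 <= crd q i0 <= 2, 0 <= crd q i1 <= 2 & -1 <= crd q i2 <= 1]].

(* q in Q_0 : 0 not in sigma(H(q)) = U_k sigma(H(k;q)), and
   1_{(-oo,0)}(H(q)) <> 0 (some fibre projection is nonzero) *)
Definition Q0 : set 'rV[R]_3 :=
  [set q | [/\ Qbox q,
     (forall k1 k2 : R, ~~ eigenvalue (Hmat k1 k2 q) 0) &
     (exists k1 k2 : R, negproj (Hmat k1 k2 q) != 0)]].

Definition loop_in_Q0 (eta : R -> 'rV[R]_3) : Prop :=
  [/\ continuous eta, (forall t, eta (t + 2 * pi) = eta t) &
      (forall t, Q0 (eta t))].

Definition eta1 (eps : R) (t : R) : 'rV[R]_3 :=
  mkv (1 + eps * cos t) 0 (- (eps * sin t)).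
Definition eta2 (eps : R) (t : R) : 'rV[R]_3 :=
  mkv 0 (1 + eps * cos t) (- (eps * sin t)).

Definition unitI (s : R) : Prop := 0 <= s <= 1.

Definition path_in_Q0 (g : R -> 'rV[R]_3) (a b : 'rV[R]_3) : Prop :=
  [/\ continuous g, g 0 = a, g 1 = b & forall s, unitI s -> Q0 (g s)].

Definition concat (f g : R -> 'rV[R]_3) : R -> 'rV[R]_3 :=
  fun t => if t <= 2^-1 then f (2 * t) else g (2 * t - 1).
Definition revp (f : R -> 'rV[R]_3) : R -> 'rV[R]_3 := fun t => f (1 - t).

Fixpoint npow (f : R -> 'rV[R]_3) (n : nat) : R -> 'rV[R]_3 :=
  match n with
  | 0 => fun _ => f 0
  | 1 => f
  | m.+1 => concat f (npow f m)
  end.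
Definition zpow (f : R -> 'rV[R]_3) (z : int) : R -> 'rV[R]_3 :=
  match z with
  | Posz n => npow f n
  | Negz n => npow (revp f) n.+1
  end.

Definition conjloop (g f : R -> 'rV[R]_3) : R -> 'rV[R]_3 :=
  concat g (concat f (revp g)).

Definition free_homotopic_Q0 (f g : R -> 'rV[R]_3) : Prop :=
  exists h : R * R -> 'rV[R]_3,
  [/\ continuous h,
      (forall t, unitI t -> h (0, t) = f t /\ h (1, t) = g t),
      (forall s, unitI s -> h (s, 0) = h (s, 1)) &
      (forall s t, unitI s -> unitI t -> Q0 (h (s, t)))].

(* [eta] = n1 [eta_1] + n2 [eta_2] in pi_1(Q_0): for a base point b and
   paths g1, g2 in Q_0 from b to the base points of eta_1, eta_2, the loop
   eta is (freely) homotopic in Q_0 to (g1 eta1 g1^-1)^n1 (g2 eta2 g2^-1)^n2 *)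
Definition in_class (eta : R -> 'rV[R]_3) (eps : R) (n1 n2 : int) : Prop :=
  exists (b : 'rV[R]_3) (g1 g2 : R -> 'rV[R]_3),
  [/\ path_in_Q0 g1 b (eta1 eps 0), path_in_Q0 g2 b (eta2 eps 0) &
      free_homotopic_Q0 (fun t => eta (2 * pi * t))
        (concat (zpow (conjloop g1 (fun t => eta1 eps (2 * pi * t))) n1)
                (zpow (conjloop g2 (fun t => eta2 eps (2 * pi * t))) n2))].

Definition Pbloch (eta : R -> 'rV[R]_3) (T : R) (x : 'rV[R]_3) : 'M[R[i]]_2 :=
  negproj (Hmat (crd x i0) (crd x i1) (eta (2 * pi * crd x i2 / T))).

Definition per (T : R) (j : 'I_3) : R := if j == i2 then T else 2 * pi.

Definition pd (j : 'I_3) (g : 'rV[R]_3 -> R) (x : 'rV[R]_3) : R :=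
  derive1 (fun s : R => g (x + s *: ev j)) 0.

Definition C1fun (g : 'rV[R]_3 -> R) : Prop :=
  [/\ continuous g,
      (forall (j : 'I_3) (x : 'rV[R]_3), derivable (fun s : R => g (x + s *: ev j)) 0 1) &
      (forall j : 'I_3, continuous (pd j g))].

Definition reM (Q : 'rV[R]_3 -> 'M[R[i]]_2) a b := fun y => complex.Re (Q y a b).
Definition imM (Q : 'rV[R]_3 -> 'M[R[i]]_2) a b := fun y => complex.Im (Q y a b).

Definition pdM (j : 'I_3) (Q : 'rV[R]_3 -> 'M[R[i]]_2) (x : 'rV[R]_3)
  : 'M[R[i]]_2 :=
  \matrix_(a, b) Complex (pd j (reM Q a b) x) (pd j (imM Q a b) x).

Definition smooth_proj_family (T : R) (Q : 'rV[R]_3 -> 'M[R[i]]_2) : Prop :=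
  [/\ (forall a b, C1fun (reM Q a b) /\ C1fun (imM Q a b)),
      (forall x j, Q (x + per T j *: ev j) = Q x) &
      (forall x, [/\ Q x *m Q x = Q x, adjoint (Q x) = Q x & \rank (Q x) = 1%N])].

Definition hs2 (A : 'M[R[i]]_2) : R := \sum_a \sum_b (complex.Re (A a b) ^+ 2 + complex.Im (A a b) ^+ 2).

Definition smooth_approx (P : 'rV[R]_3 -> 'M[R[i]]_2) (T : R)
  (Q : 'rV[R]_3 -> 'M[R[i]]_2) : Prop :=
  smooth_proj_family T Q /\ (forall x, hs2 (P x - Q x) < 1).

Definition curv (Q : 'rV[R]_3 -> 'M[R[i]]_2) (j n : 'I_3) (x : 'rV[R]_3) : R :=
  complex.Re (iC * \tr (Q x *m (pdM j Q x *m pdM n Q x - pdM n Q x *m pdM j Q x)))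
  / (2 * pi).

Definition chern_slice (Q : 'rV[R]_3 -> 'M[R[i]]_2) (T : R) (j n : 'I_3)
  (x0 : 'rV[R]_3) : R :=
  Rintegral lebesgue_measure `[0, per T j]
    (fun a => Rintegral lebesgue_measure `[0, per T n]
       (fun b => curv Q j n (x0 + a *: ev j + b *: ev n))).

(* C_{j,n} = m for the line bundle ran P over T^3: computed via Chern-Weil on
   any C^1 family of projections uniformly close to P (such a family exists
   and all of them give the same value, on every slice). *)
Definition chern_number_is (P : 'rV[R]_3 -> 'M[R[i]]_2) (T : R) (j n : 'I_3)
  (m : int) : Prop :=
  (exists Q, smooth_approx P T Q) /\
  (forall Q, smooth_approx P T Q -> forall x0, chern_slice Q T j n x0 = m%:~R).

End UniaxialStrain.

(* Main.v *)
Require Import Defs.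
From HB Require Import structures.
From mathcomp Require Import all_boot all_order all_algebra.
From mathcomp Require Import all_classical all_reals all_analysis.
From mathcomp Require Import complex ring lra.
Import Order.TTheory GRing.Theory Num.Theory.
Import numFieldNormedType.Exports.
Local Open Scope ring_scope.

(**
Write the projections in terms of unit vectors, Q = (1 - m.sigma)/2. For a
vector field d without zeros on the torus, fix the second coordinate b, discretize
the first one and form the Wilson loop W_M(b) = tr prod_a (|d_a| - d_a.sigma),
which is nonzero as soon as neighbouring vectors are not antipodal. The angle
through which W_M winds in b is a homotopy invariant of d for large M. If d = m
is C^1, then W_M' = lambda W_M, where lambda is a sum over the links of the chain,
and Im lambda tends uniformly to the integral of 2 pi times the curvature, so
the angle is 2 pi times the Chern number.

An approximation Q of the Bloch projection has m.d > 0 with d = (Re w, Im w, q3)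
the vector of H, so m may be replaced by d, and then eta by the word in eta_1 and
eta_2, since every Q_0 point is gapped. On a slice with one momentum fixed at 0,
d is (a e^{-ik} + b, q3) with a, b >= 0 and (a - b, q3) <> 0; it is homotopic to
the field with a, b replaced by the positive and negative parts of x = a - b.
Its Wilson loop is positive for x <= 0 and equals
((r - y) + (r + y) e^{-2 pi i / M})^M, r = |(x, y)|, y = q3, for x >= 0, so it
winds once along the generator that encircles (x, y) = 0 and not at all along the
other one. On a slice of fixed t, d is homotopic to a constant.
*)

Set Implicit Arguments.
Unset Strict Implicit.
Unset Printing Implicit Defensive.

(** * Continuity at a point *)

(** The loop is only continuous and the approximating projections are only C^1. So the Bloch field
    itself has no Berry connection, and the usual invariance argument, which differentiates the
    curvature along a homotopy, would need second derivatives. Wilson loops of finite chains bridge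
    the two settings: they make sense for continuous fields, and their logarithmic derivative in the
    remaining variable involves first derivatives only. The required mesh depends on the field or
    the homotopy, so only the eventual value for fine meshes carries information.

    Winding angles come from real lifts and do not require the curve to close. They are therefore
    additive under concatenation, and the auxiliary paths to the base points of the generators
    cancel. Angles pass from the whole word to its pieces by restricting a lift, and the angle of
    the word itself comes from the end of a given homotopy.

    Fixing the other momentum at 0 leaves a constant term 1 + q_j >= 0. Then |a e^{-ik} + b| >= |a -
    b| with equality at k = pi, so one point of the slice decides whether the field vanishes. *)

Section PointwiseContinuity.
Context {R : realType} {X : topologicalType}.
Implicit Types (f g : X -> R) (x : X).

Lemma ctatD f g x : continuous_at x f -> continuous_at x g ->
  continuous_at x (fun y => f y + g y).
Proof. by move=> cf cg; apply: cvgD. Qed.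

Lemma ctat_eq (Y : topologicalType) (f g : X -> Y) x : f =1 g ->
  continuous_at x f -> continuous_at x g.
Proof. by move=> /funext ->. Qed.

Lemma ctatN f x : continuous_at x f -> continuous_at x (fun y => - f y).
Proof. by move=> cf; apply: cvgN. Qed.

Lemma ctatM f g x : continuous_at x f -> continuous_at x g ->
  continuous_at x (fun y => f y * g y).
Proof. by move=> cf cg; apply: cvgM. Qed.

Lemma ctatX f n x : continuous_at x f ->
  continuous_at x (fun y => f y ^+ n).
Proof.
move=> cf; elim: n => [|n IH]; first exact: cst_continuous.
have -> : (fun y => f y ^+ n.+1) = (fun y => f y * f y ^+ n).
  by apply: funext => y; rewrite exprS.
exact: ctatM.
Qed.

Lemma ctatV f x : f x != 0 -> continuous_at x f ->
  continuous_at x (fun y => (f y)^-1).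
Proof. by move=> f0 cf; apply: cvgV. Qed.

Lemma ctat_comp (Y Z : topologicalType) (g : Y -> Z) (f : X -> Y) x :
  continuous g -> continuous_at x f -> continuous_at x (fun y => g (f y)).
Proof. by move=> cg cf; apply: (@continuous_comp _ _ _ f g) => //; apply: cg. Qed.

Lemma ctat_max f g x : continuous_at x f -> continuous_at x g ->
  continuous_at x (fun y => Num.max (f y) (g y)).
Proof. by move=> cf cg; apply: continuous_max. Qed.

Lemma ctat_min f g x : continuous_at x f -> continuous_at x g ->
  continuous_at x (fun y => Num.min (f y) (g y)).
Proof. by move=> cf cg; apply: continuous_min. Qed.

Lemma ctat_pair (Y Z : topologicalType) (f : X -> Y) (g : X -> Z) x :
  continuous_at x f -> continuous_at x g ->
  continuous_at x (fun y => (f y, g y)).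
Proof. by move=> cf cg; apply: cvg_pair. Qed.

Lemma ctat_crd (f : X -> 'rV[R]_3) j x :
  continuous_at x f -> continuous_at x (fun y => crd (f y) j).
Proof. by move=> cf; apply: (ctat_comp (g := fun v => crd v j)) => //; exact: coord_continuous. Qed.

Lemma ctat_sum (n : nat) (f : nat -> X -> R) x :
  (forall j, continuous_at x (f j)) ->
  continuous_at x (fun y => \sum_(j < n) f j y).
Proof.
move=> cf; elim: n => [|n IH].
  apply: (@ctat_eq _ (fun=> 0)); first by move=> y; rewrite big_ord0.
  exact: cst_continuous.
apply: (@ctat_eq _ (fun y => \sum_(j < n) f j y + f n y)).
  by move=> y; rewrite big_ord_recr.
exact: ctatD.
Qed.

End PointwiseContinuity.

Lemma ctat_fst {X Y Z : topologicalType} (f : X -> Y * Z) x :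
  continuous_at x f -> continuous_at x (fun y => (f y).1).
Proof. by move=> cf; apply: (ctat_comp (g := fst)) => // p; exact: cvg_fst. Qed.

Lemma ctat_snd {X Y Z : topologicalType} (f : X -> Y * Z) x :
  continuous_at x f -> continuous_at x (fun y => (f y).2).
Proof. by move=> cf; apply: (ctat_comp (g := snd)) => // p; exact: cvg_snd. Qed.

Lemma ctat_id {X : topologicalType} (x : X) : continuous_at x (fun y => y).
Proof. exact: cvg_id. Qed.

Lemma ctat_cst {X Y : topologicalType} (c : Y) (x : X) :
  continuous_at x (fun=> c).
Proof. exact: cst_continuous. Qed.

Ltac ctac_eta :=
  lazymatch goal with
  | |- continuous_at _ (fun _ => _) => idtac
  | |- continuous_at ?x ?f => change (continuous_at x (fun y => f y))
  end.
(* Syntactic, because plain assumption may unfold derivatives and integrals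
   when it compares the goal with an unrelated hypothesis. *)
Ltac ctac_hyp :=
  match goal with
  | H : continuous_at ?x ?f |- continuous_at ?x ?f => exact: H
  | H : continuous_at ?x ?f |- continuous_at ?x (fun y => ?f y) => exact: H
  | H : forall x, continuous_at x ?g |- continuous_at _ (fun y => ?g (@?f y)) =>
      apply: (ctat_comp H)
  | H : forall x, continuous_at x ?g |- continuous_at _ (fun y => ?g y) => exact: H
  end.
Ltac ctac_step :=
  ctac_eta;
  lazymatch goal with
  | |- continuous_at _ (fun y => y) => apply: ctat_id
  | |- continuous_at _ (fun _ => ?c) => apply: ctat_cst
  | |- continuous_at _ (fun y => @?f y + @?g y) => apply: ctatD
  | |- continuous_at _ (fun y => - (@?f y)) => apply: ctatN
  | |- continuous_at _ (fun y => @?f y * @?g y) => apply: ctatM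
  | |- continuous_at _ (fun y => @?f y ^+ ?n) => apply: ctatX
  | |- continuous_at _ (fun y => Num.max (@?f y) (@?g y)) => apply: ctat_max
  | |- continuous_at _ (fun y => Num.min (@?f y) (@?g y)) => apply: ctat_min
  | |- continuous_at _ (fun y => cos (@?f y)) => apply: (ctat_comp (@continuous_cos _))
  | |- continuous_at _ (fun y => sin (@?f y)) => apply: (ctat_comp (@continuous_sin _))
  | |- continuous_at _ (fun y => atan (@?f y)) => apply: (ctat_comp (@continuous_atan _))
  | |- continuous_at _ (fun y => Num.sqrt (@?f y)) => apply: (ctat_comp (@sqrt_continuous _))
  | |- continuous_at _ (fun y => crd (@?f y) ?j) => apply: ctat_crd
  | |- continuous_at _ (fun y => pair (@?f y) (@?g y)) => apply: ctat_pair
  | |- continuous_at _ (fun y => fst (@?f y)) => first [ctac_hyp | apply: ctat_fst]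
  | |- continuous_at _ (fun y => snd (@?f y)) => first [ctac_hyp | apply: ctat_snd]
  | |- continuous_at _ _ => first [ctac_hyp | assumption]
  end.
Ltac ctac := repeat first [ctac_hyp | ctac_step].

(** * Arguments and lifts *)

Section Tube.
Local Open Scope classical_set_scope.
Context {R : realType}.

(** The common source of uniformity: lower bounds follow directly, and uniform smallness of a
    difference [u] follows by applying it to [e ^+ 2 - u ^+ 2]. Continuity is asked for at height 0
    only, which is what [quot_cts] provides for difference quotients. *)
Lemma tube (X : topologicalType) (K : set X) (f : X * R -> R) :
  compact K -> (forall x, K x -> continuous_at (x, 0) f) ->
  (forall x, K x -> 0 < f (x, 0)) ->
  exists2 e : R, 0 < e & forall h, `|h| < e -> forall x, K x -> 0 < f (x, h).
Proof.
move=> /compact_near_coveringP cK cf pf.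
have [x Kx|e /= e0 He] := cK R (nbhs (0 : R)) (fun h x => 0 < f (x, h)) _.
  have h := cvgr_gt (f (x, 0)) (cf x Kx) _ (pf x Kx).
  case: h => -[U V] /= [nU nV] UV; exists (U, V) => // -[y i] /= [Uy Vi].
  exact: (UV (y, i)).
exists e => // h he x Kx; apply: He => //=.
by rewrite /ball_ /= sub0r normrN.
Qed.

(** Clamping to the unit interval: precomposition turns a field that is nonzero on the unit square
    into one that is nonzero on the whole plane, as [lift2] demands. *)
Definition cl (t : R) : R := Num.max 0 (Num.min 1 t).

Lemma cl_itv t : 0 <= cl t <= 1.
Proof.
rewrite /cl; case: (leP 1 t) => h; first by case: (leP 0 1) => ?; lra.
by case: (leP 0 t) => ?; lra.
Qed.

Lemma cl_id t : 0 <= t <= 1 -> cl t = t.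
Proof.
rewrite /cl; case: (leP 1 t) => h; first by case: (leP 0 1) => ?; lra.
by case: (leP 0 t) => ?; lra.
Qed.

Lemma cl_continuous : continuous cl.
Proof. by move=> t; rewrite /cl; ctac. Qed.

Lemma compact_square : compact [set p : R * R | 0 <= p.1 <= 1 /\ 0 <= p.2 <= 1].
Proof.
have -> : [set p : R * R | 0 <= p.1 <= 1 /\ 0 <= p.2 <= 1] = (`[0, 1] `*` `[0, 1])%classic.
  by apply/seteqP; split=> p /=; rewrite !in_itv.
by apply: compact_setX; exact: segment_compact.
Qed.

Lemma compact_cube :
  compact [set p : R * R * R | [/\ 0 <= p.1.1 <= 1, 0 <= p.1.2 <= 1 & 0 <= p.2 <= 1]].
Proof.
have -> : [set p : R * R * R | [/\ 0 <= p.1.1 <= 1, 0 <= p.1.2 <= 1 & 0 <= p.2 <= 1]] =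
    ((`[0, 1] `*` `[0, 1]) `*` `[0, 1])%classic.
  by apply/seteqP; split=> p /=; rewrite !in_itv /=; [case | case=> -[]].
by do ![apply: compact_setX; last exact: segment_compact]; exact: segment_compact.
Qed.

End Tube.

Section Arguments.
Context {R : realType}.
Implicit Types (z w : R[i]) (a b t : R).

(** A relation instead of a function, because no branch of the argument is continuous on the
    punctured plane. The condition [0 < r] builds in [z != 0]. *)
Definition isarg a z :=
  exists2 r : R, 0 < r & z = Complex (r * cos a) (r * sin a).

Lemma isarg_neq0 a z : isarg a z -> z != 0.
Proof.
case=> r r0 ->; rewrite eq_complex /=; apply/negP => /andP[/eqP h1 /eqP h2].
have := cos2Dsin2 a; have := r0; nra.
Qed.

Lemma isargM a b z w : isarg a z -> isarg b w -> isarg (a + b) (z * w).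
Proof.
case=> r r0 -> [s s0 ->]; exists (r * s); first exact: mulr_gt0.
by apply/eqP; rewrite eq_complex /= cosD sinD; apply/andP; split; apply/eqP; ring.
Qed.

(** The product of [z] with the conjugate of [w] is the quotient of [z] by [w] times a positive
    number, so its argument is the increment from [w] to [z]. *)
Lemma isarg_step a b z w : isarg a w -> isarg b (z * w^*%C) -> isarg (a + b) z.
Proof.
case: z => x y; case=> r r0 -> [s s0] /eqP; rewrite eq_complex /=.
move=> /andP[/eqP h1 /eqP h2]; exists (s / r); first exact: divr_gt0.
have h := cos2Dsin2 a.
have r1 : r != 0 by rewrite gt_eqF.
apply/eqP; rewrite eq_complex /= cosD sinD; apply/andP; split; apply/eqP; apply: (mulfI r1).
  rewrite mulrA [r * (s / r)]mulrC divfK //.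
  transitivity (r * x * (cos a ^+ 2 + sin a ^+ 2)); first by rewrite h; ring.
  transitivity (cos a * (s * cos b) - sin a * (s * sin b)); last by ring.
  by rewrite -h1 -h2; ring.
rewrite mulrA [r * (s / r)]mulrC divfK //.
transitivity (r * y * (cos a ^+ 2 + sin a ^+ 2)); first by rewrite h; ring.
transitivity (sin a * (s * cos b) + cos a * (s * sin b)); last by ring.
by rewrite -h1 -h2; ring.
Qed.

(** An argument only on the open right half-plane; elsewhere [atan] picks the wrong branch. *)
Definition parg z := atan (complex.Im z / complex.Re z).

Lemma isarg_parg z : 0 < complex.Re z -> isarg (parg z) z.
Proof.
case: z => x y /= x0; rewrite /parg /=; set a := atan _.
have ca : 0 < cos a by apply: cos_gt0_pihalf; rewrite atan_gtNpi2 atan_ltpi2.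
exists (x / cos a); first exact: divr_gt0.
have ta : tan a = y / x by rewrite atanK.
rewrite divfK ?gt_eqF //; congr Complex.
by rewrite -mulrA [_^-1 * _]mulrC -[sin a / cos a]/(tan a) ta mulrC divfK // gt_eqF.
Qed.

Lemma isarg_ex z : z != 0 -> exists a, isarg a z.
Proof.
case: z => x y; rewrite eq_complex /= negb_and => h.
case: (ltgtP 0 x) => hx.
- by exists (parg (Complex x y)); apply: isarg_parg.
- have [|r r0 [h1 h2]] := @isarg_parg (Complex (- x) (- y)); first by rewrite /=; lra.
  exists (parg (Complex (- x) (- y)) + pi); exists r => //.
  by rewrite cosDpi sinDpi !mulrN -h1 -h2 !opprK.
case: (ltgtP 0 y) => hy; last by move: h; rewrite -hx -hy eqxx.
- by exists (pi / 2), y => //; rewrite cos_pihalf sin_pihalf mulr0 mulr1 hx.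
exists (- (pi / 2)), (- y); first by rewrite oppr_gt0.
by rewrite cosN sinN cos_pihalf sin_pihalf mulr0 mulrNN mulr1 hx.
Qed.

Lemma isarg_cos a b z : isarg a z -> isarg b z -> cos (a - b) = 1.
Proof.
case=> r r0 -> [s s0] /eqP; rewrite eq_complex /= => /andP[/eqP h1 /eqP h2].
have ha := cos2Dsin2 a; have hb := cos2Dsin2 b.
have rs : r = s.
  apply/eqP; rewrite -(eqrXn2 (n := 2)) ?ltW //; apply/eqP.
  transitivity ((r * cos a) ^+ 2 + (r * sin a) ^+ 2).
    by rewrite !exprMn -mulrDr ha mulr1.
  by rewrite h1 h2 !exprMn -mulrDr hb mulr1.
subst s; rewrite cosB.
have r1 : r != 0 by rewrite gt_eqF.
by rewrite (mulfI r1 h1) (mulfI r1 h2) -!expr2.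
Qed.

Lemma isarg_eq_near a b z : isarg a z -> isarg b z -> `|a - b| < pi -> a = b.
Proof.
move=> ha hb hab; have h := isarg_cos ha hb.
case: (eqVneq a b) => // ne.
have n0 : 0 < `|a - b| by rewrite normr_gt0 subr_eq0.
have : cos `|a - b| < cos 0.
  by rewrite ltr_cos // ?in_itv /= ?lexx ?pi_ge0 // ltW // ltW.
have -> : cos `|a - b| = cos (a - b).
  by case: (leP 0 (a - b)) => h'; [rewrite ger0_norm | rewrite ltr0_norm // cosN].
by rewrite cos0 h ltxx.
Qed.

Lemma isarg_conj a z : isarg a z -> isarg (- a) z^*%C.
Proof. by case=> r r0 ->; exists r => //; rewrite cosN sinN /= mulrN. Qed.

Lemma isarg_pos (r : R) : 0 < r -> isarg 0 (rc r).
Proof. by move=> r0; exists r => //; rewrite cos0 sin0 mulr1 mulr0. Qed.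

Lemma isarg_exp a z n : isarg a z -> isarg (a *+ n) (z ^+ n).
Proof.
move=> h; elim: n => [|n IH]; last by rewrite mulrS exprS; exact: isargM.
by rewrite mulr0n expr0; have := @isarg_pos 1 ltr01.
Qed.

End Arguments.

Section ComplexContinuity.
Context {R : realType} {X : topologicalType}.
Implicit Types (F G : X -> R[i]) (x : X).

Definition cctat F x := continuous_at x (fun y => complex.Re (F y)) /\
  continuous_at x (fun y => complex.Im (F y)).

Definition ccts F := forall x, cctat F x.

Lemma Re_mul (z w : R[i]) :
  complex.Re (z * w) = complex.Re z * complex.Re w - complex.Im z * complex.Im w.
Proof. by case: z => ? ?; case: w. Qed.

Lemma Im_mul (z w : R[i]) :
  complex.Im (z * w) = complex.Re z * complex.Im w + complex.Im z * complex.Re w.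
Proof. by case: z => ? ?; case: w. Qed.

Lemma Re_add (z w : R[i]) : complex.Re (z + w) = complex.Re z + complex.Re w.
Proof. by case: z => ? ?; case: w. Qed.

Lemma Im_add (z w : R[i]) : complex.Im (z + w) = complex.Im z + complex.Im w.
Proof. by case: z => ? ?; case: w. Qed.

Lemma cctatM F G x : cctat F x -> cctat G x -> cctat (fun y => F y * G y) x.
Proof.
move=> [F1 F2] [G1 G2]; split.
  apply: ctat_eq; first by move=> y; symmetry; exact: Re_mul.
  by ctac.
apply: ctat_eq; first by move=> y; symmetry; exact: Im_mul.
by ctac.
Qed.

Lemma cctatD F G x : cctat F x -> cctat G x -> cctat (fun y => F y + G y) x.
Proof.
move=> [F1 F2] [G1 G2]; split.
  apply: ctat_eq; first by move=> y; symmetry; exact: Re_add.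
  by ctac.
apply: ctat_eq; first by move=> y; symmetry; exact: Im_add.
by ctac.
Qed.

Lemma cctat_conj F x : cctat F x -> cctat (fun y => (F y)^*%C) x.
Proof.
move=> [F1 F2]; split.
  by apply: (ctat_eq _ F1) => y; case: (F y).
by apply: (ctat_eq _ (ctatN F2)) => y; case: (F y).
Qed.

Lemma cctat_mk (u v : X -> R) x : continuous_at x u -> continuous_at x v ->
  cctat (fun y => Complex (u y) (v y)) x.
Proof. by []. Qed.

Lemma cctat_cst (c : R[i]) x : cctat (fun=> c) x.
Proof. by split; ctac. Qed.

Lemma ctat_parg F x : 0 < complex.Re (F x) -> cctat F x ->
  continuous_at x (fun y => parg (F y)).
Proof.
move=> h [F1 F2]; rewrite /parg; ctac.
by apply: ctatV => //; rewrite gt_eqF.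
Qed.

End ComplexContinuity.

Lemma cctat_comp {R : realType} {X Y : topologicalType} (F : Y -> R[i]) (g : X -> Y) x :
  ccts F -> continuous_at x g -> cctat (fun y => F (g y)) x.
Proof.
move=> cF cg; split.
  by apply: (ctat_comp (g := fun y => complex.Re (F y))) => // y; case: (cF y).
by apply: (ctat_comp (g := fun y => complex.Im (F y))) => // y; case: (cF y).
Qed.

Ltac cctac := repeat first
  [ apply: cctat_cst | apply: cctatM | apply: cctatD | apply: cctat_conj
  | match goal with H : ccts ?f |- _ => apply: (cctat_comp H) end
  | apply: cctat_mk ]; ctac.

(** * Continuous lifts and winding angles *)

Section Lift.
Context {R : realType}.

(* The argument of F p is the sum of the small argument increments along the
   segment from the origin to p. *)
Lemma lift2 (F : R * R -> R[i]) : ccts F -> (forall p, F p != 0) ->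
  exists2 th : R * R -> R, continuous th &
    forall p, 0 <= p.1 <= 1 -> 0 <= p.2 <= 1 -> isarg (th p) (F p).
Proof.
move=> cF nF.
(* As long as this is positive, the increment between neighbouring points of a ray lies in the right
   half-plane, where [parg] is continuous. At zero increment it equals |F|^2. *)
pose g (x : (R * R * R) * R) :=
  complex.Re (F ((x.1.1.1 + x.2) * x.1.1.2, (x.1.1.1 + x.2) * x.1.2)
    * (F (x.1.1.1 * x.1.1.2, x.1.1.1 * x.1.2))^*%C).
have cg : continuous g.
  move=> x; rewrite /g.
  suff [] : cctat (fun x : (R * R * R) * R =>
    F ((x.1.1.1 + x.2) * x.1.1.2, (x.1.1.1 + x.2) * x.1.2)
    * (F (x.1.1.1 * x.1.1.2, x.1.1.1 * x.1.2))^*%C) x by [].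
  by cctac.
have [x _|x _|e e0 He] := @tube R _ _ g compact_cube.
- exact: cg.
- rewrite /g /= addr0.
  move: (nF (x.1.1 * x.1.2, x.1.1 * x.2)); case: (F _) => u v.
  rewrite eq_complex /= negb_and mulrN opprK => /orP[] h.
    by apply: ltr_pwDl; [rewrite -expr2 exprn_even_gt0|rewrite -expr2 sqr_ge0].
  by apply: ltr_wpDl; [rewrite -expr2 sqr_ge0|rewrite -expr2 exprn_even_gt0].
have [N HN] : exists N : nat, N.+1%:R^-1 < e.
  have [N _ /(_ N) H] := near_infty_natSinv_lt (PosNum e0).
  by exists N; apply: H => /=.
set h := N.+1%:R^-1 in HN.
have h0 : 0 < h by rewrite invr_gt0 ltr0Sn.
have hN : h * N.+1%:R = 1 by rewrite mulVf // pnatr_eq0.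
pose P (j : nat) (p : R * R) := F (j%:R * h * cl p.1, j%:R * h * cl p.2).
have pos (j : nat) p : (j < N.+1)%N -> 0 < complex.Re (P j.+1 p * (P j p)^*%C).
  move=> jN; have jh : 0 <= j%:R * h <= 1.
    apply/andP; split; first by apply: mulr_ge0 => //; exact: ltW.
    have jn : j%:R <= N.+1%:R :> R by rewrite ler_nat ltnW.
    have : h * j%:R <= h * N.+1%:R by rewrite ler_wpM2l // ltW.
    by rewrite hN mulrC.
  have := He h _ (j%:R * h, cl p.1, cl p.2) _.
  rewrite /g /P /= mulrSr [(_ + 1) * h]mulrDl mul1r; apply.
    by rewrite gtr0_norm.
  by split; rewrite ?cl_itv.
have [a Ha] := isarg_ex (nF (0, 0)).
exists (fun p => a + \sum_(j < N.+1) parg (P j.+1 p * (P j p)^*%C)).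
  move=> p; apply: ctatD; first exact: ctat_cst.
  have cP j : cctat (P j) p.
    by have cl_c := @cl_continuous R; rewrite /P; cctac.
  (* Truncated because [ctat_sum] asks for continuity at every index, whereas the real part is known
     to be positive only up to [N]. *)
  pose f j q := if (j < N.+1)%N then parg (P j.+1 q * (P j q)^*%C) else 0.
  apply: (ctat_eq (f := fun q => \sum_(j < N.+1) f j q)).
    by move=> q; apply: eq_bigr => j _; rewrite /f ltn_ord.
  apply: ctat_sum => j; rewrite /f; case: (ltnP j N.+1) => jN; last exact: ctat_cst.
  by apply: ctat_parg; [exact: pos|apply: cctatM => //; apply: cctat_conj].
move=> p p1 p2.
have -> : F p = P N.+1 p.
  by rewrite /P [_ * h]mulrC hN !mul1r !cl_id //; case: p {p1 p2}.
suff H m : (m <= N.+1)%N ->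
  isarg (a + \sum_(j < m) parg (P j.+1 p * (P j p)^*%C)) (P m p) by exact: H.
elim: m => [|j IH] jN.
  by rewrite big_ord0 addr0 /P !mul0r.
rewrite big_ord_recr /= addrA; apply: (isarg_step (w := P j p)); first exact/IH/ltnW.
by apply: isarg_parg; exact: pos.
Qed.

(** The curve need not close and the angle need not be a multiple of 2 pi, so that pieces of a
    concatenation have angles too. *)
Definition IsAng (f : R -> R[i]) (al : R) :=
  exists2 th : R -> R, continuous th /\ th 1 - th 0 = al &
    forall t, unitI t -> isarg (th t) (f t).

(** Such an [f] takes its values in the discrete set 2 pi Z. If it changed, the intermediate value
    theorem would yield a value other than [f 0] at distance less than pi from it, which
    [isarg_eq_near] excludes since both are arguments of 1. *)
Lemma cos1_const (f : R -> R) : continuous f ->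
  (forall t, unitI t -> cos (f t) = 1) -> f 1 = f 0.
Proof.
move=> cf Hf.

have H (a b v : R) : a <= b -> 0 <= a -> b <= 1 -> 
    Num.min (f a) (f b) <= v <= Num.max (f a) (f b) -> exists2 t, unitI t & f t = v.
  move=> ab a0 b1 vv; have [|t] := @IVT R f a b v ab _ vv.
    by apply: continuous_subspaceT.
  by rewrite in_itv /= => /andP[ta tb] <-; exists t => //; rewrite /unitI; lra.
have Z0 : unitI (0 : R) by rewrite /unitI; lra.
have Z1 : unitI (1 : R) by rewrite /unitI; lra.
apply/eqP/negPn/negP => ne.
pose d := Num.min pi `|f 1 - f 0|.
have d0 : 0 < d by rewrite lt_min pi_gt0 normr_gt0 subr_eq0.
pose v := if f 0 < f 1 then f 0 + d / 2 else f 0 - d / 2.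
have dpi : d <= pi by rewrite ge_min lexx.
have dl : d <= `|f 1 - f 0| by rewrite ge_min lexx orbT.
have vv : Num.min (f 0) (f 1) <= v <= Num.max (f 0) (f 1).
  move: dl; rewrite /v; case: ltgtP ne => // h _.
    by rewrite gtr0_norm ?subr_gt0 //; lra.
  by rewrite ltr0_norm ?subr_lt0 //; lra.
have [t t1 ft] := H 0 1 v ler01 (lexx _) (lexx _) vv.
have := @isarg_eq_near R (f t) (f 0) 1.
have A u : unitI u -> isarg (f u) (1 : R[i]).
  move=> u1; exists 1 => //; rewrite !mul1r; apply/eqP; rewrite eq_complex /= Hf // eqxx /=.
  have h := cos2Dsin2 (f u); rewrite Hf // in h.
  by rewrite eq_sym -sqrf_eq0; apply/eqP; lra.
have nd : `|v - f 0| = d / 2.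
  by rewrite /v; case: ifP => _; rewrite [_ - f 0]addrAC subrr add0r ?normrN gtr0_norm; lra.
move=> /(_ (A _ t1) (A _ Z0)); rewrite ft nd => E.
have : v = f 0 by apply: E; have := @pi_gt0 R; lra.
by move/eqP; rewrite -subr_eq0 -normr_eq0 nd; apply/negP; rewrite gt_eqF; lra.
Qed.

Lemma IsAng_uniq f a b : IsAng f a -> IsAng f b -> a = b.
Proof.
move=> [th [ct <-] Ht] [ph [cp <-] Hp].
suff : th 1 - ph 1 = th 0 - ph 0 by lra.
apply: (@cos1_const (fun t => th t - ph t)); first by move=> t; ctac.
by move=> t t1; apply: isarg_cos (Ht t t1) (Hp t t1).
Qed.

(** A lift on the square assigns to each [s] a total change in [t]. The changes at [s = 0] and
    [s = 1] agree by [cos1_const]: the curves close, so all these changes lie in 2 pi Z, and they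
    depend continuously on [s]. *)
Lemma IsAng_homotopy (F : R * R -> R[i]) al :
  ccts F -> (forall s t, unitI s -> unitI t -> F (s, t) != 0) ->
  (forall s, unitI s -> F (s, 0) = F (s, 1)) ->
  IsAng (fun t => F (0, t)) al -> IsAng (fun t => F (1, t)) al.
Proof.
move=> cF nF pF A0.
have c1 := @cl_continuous R.
have [||th ct Ht] := @lift2 (fun p => F (cl p.1, cl p.2)).
- by move=> p; cctac.
- by move=> p; apply: nF; exact: cl_itv.
have H s t : unitI s -> unitI t -> isarg (th (s, t)) (F (s, t)).
  by move=> hs ht; have := Ht (s, t) hs ht; rewrite /= !cl_id.
have Z0 : unitI (0 : R) by rewrite /unitI; lra.
have Z1 : unitI (1 : R) by rewrite /unitI; lra.
have e : th (1, 1) - th (1, 0) = th (0, 1) - th (0, 0).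
  apply: (@cos1_const (fun s => th (s, 1) - th (s, 0))); first by move=> s; ctac.
  move=> s hs; apply: (@isarg_cos _ _ _ (F (s, 1))); first exact: H.
  by rewrite -pF //; exact: H.
have A0' : IsAng (fun t => F (0, t)) (th (0, 1) - th (0, 0)).
  by exists (fun t => th (0, t)); [split=> // t; ctac|move=> t; exact: H].
rewrite (IsAng_uniq A0 A0') -e.
by exists (fun t => th (1, t)); [split=> // t; ctac|move=> t; exact: H].
Qed.

Lemma IsAng_ex (f : R -> R[i]) : ccts f -> (forall t, unitI t -> f t != 0) ->
  exists al, IsAng f al.
Proof.
move=> cf nf; have c1 := @cl_continuous R.
have [||th ct Ht] := @lift2 (fun p => f (cl p.2)).
- by move=> p; cctac.
- by move=> p; apply: nf; exact: cl_itv.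
have Z0 : unitI (0 : R) by rewrite /unitI; lra.
exists (th (0, 1) - th (0, 0)), (fun t => th (0, t)); first by split=> // t; ctac.
by move=> t t1; have := Ht (0, t) Z0 t1; rewrite /= cl_id.
Qed.

Lemma IsAng_eq (f g : R -> R[i]) al : (forall t, unitI t -> f t = g t) ->
  IsAng f al -> IsAng g al.
Proof. by move=> fg [th h H]; exists th => // t t1; rewrite -fg //; exact: H. Qed.

End Lift.

(** * Additivity of angles along words in loops *)

Section LoopAngles.
Context {R : realType} (G : 'rV[R]_3 -> R[i]).
Implicit Types f g : R -> 'rV[R]_3.
Local Notation ang f := (IsAng (fun t => G (f t))).

Let Z0 : unitI (0 : R). Proof. by rewrite /unitI; lra. Qed.
Let Z1 : unitI (1 : R). Proof. by rewrite /unitI; lra. Qed.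

(** A lift along the concatenation restricts to lifts along the two halves; nothing has to be
    glued. *)
Lemma IsAng_concat f g c : f 1 = g 0 -> ang (concat f g) c ->
  exists a b, [/\ ang f a, ang g b & c = a + b].
Proof.
move=> fg [th [ct <-] Ht].
exists (th 2^-1 - th 0), (th 1 - th 2^-1); split; last by lra.
- exists (fun t => th (2^-1 * t)).
    by split; [move=> t; ctac|rewrite mulr1 mulr0].
  move=> t /[dup] h; rewrite /unitI => t1.
  have h2 : unitI (2^-1 * t) by rewrite /unitI; lra.
  have := Ht _ h2; rewrite /concat; case: ifP => [_|/negP]; last by case; lra.
  by rewrite mulrA divff ?pnatr_eq0 // mul1r.
exists (fun t => th (2^-1 * t + 2^-1)).
  split; first by move=> t; ctac.
  by rewrite mulr0 add0r mulr1 -div1r -splitr.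
move=> t /[dup] h; rewrite /unitI => t1.
have h2 : unitI (2^-1 * t + 2^-1) by rewrite /unitI; lra.
have := Ht _ h2; rewrite /concat.
have -> : 2 * (2^-1 * t + 2^-1) = t + 1 by lra.
(* At the midpoint [concat] still evaluates [f], so the second half starts at [f 1], which has to be
   identified with [g 0]. *)
case: ifP => [le|_]; last by rewrite addrK.
have -> : t = 0 by lra.
by rewrite add0r fg.
Qed.

Lemma IsAng_revp f a : ang (revp f) a -> ang f (- a).
Proof.
move=> [th [ct <-] Ht]; exists (fun t => th (1 - t)).
  by split; [move=> t; ctac|rewrite subrr subr0 opprB].
move=> t t1; have h : unitI (1 - t) by move: t1; rewrite /unitI; lra.
by have := Ht _ h; rewrite /revp subKr.
Qed.

Lemma IsAng_const v a : ang (fun=> v) a -> a = 0.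
Proof.
move=> h; apply: (IsAng_uniq h); case: h => th _ Ht.
exists (fun=> th 0); first by split=> [t|]; [ctac|lra].
by move=> t _; apply: Ht.
Qed.

Lemma concat0 f g : concat f g 0 = f 0.
Proof. by rewrite /concat mulr0 ifT // invr_ge0. Qed.

Lemma concat1 f g : concat f g 1 = g 1.
Proof.
rewrite /concat ifF; last by apply/negP => h; lra.
by rewrite mulr1; congr g; lra.
Qed.

Lemma revp0 f : revp f 0 = f 1. Proof. by rewrite /revp subr0. Qed.
Lemma revp1 f : revp f 1 = f 0. Proof. by rewrite /revp subrr. Qed.

Lemma conjloop0 g f : conjloop g f 0 = g 0.
Proof. by rewrite /conjloop concat0. Qed.

Lemma conjloop1 g f : conjloop g f 1 = g 0.
Proof. by rewrite /conjloop !concat1 revp1. Qed.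

(** The path and its reverse contribute opposite angles, so conjugation is invisible to a
    homomorphism into the reals. *)
Lemma IsAng_conjloop g f c : g 1 = f 0 -> f 0 = f 1 ->
  ang (conjloop g f) c -> ang f c.
Proof.
move=> gf ff /IsAng_concat[|a [b [ha hb ->]]]; first by rewrite concat0.
case/IsAng_concat: hb => [|d [e [hd he ->]]]; first by rewrite revp0 gf ff.
have -> : e = - a by apply/eqP; rewrite -eqr_oppLR eq_sym; apply/eqP/(IsAng_uniq ha)/IsAng_revp.
by rewrite addrC subrK.
Qed.

Lemma npowSS f n : npow f n.+2 = concat f (npow f n.+1).
Proof. by []. Qed.

Lemma npow0 f n : npow f n 0 = f 0.
Proof. by elim: n => [|[|n] IH] //; rewrite npowSS concat0. Qed.

Lemma npow1 f n : f 0 = f 1 -> npow f n 1 = f 0.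
Proof. by move=> ff; elim: n => [|[|n] IH] //; rewrite npowSS concat1. Qed.

(** The assumption on [f] says which angle it can have, not that it has one: for conjugated loops an
    angle becomes available only by restriction from the whole word. *)
Lemma IsAng_npow f n a c : f 0 = f 1 -> (forall b, ang f b -> b = a) ->
  ang (npow f n) c -> c = a * n%:R.
Proof.
move=> ff Hf; elim: n c => [c /IsAng_const ->|[|n] IH c]; first by rewrite mulr0.
  by rewrite mulr1; exact: Hf.
rewrite npowSS => /IsAng_concat[|x [y [/Hf -> /IH -> ->]]].
  by rewrite npow0.
by rewrite [n.+2%:R]mulrS mulrDr mulr1.
Qed.

Lemma zpow0 f n : f 0 = f 1 -> zpow f n 0 = f 0.
Proof. by move=> ff; case: n => n; rewrite /zpow npow0 // revp0. Qed.

Lemma zpow1 f n : f 0 = f 1 -> zpow f n 1 = f 0.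
Proof. by move=> ff; case: n => n; rewrite /zpow npow1 // revp0 ?revp1. Qed.

Lemma IsAng_zpow f (n : int) a c : f 0 = f 1 -> (forall b, ang f b -> b = a) ->
  ang (zpow f n) c -> c = a * n%:~R.
Proof.
move=> ff Hf; case: n => n; first exact: IsAng_npow.
move=> /(@IsAng_npow _ _ (- a)) ->.
- by rewrite NegzE mulrNz mulrN mulNr.
- by rewrite revp0 revp1.
by move=> b /IsAng_revp/Hf <-; rewrite opprK.
Qed.

Lemma IsAng_word g1 g2 f1 f2 (n1 n2 : int) a1 a2 c :
  g1 0 = g2 0 -> g1 1 = f1 0 -> g2 1 = f2 0 -> f1 0 = f1 1 -> f2 0 = f2 1 ->
  ang f1 a1 -> ang f2 a2 ->
  ang (concat (zpow (conjloop g1 f1) n1) (zpow (conjloop g2 f2) n2)) c ->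
  c = a1 * n1%:~R + a2 * n2%:~R.
Proof.
move=> e0 e1 e2 l1 l2 h1 h2 /IsAng_concat[|x [y [hx hy ->]]].
  by rewrite zpow1 ?zpow0 ?conjloop1 ?conjloop0.
congr (_ + _).
  apply: (IsAng_zpow _ _ hx); rewrite ?conjloop1 ?conjloop0 // => b hb.
  by apply: (IsAng_uniq _ h1); exact: IsAng_conjloop hb.
apply: (IsAng_zpow _ _ hy); rewrite ?conjloop1 ?conjloop0 // => b hb.
by apply: (IsAng_uniq _ h2); exact: IsAng_conjloop hb.
Qed.

End LoopAngles.

(** * Wilson loops *)

Lemma I2P (i : 'I_2) : i = 0 \/ i = 1.
Proof. by case: i => [[|[|//]] p]; [left|right]; apply/val_inj. Qed.

Section TwoByTwo.
Context {S : comNzRingType}.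
Implicit Types (A B : 'M[S]_2).

Definition mx2 (a b c d : S) : 'M[S]_2 :=
  \matrix_(i < 2, j < 2) (if i == 0 then (if j == 0 then a else b)
                          else (if j == 0 then c else d)).

Lemma mx2P A B : A 0 0 = B 0 0 -> A 0 1 = B 0 1 -> A 1 0 = B 1 0 ->
  A 1 1 = B 1 1 -> A = B.
Proof.
move=> h1 h2 h3 h4; apply/matrixP => i j.
by case: (I2P i) => ->; case: (I2P j) => ->.
Qed.

Lemma mulmx2E A B i j : (A *m B) i j = A i 0 * B 0 j + A i 1 * B 1 j.
Proof. by rewrite mxE big_ord_recl big_ord1; congr (_ * _ + A i _ * B _ j); apply/val_inj. Qed.

Lemma mxtrace2 A : \tr A = A 0 0 + A 1 1.
Proof. by rewrite /mxtrace big_ord_recl big_ord1; congr (_ + A _ _); apply/val_inj. Qed.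

Lemma mx2_mul a b c d a' b' c' d' : mx2 a b c d *m mx2 a' b' c' d' =
  mx2 (a * a' + b * c') (a * b' + b * d') (c * a' + d * c') (c * b' + d * d').
Proof. by apply: mx2P; rewrite mulmx2E !mxE. Qed.

Lemma mx2_tr a b c d : \tr (mx2 a b c d) = a + d.
Proof. by rewrite mxtrace2 !mxE. Qed.

Lemma mulmxZZ (k l : S) A B : (k *: A) *m (l *: B) = (k * l) *: (A *m B).
Proof. by rewrite -scalemxAl -scalemxAr scalerA. Qed.

Lemma mxtrace_commZ (k : S) P A B :
  \tr ((k *: P) *m ((k *: A) *m (k *: B) - (k *: B) *m (k *: A))) =
  k ^+ 3 * (\tr (P *m A *m B) - \tr (P *m B *m A)).
Proof.
rewrite !mulmxZZ -scalerBr mulmxZZ mxtraceZ mulmxBr !mulmxA linearB /=.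
by rewrite !exprS expr0 mulr1.
Qed.

Lemma mx2_eta A : A = mx2 (A 0 0) (A 0 1) (A 1 0) (A 1 1).
Proof. by apply: mx2P; rewrite mxE. Qed.

End TwoByTwo.

(** * Rank-one matrices attached to vectors, and their chains *)

Section Spinors.
Context {R : realType}.
Local Notation vec := (R * R * R)%type.
Implicit Types (v w : vec) (p q : R[i] * R[i]).

Definition dot v w := v.1.1 * w.1.1 + v.1.2 * w.1.2 + v.2 * w.2.
Definition vnorm v := Num.sqrt (dot v v).

(* |v| - v . sigma, a multiple of the spectral projection of v . sigma onto
   its negative eigenvalue. *)
Definition nmx v : 'M[R[i]]_2 :=
  mx2 (rc (vnorm v - v.2)) (Complex (- v.1.1) v.1.2)
      (Complex (- v.1.1) (- v.1.2)) (rc (vnorm v + v.2)).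

Definition outer p q : 'M[R[i]]_2 :=
  mx2 (p.1 * q.1^*%C) (p.1 * q.2^*%C) (p.2 * q.1^*%C) (p.2 * q.2^*%C).
Definition ip p q : R[i] := p.1^*%C * q.1 + p.2^*%C * q.2.

Lemma dot_ge0 v : 0 <= dot v v.
Proof. by rewrite /dot -!expr2 !addr_ge0 ?sqr_ge0. Qed.

Lemma sqr_vnorm v : vnorm v ^+ 2 = dot v v.
Proof. by rewrite sqr_sqrtr ?dot_ge0. Qed.

Lemma vnorm_ge0 v : 0 <= vnorm v. Proof. exact: sqrtr_ge0. Qed.

Lemma vnorm_gt0 v : 0 < dot v v -> 0 < vnorm v.
Proof. by rewrite sqrtr_gt0. Qed.

Lemma outerM p q p' q' : outer p q *m outer p' q' = ip q p' *: outer p q'.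
Proof. by rewrite mx2_mul; apply: mx2P; rewrite !mxE /ip /=; ring. Qed.

Lemma tr_outer p q : \tr (outer p q) = ip q p.
Proof. by rewrite mx2_tr /ip; ring. Qed.

(** The matrix is positive of rank at most one. The spinor has a real first component, except on the
    ray x = y = 0, z >= 0, where that component vanishes and a second chart is used. A continuous
    choice on the whole sphere does not exist; the Wilson loop does not depend on the choice. *)
Lemma nmx_outer v : exists p, nmx v = outer p p.
Proof.
case: v => -[x y] z; rewrite /nmx /=.
have := sqr_vnorm (x, y, z); have := vnorm_ge0 (x, y, z).
rewrite /dot /=; set r := vnorm _ => r0 rE.
have [h|h] := ltP 0 (r - z).
  pose s := Num.sqrt (r - z).
  have s0 : s != 0 by rewrite gt_eqF // sqrtr_gt0.
  have sE : s * s = r - z by rewrite -expr2 sqr_sqrtr // ltW.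
  exists (rc s, Complex (- x / s) (- y / s)).
  apply: mx2P; rewrite !mxE /=; apply/eqP; rewrite eq_complex /=; apply/andP; split; apply/eqP.
  - by rewrite -sE; ring.
  - by ring.
  - by field.
  - by field.
  - by field.
  - by field.
  - have e : r + z = (x * x + y * y) / (s * s).
      by rewrite sE; apply: (mulIf (lt0r_neq0 h)); rewrite divfK ?gt_eqF //; nra.
    by rewrite e; field.
  - by field.
have zr : z = r by nra.
have x0 : x = 0 by nra.
have y0 : y = 0 by nra.
have r2 : 0 <= r + z by lra.
pose s := Num.sqrt (r + z).
have sE : s * s = r + z by rewrite -expr2 sqr_sqrtr.
exists (0, rc s).
by apply: mx2P; rewrite !mxE /=; apply/eqP; rewrite eq_complex /=; apply/andP; split; apply/eqP; lra.
Qed.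

Lemma tr_nmxM v w : \tr (nmx v *m nmx w) = rc (2 * (vnorm v * vnorm w + dot v w)).
Proof.
rewrite mx2_mul mx2_tr; apply/eqP; rewrite eq_complex /= /dot.
by apply/andP; split; apply/eqP; ring.
Qed.

(** The product of [ip p q] and [ip q p] is the trace in [tr_nmxM], which is positive unless the
    vectors are opposite. *)
Lemma ip_neq0 v w p q : nmx v = outer p p -> nmx w = outer q q ->
  0 < vnorm v * vnorm w + dot v w -> ip p q != 0.
Proof.
move=> hp hq h; apply/eqP => e.
have := tr_nmxM v w; rewrite hp hq outerM e scale0r mxtrace0.
move/eqP; rewrite eq_complex /=; apply/negP; rewrite negb_and; apply/orP; left.
by rewrite lt_eqF // mulr_gt0.
Qed.

(** Up to positive factors, the Bargmann invariant of the chain of lower eigenstates. Leaving the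
    matrices unnormalised changes the modulus but not the argument. *)
Definition wilson (A : nat -> vec) (M : nat) : R[i] := \tr (\prod_(a < M) nmx (A a)).

Lemma prod_outer (B : nat -> 'M[R[i]]_2) (u : nat -> R[i] * R[i]) n :
  (forall a, B a = outer (u a) (u a)) ->
  \prod_(a < n.+1) B a = (\prod_(a < n) ip (u a) (u a.+1)) *: outer (u 0) (u n).
Proof.
move=> hB; elim: n => [|n IH]; first by rewrite big_ord1 big_ord0 scale1r.
rewrite big_ord_recr /= IH hB -mulmxE -scalemxAl outerM scalerA.
by rewrite [in RHS]big_ord_recr.
Qed.

(** The trace supplies the closing overlap. Every spinor occurs once conjugated and once not, so its
    phase cancels. *)
Lemma wilson_outer (A : nat -> vec) (u : nat -> R[i] * R[i]) n :
  (forall a, nmx (A a) = outer (u a) (u a)) ->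
  wilson A n.+1 = (\prod_(a < n) ip (u a) (u a.+1)) * ip (u n) (u 0%N).
Proof.
by move=> hu; rewrite /wilson (prod_outer _ hu) linearZ /= tr_outer.
Qed.

Lemma wilson_neq0 (A : nat -> vec) M : A M.+1 = A 0 ->
  (forall a, (a < M.+1)%N -> 0 < vnorm (A a) * vnorm (A a.+1) + dot (A a) (A a.+1)) ->
  wilson A M.+1 != 0.
Proof.
move=> AM hA.
have [u hu] := choice (fun a => nmx_outer (A a)).
rewrite (wilson_outer _ hu) mulf_neq0 //.
  apply/prodf_neq0 => a _; apply: (ip_neq0 (hu _) (hu _)); apply: hA.
  exact: (leq_trans (ltn_ord a)).
by apply: (ip_neq0 (hu _) (hu _)); rewrite -AM; apply: hA.
Qed.

Section Continuity.
Context {X : topologicalType}.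

Lemma ctat_dot (f g : X -> vec) x : continuous_at x f -> continuous_at x g ->
  continuous_at x (fun y => dot (f y) (g y)).
Proof. by move=> cf cg; rewrite /dot; ctac. Qed.

Lemma ctat_vnorm (f : X -> vec) x : continuous_at x f ->
  continuous_at x (fun y => vnorm (f y)).
Proof.
move=> cf; rewrite /vnorm; apply: (ctat_comp (@sqrt_continuous _)).
exact: ctat_dot.
Qed.

Definition mctat (Q : X -> 'M[R[i]]_2) x := forall i j, cctat (fun y => Q y i j) x.

Lemma mctatM (P Q : X -> 'M[R[i]]_2) x : mctat P x -> mctat Q x ->
  mctat (fun y => P y *m Q y) x.
Proof.
move=> cP cQ i j.
rewrite (_ : (fun y => _) = fun y => P y i 0 * Q y 0 j + P y i 1 * Q y 1 j).
  by apply: cctatD; apply: cctatM.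
by apply: funext => y; rewrite mulmx2E.
Qed.

Lemma mctat_nmx (f : X -> vec) x : continuous_at x f -> mctat (fun y => nmx (f y)) x.
Proof.
move=> cf i j; have cn := ctat_vnorm cf.
have H (u v : X -> R) : continuous_at x u -> continuous_at x v ->
    (forall y, nmx (f y) i j = Complex (u y) (v y)) -> cctat (fun y => nmx (f y) i j) x.
  move=> cu cv e.
  by split; [apply: (ctat_eq _ cu)|apply: (ctat_eq _ cv)] => y; rewrite e.
case: (I2P i) (I2P j) H => -> [] -> H.
- by apply: (H (fun y => vnorm (f y) - (f y).2) (fun=> 0)) => [||y]; [ctac|ctac|rewrite mxE].
- by apply: (H (fun y => - (f y).1.1) (fun y => (f y).1.2)) => [||y]; [ctac|ctac|rewrite mxE].
- by apply: (H (fun y => - (f y).1.1) (fun y => - (f y).1.2)) => [||y]; [ctac|ctac|rewrite mxE].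
by apply: (H (fun y => vnorm (f y) + (f y).2) (fun=> 0)) => [||y]; [ctac|ctac|rewrite mxE].
Qed.

Lemma cctat_wilson (A : X -> nat -> vec) M x :
  (forall a, continuous_at x (fun y => A y a)) -> cctat (fun y => wilson (A y) M) x.
Proof.
move=> cA.
have H : mctat (fun y => \prod_(a < M) nmx (A y a)) x.
  elim: M => [|M IH] i j.
    split; [apply: (ctat_eq (f := fun=> complex.Re ((1 : 'M[R[i]]_2) i j)))|
            apply: (ctat_eq (f := fun=> complex.Im ((1 : 'M[R[i]]_2) i j)))].
    - by move=> y; rewrite big_ord0.
    - by ctac.
    - by move=> y; rewrite big_ord0.
    - by ctac.
  have [h1 h2] := mctatM IH (mctat_nmx (cA M)) i j.
  by split; [apply: (ctat_eq _ h1)|apply: (ctat_eq _ h2)] => y; rewrite big_ord_recr.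
have [h1 h2] := cctatD (H 0 0) (H 1 1).
by split; [apply: (ctat_eq _ h1)|apply: (ctat_eq _ h2)] => y; rewrite /wilson mxtrace2.
Qed.

End Continuity.

End Spinors.

(** * The degree read off from fine Wilson loops, and its homotopy invariance *)

Section Degree.
Context {R : realType}.
Local Notation vec := (R * R * R)%type.

Definition wloop (f : R * R -> vec) (M : nat) (b : R) : R[i] :=
  wilson (fun a => f (a%:R / M%:R, b)) M.

(* Twice pi times the degree of f / |f| as a map from the 2-torus to the
   sphere, read off from the discrete holonomies along the first coordinate. *)
Definition HasDeg (f : R * R -> vec) (al : R) :=
  exists M0, forall M, (M0 <= M)%N -> IsAng (wloop f M) al.

(** Compactness in all three variables, the homotopy parameter included, gives one mesh for which no
    two neighbouring vectors are opposite. *)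
Lemma wloop_neq0 (D : R * R * R -> vec) : continuous D ->
  (forall s k b, unitI s -> unitI k -> unitI b -> 0 < dot (D (s, k, b)) (D (s, k, b))) ->
  (forall s b, unitI s -> unitI b -> D (s, 1, b) = D (s, 0, b)) ->
  exists M0, forall M, (M0 <= M)%N -> forall s b, unitI s -> unitI b ->
    wloop (fun p => D (s, p.1, p.2)) M b != 0.
Proof.
move=> cD pD perD.
(* Zero exactly when the two vectors are opposite or one of them vanishes; at zero shift it equals 2
   |D|^2. *)
pose g (x : (R * R * R) * R) :=
  vnorm (D x.1) * vnorm (D (x.1.1.1, x.1.1.2 + x.2, x.1.2))
  + dot (D x.1) (D (x.1.1.1, x.1.1.2 + x.2, x.1.2)).
have cg : continuous g.
  move=> x; rewrite /g.
  have c1 : continuous_at x (fun x : (R * R * R) * R => D x.1) by ctac.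
  have c2 : continuous_at x (fun x : (R * R * R) * R =>
     D (x.1.1.1, x.1.1.2 + x.2, x.1.2)) by ctac.
  by apply: ctatD; [apply: ctatM; exact: ctat_vnorm|exact: ctat_dot].
have [x _|[[s k] b] /= [hs hk hb]|e e0 He] := @tube R _ _ g compact_cube.
- exact: cg.
- rewrite /g /= addr0 -expr2 sqr_vnorm.
  by rewrite addr_gt0 // pD.
have [N HN] : exists N : nat, N.+1%:R^-1 < e.
  have [N _ /(_ N) H] := near_infty_natSinv_lt (PosNum e0).
  by exists N; apply: H => /=.
exists N.+1 => -[//|M] NM s b hs hb.
have M0 : 0 < M.+1%:R :> R by rewrite ltr0Sn.
apply: wilson_neq0 => [|a aM].
  by rewrite mul0r divff ?gt_eqF //= perD.
have h1 : `|M.+1%:R^-1 : R| < e.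
  rewrite gtr0_norm ?invr_gt0 //; apply: le_lt_trans HN.
  by rewrite lef_pV2 ?posrE ?ltr0Sn // ler_nat.
have := He _ h1 (s, a%:R / M.+1%:R, b) _.
rewrite /g /= -[in a.+1%:R]addn1 natrD mulrDl mul1r; apply; split => //=.
rewrite divr_ge0 //= ler_pdivrMr // mul1r ler_nat; exact: ltnW.
Qed.

Lemma HasDeg_homotopy (D : R * R * R -> vec) al : continuous D ->
  (forall s k b, unitI s -> unitI k -> unitI b -> 0 < dot (D (s, k, b)) (D (s, k, b))) ->
  (forall s b, unitI s -> unitI b -> D (s, 1, b) = D (s, 0, b)) ->
  (forall s k, unitI s -> unitI k -> D (s, k, 0) = D (s, k, 1)) ->
  HasDeg (fun p => D (0, p.1, p.2)) al -> HasDeg (fun p => D (1, p.1, p.2)) al.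
Proof.
move=> cD pD perk perb [M1 H1].
have [M2 H2] := wloop_neq0 cD pD perk.
exists (maxn 1 (maxn M1 M2)) => M; rewrite !geq_max => /and3P[M0 HM1 HM2].
have := @IsAng_homotopy R (fun x => wloop (fun p => D (x.1, p.1, p.2)) M x.2) al.
apply.
- by move=> x; apply: cctat_wilson => a; ctac.
- by move=> s t hs ht; exact: H2.
- move=> s hs; rewrite /wloop /= /wilson; congr (\tr _).
  apply: eq_bigr => a _; rewrite perb //.
  rewrite /unitI divr_ge0 //= ler_pdivrMr ?ltr0n // mul1r ler_nat; exact: ltnW.
by exact: H1.
Qed.

Lemma HasDeg_eq (f g : R * R -> vec) al :
  (forall k b, unitI k -> unitI b -> f (k, b) = g (k, b)) -> HasDeg f al -> HasDeg g al.
Proof.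
move=> fg [M0 H]; exists (maxn 1 M0) => M; rewrite geq_max => /andP[M1 HM].
apply: IsAng_eq (H M HM) => b hb; rewrite /wloop /wilson; congr (\tr _).
apply: eq_bigr => a _; rewrite fg //.
rewrite /unitI divr_ge0 //= ler_pdivrMr ?ltr0n // mul1r ler_nat; exact: ltnW.
Qed.

Lemma HasDeg_const v : 0 < dot v v -> HasDeg (fun=> v) 0.
Proof.
move=> v0; have [M0 H] := @wloop_neq0 (fun=> v) (@cst_continuous _ _ v)
  (fun _ _ _ _ _ _ => v0) (fun _ _ _ _ => erefl).
exists M0 => M HM; have Z0 : unitI (0 : R) by rewrite /unitI; lra.
have [th Ht] := isarg_ex (H M HM 0 0 Z0 Z0).
exists (fun=> th); first by split => [t|]; [ctac|lra].
by move=> t t1; exact: Ht.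
Qed.

End Degree.

(** * Derivatives and integrals in one variable *)

Section Derivatives.
Context {R : realType}.
Implicit Types (f g : R -> R) (x y t a b c d e : R).

Lemma derD f g x a b : is_derive x 1 f a -> is_derive x 1 g b ->
  is_derive x 1 (fun t => f t + g t) (a + b).
Proof. exact: is_deriveD. Qed.

Lemma derB f g x a b : is_derive x 1 f a -> is_derive x 1 g b ->
  is_derive x 1 (fun t => f t - g t) (a - b).
Proof. exact: is_deriveB. Qed.

Lemma derN f x a : is_derive x 1 f a -> is_derive x 1 (fun t => - f t) (- a).
Proof. exact: is_deriveN. Qed.

Lemma derM f g x a b : is_derive x 1 f a -> is_derive x 1 g b ->
  is_derive x 1 (fun t => f t * g t) (a * g x + f x * b).
Proof.
move=> hf hg; have h := is_deriveM hf hg.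
by apply: (is_derive_eq h); rewrite /GRing.scale /= addrC mulrC.
Qed.

Lemma derC (c : R) x : is_derive x 1 (fun=> c) 0.
Proof. exact: is_derive_cst. Qed.

Lemma der_id x : is_derive x 1 (fun t => t) 1.
Proof. exact: is_derive_id. Qed.

Lemma der_comp f g x a b : is_derive x 1 f a -> is_derive (f x) 1 g b ->
  is_derive x 1 (fun t => g (f t)) (b * a).
Proof. by move=> hf hg; apply: is_derive1_comp. Qed.

Lemma derV f x a : f x != 0 -> is_derive x 1 f a ->
  is_derive x 1 (fun t => (f t)^-1) (- a / f x ^+ 2).
Proof.
move=> f0 hf; apply: (is_derive_eq (is_deriveV f0 hf)).
by rewrite /GRing.scale /= mulNr mulrC mulNr.
Qed.

Lemma der_sum n (f : nat -> R -> R) (d : nat -> R) x :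
  (forall j, (j < n)%N -> is_derive x 1 (f j) (d j)) ->
  is_derive x 1 (fun t => \sum_(j < n) f j t) (\sum_(j < n) d j).
Proof.
move=> h; have -> : (fun t => \sum_(j < n) f j t) = \sum_(j < n) f j.
  by apply: funext => t; rewrite fct_sumE.
by apply: is_derive_sum => i; apply: h.
Qed.

Lemma der_cts f x a : is_derive x 1 f a -> continuous_at x f.
Proof. by case=> /derivable1_diffP/differentiable_continuous. Qed.

Lemma der_eq f x a b : a = b -> is_derive x 1 f a -> is_derive x 1 f b.
Proof. by move=> ->. Qed.

Lemma der_uniq f x a b : is_derive x 1 f a -> is_derive x 1 f b -> a = b.
Proof. by move=> [_ <-] [_ <-]. Qed.

Lemma mvt_ge0 f (df : R -> R) a b : a <= b ->
  (forall x, a <= x <= b -> continuous_at x f) ->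
  (forall x, a < x < b -> is_derive x 1 f (df x)) ->
  exists2 c, a <= c <= b & f b - f a = df c * (b - a).
Proof.
move=> ab cf Df.
have H1 x : x \in `]a, b[ -> is_derive x 1 f (df x) by rewrite in_itv /=; exact: Df.
have H2 : ({within `[a, b], continuous f})%classic.
  by apply: continuous_in_subspaceT => x; rewrite inE /= in_itv /=; exact: cf.
have [c] := MVT_segment ab H1 H2.
by rewrite in_itv /= => hc e; exists c.
Qed.

Lemma mvt_any f (df : R -> R) x y : (forall t, is_derive t 1 f (df t)) ->
  exists2 c, `|c - x| <= `|y - x| & f y - f x = df c * (y - x).
Proof.
move=> Df; case: (leP x y) => xy.
  have [c hc e] := mvt_ge0 xy (fun t _ => der_cts (Df t)) (fun t _ => Df t).
  by exists c => //; rewrite !ger0_norm ?subr_ge0 //; lra.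
have [c hc e] := mvt_ge0 (ltW xy) (fun t _ => der_cts (Df t)) (fun t _ => Df t).
exists c; first by rewrite !ler0_norm; lra.
by rewrite -[LHS]opprB e; ring.
Qed.

Lemma mvt_le f (df : R -> R) a b e : a <= b ->
  (forall x, a <= x <= b -> continuous_at x f) ->
  (forall x, a < x < b -> is_derive x 1 f (df x)) ->
  (forall x, a <= x <= b -> `|df x| <= e) -> `|f b - f a| <= e * (b - a).
Proof.
move=> ab cf Df hdf; have [c hc ->] := mvt_ge0 ab cf Df.
rewrite normrM [`|b - a|]ger0_norm ?subr_ge0 //.
by rewrite ler_wpM2r ?subr_ge0 // hdf.
Qed.

Lemma antideriv_right g c : continuous g ->
  exists G, forall x, c < x -> is_derive x 1 G (g x).
Proof.
move=> cg; exists (fun x => Rintegral lebesgue_measure `[c, x] g) => x cx.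
have x1 : x < x + 1 by rewrite ltrDl.
have gi : lebesgue_measure.-integrable `[c, x + 1] (EFin \o g).
  apply: continuous_compact_integrable; first exact: segment_compact.
  exact: continuous_subspaceT.
have [D E] := continuous_FTC1_closed x1 gi cx (cg x).
by apply: DeriveDef; [exact: D|rewrite -derive1E E].
Qed.

Lemma der0_cst f c x y : (forall t, c < t -> is_derive t 1 f 0) -> c < x -> c < y ->
  f x = f y.
Proof.
move=> Df; wlog : x y / x <= y.
  by move=> W cx cy; case: (leP x y) => [|/ltW] h; [exact: W|symmetry; exact: W].
move=> xy cx cy.
have [||u _ e] := @mvt_ge0 f (fun=> 0) x y xy.
- by move=> t /andP[xt _]; apply: der_cts (Df t _); exact: lt_le_trans xt.
- by move=> t /andP[xt _]; apply: Df; exact: lt_trans xt.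
by apply/eqP; rewrite eq_sym -subr_eq0 e mul0r.
Qed.

(** Integrals from a negative integer are antiderivatives to the right of it. Normalised to vanish
    at 0, any two of them agree where both are defined, since their difference has derivative zero
    there; hence they glue to the whole line. *)
Lemma antideriv g : continuous g -> exists G, forall x, is_derive x 1 G (g x).
Proof.
move=> cg.
have [G HG] := choice (fun n : nat => antideriv_right (- n.+1%:R) cg).
pose H n x := G n x - G n 0.
have HH n x : - n.+1%:R < x -> is_derive x 1 (H n) (g x).
  by move=> nx; have h := derB (HG n x nx) (derC (G n 0) x); rewrite subr0 in h.
have Hnm n m x : - n.+1%:R < x -> - m.+1%:R < x -> H n x = H m x.
  move=> nx mx; apply/eqP; rewrite -subr_eq0; apply/eqP.
  have n0 : 0 < n.+1%:R :> R by rewrite ltr0Sn.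
  have m0 : 0 < m.+1%:R :> R by rewrite ltr0Sn.
  transitivity (H n 0 - H m 0); last by rewrite /H !subrr.
  apply: (@der0_cst (fun t => H n t - H m t) (Num.max (- n.+1%:R) (- m.+1%:R)) x 0).
  - move=> t; rewrite gt_max => /andP[nt mt].
    by have h := derB (HH n t nt) (HH m t mt); rewrite subrr in h.
  - by rewrite gt_max nx mx.
  - by rewrite gt_max !oppr_lt0 n0 m0.
pose N (x : R) := Num.bound x.
have NP x : - (N x).+1%:R < x.
  have h : - x < (N x)%:R by apply: unstable.ltrNbound.
  rewrite ltrNl (lt_trans h) // ltr_nat //.
exists (fun x => H (N x) x) => x; pose n := N (x - 1).
have nx : - n.+1%:R < x by apply: lt_trans (NP (x - 1)) _; rewrite ltrBlDr ltrDl.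
apply: near_eq_is_derive (HH n x nx).
near=> t; apply: Hnm => //.
by near: t; exact: lt_nbhsr.
Unshelve. all: by end_near. Qed.

Lemma Rint_FTC g G b : continuous g -> (forall x, is_derive x 1 G (g x)) -> 0 < b ->
  Rintegral lebesgue_measure `[0, b] g = G b - G 0.
Proof.
move=> cg DG b0; rewrite /Rintegral (@continuous_FTC2 R g G 0 b b0) //.
- exact: continuous_subspaceT.
- split=> [x _||].
  + by case: (DG x).
  + by apply: cvg_at_right_filter; exact: der_cts (DG 0).
  + by apply: cvg_at_left_filter; exact: der_cts (DG b).
by move=> x _; rewrite derive1E; case: (DG x).
Qed.

Lemma Rint_scale g b : continuous g -> 0 < b ->
  Rintegral lebesgue_measure `[0, b] g =
  Rintegral lebesgue_measure `[0, 1] (fun t => b * g (b * t)).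
Proof.
move=> cg b0; have [G DG] := antideriv cg.
rewrite (Rint_FTC cg DG b0).
have cg' : continuous (fun t => b * g (b * t)) by move=> t; ctac.
have DG' t : is_derive t 1 (fun t => G (b * t)) (b * g (b * t)).
  have h := der_comp (derM (derC b t) (der_id t)) (DG (b * t)).
  by apply: der_eq h; ring.
by rewrite (Rint_FTC cg' DG' ltr01) mulr1 mulr0.
Qed.

End Derivatives.

(** * The Chern integral as a limit of Wilson loops *)

Section LiftDerivative.
Context {R : realType}.

(** The derivative is Im (f' / f). Near [b] the lift equals its value at [b] plus an arctangent of
    the increment, because both are arguments of the same number and differ by less than pi. *)
Lemma lift_der (f : R -> R[i]) (th : R -> R) (b du dv : R) :
  continuous_at b th -> (\forall t \near b, isarg (th t) (f t)) ->
  is_derive b 1 (fun t => complex.Re (f t)) du ->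
  is_derive b 1 (fun t => complex.Im (f t)) dv ->
  is_derive b 1 th ((complex.Re (f b) * dv - complex.Im (f b) * du)
    / (complex.Re (f b) ^+ 2 + complex.Im (f b) ^+ 2)).
Proof.
move=> cth nf Du Dv.
have fb := nbhs_singleton nf.
have cu := der_cts Du; have cv := der_cts Dv.
set x := complex.Re (f b); set y := complex.Im (f b).
have n0 : 0 < x ^+ 2 + y ^+ 2.
  have := isarg_neq0 fb; rewrite /x /y; case: (f b) => x' y'.
  rewrite eq_complex /= negb_and => /orP[] h.
    by rewrite ltr_pwDl ?sqr_ge0 // exprn_even_gt0.
  by rewrite ltr_wpDl ?sqr_ge0 // exprn_even_gt0.
(* [p] and [q] are the real and imaginary parts of [f t] times the conjugate of [f b], which is a
   positive number at [t = b]. *)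
pose p t := complex.Re (f t) * x + complex.Im (f t) * y.
pose q t := complex.Im (f t) * x - complex.Re (f t) * y.
have pb : p b = x ^+ 2 + y ^+ 2 by rewrite /p -/x -/y; ring.
have qb : q b = 0 by rewrite /q -/x -/y; ring.
have Dp : is_derive b 1 p (du * x + dv * y).
  have h := derD (derM Du (derC x b)) (derM Dv (derC y b)).
  by apply: der_eq h; ring.
have Dq : is_derive b 1 q (dv * x - du * y).
  have h := derB (derM Dv (derC x b)) (derM Du (derC y b)).
  by apply: der_eq h; ring.
have pb0 : p b != 0 by rewrite pb gt_eqF.
have D : is_derive b 1 (fun t => th b + atan (q t / p t)) ((x * dv - y * du) / (x ^+ 2 + y ^+ 2)).
  have h := derD (derC (th b) b) (der_comp (derM Dq (derV pb0 Dp)) (is_derive1_atan _)).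
  apply: der_eq h; rewrite qb pb; field.
  by rewrite gt_eqF.
apply: near_eq_is_derive D.
have npi : 0 < pi / 2 :> R by rewrite divr_gt0 ?pi_gt0.
have pp : 0 < p b by rewrite pb.
have np : \forall t \near b, 0 < p t.
  have cp : continuous_at b p by exact: der_cts Dp.
  exact: (cvgr_gt (p b) cp _ pp).
have nth : \forall t \near b, `|th b - th t| < pi / 2.
  have /cvgrPdist_lt := cth; exact.
near=> t.
have ht : isarg (th t) (f t) by near: t.
have h1 := isargM ht (isarg_conj fb).
have hp : 0 < p t by near: t.
have e : f t * (f b)^*%C = Complex (p t) (q t).
  rewrite /p /q /x /y; case: (f t) => u v; case: (f b) => x' y'.
  by apply/eqP; rewrite eq_complex /=; apply/andP; split; apply/eqP; ring.
rewrite e in h1.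
have h2 := @isarg_parg R (Complex (p t) (q t)) hp.
have h3 : `|th b - th t| < pi / 2 by near: t.
have h4 : - (pi / 2) < parg (Complex (p t) (q t)) < pi / 2.
  by rewrite atan_gtNpi2 atan_ltpi2.
have := isarg_eq_near h1 h2; rewrite /parg /= in h4 *.
move=> <-; first by rewrite addrCA subrr addr0.
by move: h3 h4; rewrite !ltr_norml; lra.
Unshelve. all: by end_near. Qed.

End LiftDerivative.

(** * The logarithmic derivative of a Wilson loop *)

Section WilsonDerivative.
Context {R : realType}.
Local Notation vec := (R * R * R)%type.
Implicit Types (v w x : vec).

(** The triple product, v . (w x x) with the cross product in brackets. *)
Definition det3 v w x := v.1.1 * (w.1.2 * x.2 - w.2 * x.1.2)
  + v.1.2 * (w.2 * x.1.1 - w.1.1 * x.2) + v.2 * (w.1.1 * x.1.2 - w.1.2 * x.1.1).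

Definition vadd v w : vec := (v.1.1 + w.1.1, v.1.2 + w.1.2, v.2 + w.2).

(** For a unit vector this is twice a projection. Unlike [nmx] it is affine in [v], with linear part
    [lmx], so that differentiating it involves no norm. *)
Definition pmx v : 'M[R[i]]_2 :=
  mx2 (rc (1 - v.2)) (Complex (- v.1.1) v.1.2)
      (Complex (- v.1.1) (- v.1.2)) (rc (1 + v.2)).
Definition lmx v : 'M[R[i]]_2 :=
  mx2 (rc (- v.2)) (Complex (- v.1.1) v.1.2)
      (Complex (- v.1.1) (- v.1.2)) (rc v.2).

Lemma vnorm1 v : dot v v = 1 -> vnorm v = 1.
Proof. by move=> h; rewrite /vnorm h sqrtr1. Qed.

Lemma nmx_unit v : dot v v = 1 -> nmx v = pmx v.
Proof. by move=> /vnorm1 h; rewrite /nmx h. Qed.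

Lemma pmx_sqr v : dot v v = 1 -> pmx v *m pmx v = rc 2 *: pmx v.
Proof.
move=> h; have [p hp] := nmx_outer v; rewrite nmx_unit // in hp.
rewrite hp outerM -tr_outer -hp mx2_tr; congr (_ *: _).
by apply/eqP; rewrite eq_complex /=; apply/andP; split; apply/eqP; ring.
Qed.

Lemma Im_tr_link v x w :
  complex.Im (\tr (pmx v *m lmx x *m pmx w)) = - 2 * det3 v x w.
Proof. by rewrite !mx2_mul mx2_tr /= /det3; ring. Qed.

Lemma tr_lmx_pmx v w : \tr (lmx v *m pmx w) = rc (2 * dot v w).
Proof.
rewrite mx2_mul mx2_tr /dot; apply/eqP; rewrite eq_complex /=.
by apply/andP; split; apply/eqP; ring.
Qed.

Lemma lmxD v w : lmx (vadd v w) = lmx v + lmx w.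
Proof.
by apply: mx2P; rewrite !mxE /=; apply/eqP; rewrite eq_complex /=; apply/andP;
  split; apply/eqP; ring.
Qed.

(* Both projections have rank one, so that p X q is a multiple of p q. *)
Lemma link v w (X : 'M[R[i]]_2) : dot v v = 1 -> dot w w = 1 -> 0 < 1 + dot v w ->
  pmx v *m X *m pmx w =
  (\tr (pmx v *m X *m pmx w) * rc ((2 * (1 + dot v w))^-1)) *: (pmx v *m pmx w).
Proof.
move=> hv hw hvw.
have := tr_nmxM v w; rewrite !vnorm1 // mulr1 !nmx_unit // => T.
have [p] := nmx_outer v; rewrite nmx_unit // => hp.
have [q] := nmx_outer w; rewrite nmx_unit // => hq.
rewrite {}hp {}hq in T *; rewrite outerM linearZ /= tr_outer in T.
pose c := p.1^*%C * (X 0 0 * q.1 + X 0 1 * q.2) + p.2^*%C * (X 1 0 * q.1 + X 1 1 * q.2).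
have -> : outer p p *m X *m outer q q = c *: outer p q.
  by rewrite [X]mx2_eta !mx2_mul; apply: mx2P; rewrite !mxE /= /c; ring.
rewrite outerM mxtraceZ /= tr_outer scalerA; congr (_ *: _).
have E : ip p q * ip q p * rc ((2 * (1 + dot v w))^-1) = 1.
  rewrite T; apply/eqP; rewrite eq_complex /= !mulr0 mul0r subr0 addr0 eqxx andbT.
  by rewrite divff // gt_eqF // mulr_gt0.
by rewrite -[LHS]mulr1 -E; ring.
Qed.

Definition cder (f : R -> R[i]) (b : R) d :=
  is_derive b 1 (fun t => complex.Re (f t)) (complex.Re d) /\
  is_derive b 1 (fun t => complex.Im (f t)) (complex.Im d).

Definition mder (Q : R -> 'M[R[i]]_2) (b : R) (D : 'M[R[i]]_2) :=
  forall i j, cder (fun t => Q t i j) b (D i j).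

Definition vder (n : R -> vec) (b : R) (d : vec) :=
  [/\ is_derive b 1 (fun t => (n t).1.1) d.1.1,
      is_derive b 1 (fun t => (n t).1.2) d.1.2 &
      is_derive b 1 (fun t => (n t).2) d.2].

Lemma der_funeq (f g : R -> R) (b d : R) : f =1 g -> is_derive b 1 f d -> is_derive b 1 g d.
Proof. by move=> /funext ->. Qed.

Lemma cderD f g b c d : cder f b c -> cder g b d -> cder (fun t => f t + g t) b (c + d).
Proof.
move=> [f1 f2] [g1 g2]; split.
  by rewrite Re_add; apply: der_funeq (derD f1 g1) => t; rewrite Re_add.
by rewrite Im_add; apply: der_funeq (derD f2 g2) => t; rewrite Im_add.
Qed.

Lemma cderM f g b c d : cder f b c -> cder g b d ->
  cder (fun t => f t * g t) b (c * g b + f b * d).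
Proof.
move=> [f1 f2] [g1 g2]; split.
  apply: (@der_funeq (fun t => complex.Re (f t) * complex.Re (g t) - complex.Im (f t) * complex.Im (g t))).
    by move=> t; rewrite Re_mul.
  by apply: der_eq (derB (derM f1 g1) (derM f2 g2)); rewrite Re_add !Re_mul; ring.
apply: (@der_funeq (fun t => complex.Re (f t) * complex.Im (g t) + complex.Im (f t) * complex.Re (g t))).
  by move=> t; rewrite Im_mul.
by apply: der_eq (derD (derM f1 g2) (derM f2 g1)); rewrite Im_add !Im_mul; ring.
Qed.

Lemma mderM P Q b C D : mder P b C -> mder Q b D ->
  mder (fun t => P t *m Q t) b (C *m Q b + P b *m D).
Proof.
move=> hP hQ i j.
rewrite (_ : (fun t => _) = fun t => P t i 0 * Q t 0 j + P t i 1 * Q t 1 j); last first.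
  by apply: funext => t; rewrite mulmx2E.
have h := cderD (cderM (hP i 0) (hQ 0 j)) (cderM (hP i 1) (hQ 1 j)).
have -> // : (C *m Q b + P b *m D) i j =
   C i 0 * Q b 0 j + P b i 0 * D 0 j + (C i 1 * Q b 1 j + P b i 1 * D 1 j).
by rewrite mxE !mulmx2E; ring.
Qed.

Lemma mder_pmx n b d : vder n b d -> mder (fun t => pmx (n t)) b (lmx d).
Proof.
case=> d1 d2 d3 i j.
have H (u v : R -> R) : is_derive b 1 u (complex.Re (lmx d i j)) ->
    is_derive b 1 v (complex.Im (lmx d i j)) ->
    (forall t, pmx (n t) i j = Complex (u t) (v t)) -> cder (fun t => pmx (n t) i j) b (lmx d i j).
  move=> cu cv e.
  by split; [apply: der_funeq cu|apply: der_funeq cv] => t; rewrite e.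
case: (I2P i) (I2P j) H => -> [] -> H.
- apply: (H (fun t => 1 - (n t).2) (fun=> 0)) => [||y]; rewrite mxE //=.
    by apply: der_eq (derB (derC 1 b) d3); rewrite sub0r.
  exact: derC.
- by apply: (H (fun t => - (n t).1.1) (fun t => (n t).1.2)) => [||y]; rewrite mxE //=; exact: derN.
- by apply: (H (fun t => - (n t).1.1) (fun t => - (n t).1.2)) => [||y]; rewrite mxE //=; exact: derN.
apply: (H (fun t => 1 + (n t).2) (fun=> 0)) => [||y]; rewrite mxE //=.
  by apply: der_eq (derD (derC 1 b) d3); rewrite add0r.
exact: derC.
Qed.

Lemma vder_unit n b d : (forall t, dot (n t) (n t) = 1) -> vder n b d -> dot d (n b) = 0.
Proof.
move=> hn [d1 d2 d3].
have h := derD (derD (derM d1 d1) (derM d2 d2)) (derM d3 d3).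
have h' : is_derive b 1 (fun t => (n t).1.1 * (n t).1.1 + (n t).1.2 * (n t).1.2 + (n t).2 * (n t).2) 0.
  by apply: der_funeq (derC 1 b) => t; rewrite -(hn t).
by have := der_uniq h h'; rewrite /dot; lra.
Qed.

Lemma cderZ (c : R[i]) f b d : cder f b d -> cder (fun t => c * f t) b (c * d).
Proof.
move=> h; have hc : cder (fun=> c) b 0 by split; exact: derC.
by have := cderM hc h; rewrite mul0r add0r.
Qed.

Lemma cder_tr Q b D : mder Q b D -> cder (fun t => \tr (Q t)) b (\tr D).
Proof.
move=> h; rewrite mxtrace2; have [h1 h2] := cderD (h 0 0) (h 1 1).
by split; [apply: der_funeq h1|apply: der_funeq h2] => t; rewrite mxtrace2.
Qed.

Lemma rc_half2 : rc 2^-1 * rc 2 = 1 :> R[i].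
Proof.
by apply/eqP; rewrite eq_complex /= !mulr0 mul0r subr0 addr0 mulVf ?pnatr_eq0 // !eqxx.
Qed.

(** This is the derivative of [pmx_sqr]: a tangent vector of the sphere gives an off-diagonal
    variation of the projection. It splits the derivative of a factor into two halves, one absorbed
    by each adjacent link. *)
Lemma lmx_pmx_half v d : dot v v = 1 -> dot d v = 0 ->
  lmx d = rc 2^-1 *: (lmx d *m pmx v) + rc 2^-1 *: (pmx v *m lmx d).
Proof.
move=> h1 h2; have := h1; have := h2; rewrite /dot => e2 e1.
rewrite !mx2_mul; apply: mx2P; rewrite !mxE /=; apply/eqP; rewrite eq_complex /=; apply/andP;
  split; apply/eqP; lra.
Qed.

(** The factor by which inserting [lmx x] between two neighbouring projections multiplies their
    product, according to [link]. *)
Let link_coef v w x : R[i] :=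
  \tr (pmx v *m lmx x *m pmx w) * rc ((2 * (1 + dot v w))^-1).

Lemma Im_link_coef v w x : complex.Im (link_coef v w x) = - (det3 v x w / (1 + dot v w)).
Proof.
rewrite /link_coef Im_mul Im_tr_link /= mulr0 add0r invfM.
by set i := (1 + dot v w)^-1; field.
Qed.

(* The endpoint terms are kept on both sides; they cancel in the trace when the
   chain closes up. *)
Lemma chain_der (n : nat -> R -> vec) (d : nat -> vec) b M :
  (forall a t, dot (n a t) (n a t) = 1) -> (forall a, vder (n a) b (d a)) ->
  (forall a, (a < M)%N -> 0 < 1 + dot (n a b) (n a.+1 b)) ->
  let P t := \prod_(a < M.+1) pmx (n a t) in
  mder P b (rc 2^-1 *: (lmx (d 0) *m P b)
    + (rc 2^-1 * \sum_(a < M) link_coef (n a b) (n a.+1 b) (vadd (d a) (d a.+1))) *: P b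
    + rc 2^-1 *: (P b *m lmx (d M))).
Proof.
move=> hn hd; elim: M => [|M IH] hM P.
  have -> : P = fun t => pmx (n 0 t) by apply: funext => t; rewrite /P big_ord1.
  rewrite big_ord0 mulr0 scale0r addr0 -lmx_pmx_half //; first exact: mder_pmx.
  exact: vder_unit.
have {IH} := IH (fun a aM => hM a (ltnW aM)).
set Q := fun t => \prod_(a < M.+1) pmx (n a t) => IH.
have PE t : P t = Q t *m pmx (n M.+1 t) by rewrite /P big_ord_recr.
(* The last factor of the chain can be repeated at the price of 2, which makes a full link available
   to the right of [Q b]. *)
have QM : Q b *m pmx (n M b) = rc 2 *: Q b.
  by rewrite /Q big_ord_recr /= -!mulmxE -mulmxA pmx_sqr // -scalemxAr.
have h := mderM IH (mder_pmx (hd M.+1)).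
have -> : P = fun t => Q t *m pmx (n M.+1 t) by apply: funext.
set L := _ *m _ + _ in h.
rewrite (_ : _ + _ = L) //.
set l := link_coef (n M b) (n M.+1 b) (vadd (d M) (d M.+1)).
have E1 : Q b *m lmx (vadd (d M) (d M.+1)) *m pmx (n M.+1 b) = l *: (Q b *m pmx (n M.+1 b)).
  have := link (lmx (vadd (d M) (d M.+1))) (hn M b) (hn M.+1 b) (hM M (ltnSn _)).
  rewrite -/(link_coef _ _ _) -/l => /(congr1 (mulmx (Q b))).
  rewrite !mulmxA -scalemxAr !mulmxA QM -!scalemxAl => /(congr1 ( *:%R (rc 2^-1))).
  rewrite !scalerA rc_half2 scale1r => ->.
  by rewrite mulrCA rc_half2 mulr1.
rewrite big_ord_recr /= -/l /L.
(* Half of the new derivative joins the former right endpoint term to form a complete link, namely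
   [E1]; the other half is the new endpoint term. *)
rewrite {2}[lmx (d M.+1)](lmx_pmx_half (hn M.+1 b)); last exact: vder_unit.
rewrite mulrDr scalerDl -[(_ * l) *: _]scalerA -E1 lmxD !(mulmxDl, mulmxDr, scalerDr).
rewrite -!(scalemxAl, scalemxAr) !mulmxA.
by move: (_ *: _) (_ *: _) (_ *: _) (_ *: _) (_ *: _) => *; rewrite !addrA.
Qed.

Lemma wilson_der (n : nat -> R -> vec) (d : nat -> vec) b M :
  (forall a t, dot (n a t) (n a t) = 1) -> (forall a, vder (n a) b (d a)) ->
  (forall a, (a < M.+1)%N -> 0 < 1 + dot (n a b) (n a.+1 b)) ->
  n M.+1 = n 0 -> d M.+1 = d 0 ->
  exists2 l : R[i], cder (fun t => wilson (n^~ t) M.+1) b (l * wilson (n^~ b) M.+1) &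
    complex.Im l = \sum_(a < M.+1)
      - 2^-1 * (det3 (n a b) (vadd (d a) (d a.+1)) (n a.+1 b) / (1 + dot (n a b) (n a.+1 b))).
Proof.
move=> hn hd hM nM dM.
have [u hu] := choice (@nmx_outer R).
(* One factor more than in the Wilson loop: the first matrix is repeated at the end. The trace is
   thereby doubled, and [P t] becomes a multiple of [pmx (n 0 t)]. *)
pose P t := \prod_(a < M.+2) pmx (n a t).
have hP t : P t = (\prod_(a < M.+1) ip (u (n a t)) (u (n a.+1 t))) *: pmx (n 0 t).
  rewrite -[pmx (n 0 t)]nmx_unit // hu -[in RHS]nM.
  rewrite /P (prod_outer (B := fun a => pmx (n a t)) (u := fun a => u (n a t))) ?nM // => a.
  by rewrite -nmx_unit.
have tp v : \tr (pmx v) = rc 2.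
  by rewrite mx2_tr; apply/eqP; rewrite eq_complex /=; apply/andP; split; apply/eqP; ring.
have W t : wilson (n^~ t) M.+1 = rc 2^-1 * \tr (P t).
  rewrite (wilson_outer (u := fun a => u (n a t))) // hP mxtraceZ tp.
  by rewrite mulrCA rc_half2 mulr1 big_ord_recr /= nM.
have D := cder_tr (chain_der hn hd hM).
rewrite -/P !mxtraceD !mxtraceZ dM [\tr (P b *m _)]mxtrace_mulC in D.
(* A tangent vector is orthogonal to its base point, so each endpoint term has trace zero. *)
have Z : \tr (lmx (d 0) *m P b) = 0.
  rewrite hP -scalemxAr mxtraceZ tr_lmx_pmx (vder_unit (hn 0) (hd 0)) mulr0.
  by rewrite (_ : rc 0 = 0) ?mulr0.
rewrite Z !mulr0 add0r addr0 in D.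
set S := \sum_(a < M.+1) link_coef _ _ _ in D.
exists (rc 2^-1 * S).
  have [h1 h2] := cderZ (rc 2^-1) D.
  have E : rc 2^-1 * S * wilson (n^~ b) M.+1 = rc 2^-1 * (rc 2^-1 * S * \tr (P b)).
    by rewrite W; ring.
  by rewrite E; split; [apply: der_funeq h1|apply: der_funeq h2] => t; rewrite W.
rewrite Im_mul /= mul0r addr0 /S (big_morph _ (@Im_add R) (erefl _)) mulr_sumr.
by apply: eq_bigr => a _; rewrite Im_link_coef mulrN mulNr.
Qed.

(** From W' = l W one gets Im (W' / W) = Im l, so the spinor overlaps disappear and only a sum over
    links is left. *)
Lemma lift_wilson_der (n : nat -> R -> vec) (d : nat -> vec) (th : R -> R) b M :
  (forall a t, dot (n a t) (n a t) = 1) -> (forall a, vder (n a) b (d a)) ->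
  (forall a, (a < M.+1)%N -> 0 < 1 + dot (n a b) (n a.+1 b)) ->
  n M.+1 = n 0 -> d M.+1 = d 0 ->
  continuous_at b th -> (\forall t \near b, isarg (th t) (wilson (n^~ t) M.+1)) ->
  is_derive b 1 th (\sum_(a < M.+1)
    - 2^-1 * (det3 (n a b) (vadd (d a) (d a.+1)) (n a.+1 b) / (1 + dot (n a b) (n a.+1 b)))).
Proof.
move=> hn hd hM nM dM cth hth.
have [l [h1 h2] <-] := wilson_der hn hd hM nM dM.
apply: der_eq (lift_der cth hth h1 h2).
have := isarg_neq0 (nbhs_singleton hth).
case: (wilson _ _) => x y; case: l {h1 h2} => l m /=.
rewrite eq_complex /= negb_and => h.
have n0 : x ^+ 2 + y ^+ 2 != 0.
  by rewrite paddr_eq0 ?sqr_ge0 // !sqrf_eq0 negb_and.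
by field.
Qed.

End WilsonDerivative.

(** * The winding angle as an integral of the curvature *)

Section GaussBonnet.
Context {R : realType}.
Local Notation vec := (R * R * R)%type.

(** The difference quotient in the first variable, completed by the derivative at zero step; by the
    mean value theorem it is continuous there. *)
Let quot (g gk : R * R -> R) (y : (R * R) * R) : R :=
  if y.2 == 0 then gk y.1 else (g (y.1.1 + y.2, y.1.2) - g y.1) / y.2.

Lemma quot_cts (g gk : R * R -> R) :
  (forall k b : R, is_derive k 1 (fun t => g (t, b)) (gk (k, b))) -> continuous gk ->
  forall x, continuous_at (x, 0) (quot g gk).
Proof.
move=> Dg cgk x; apply/cvgrPdist_lt => e e0.
have /cvgrPdist_lt/(_ e e0) := cgk x.
rewrite /quot /= eqxx => /nbhs_ballP[r /= r0 Hr].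
have r2 : 0 < r / 2 by rewrite divr_gt0.
apply: filterS (nbhsx_ballx (x, 0 : R) _ r2) => -[[k b] h] /= [[/= b1 b2] b3].
rewrite /ball /= in b1 b2 b3.
case: x Hr b1 b2 => k0 b0 Hr /= b1 b2.
rewrite sub0r normrN in b3.
have [h0|hn0] := eqVneq h 0.
  apply: Hr; split => /=; rewrite /ball /=; lra.
have [c hc ->] := mvt_any k (k + h) (Dg^~ b).
rewrite addrAC subrr add0r in hc *.
rewrite mulfK //; apply: Hr; split => /=; rewrite /ball /=; last by lra.
rewrite (_ : k0 - c = (k0 - k) - (c - k)); last by ring.
by apply: le_lt_trans (ler_normB _ _) _; lra.
Qed.

Variables (n nk nb : R * R -> vec).
Hypotheses (n1 : forall p, dot (n p) (n p) = 1) (cn : continuous n)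
  (cnk : continuous nk) (cnb : continuous nb)
  (Dk : forall k b, vder (fun t => n (t, b)) k (nk (k, b)))
  (Db : forall k b, vder (fun t => n (k, t)) b (nb (k, b))).

(** Half of the pulled-back area form of the sphere, so that its integral is 2 pi times the
    degree. *)
Definition beta p := 2^-1 * det3 (n p) (nk p) (nb p).

(** Writing the increment of [n] as [h] times a difference quotient takes one factor [h] out of the
    triple product. What remains is continuous at [h = 0], with value [beta]. *)
Lemma link_estimate e : 0 < e -> exists2 r : R, 0 < r &
  forall h, 0 < h < r -> forall k b, unitI k -> unitI b ->
  0 < 1 + dot (n (k, b)) (n (k + h, b)) /\
  `|- 2^-1 * (det3 (n (k, b)) (vadd (nb (k, b)) (nb (k + h, b))) (n (k + h, b))
      / (1 + dot (n (k, b)) (n (k + h, b)))) - h * beta (k, b)| <= h * e.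
Proof.
move=> e0.
pose q1 := quot (fun p => (n p).1.1) (fun p => (nk p).1.1).
pose q2 := quot (fun p => (n p).1.2) (fun p => (nk p).1.2).
pose q3 := quot (fun p => (n p).2) (fun p => (nk p).2).
have c1 x : continuous_at (x, 0) q1.
  by apply: quot_cts => [k b|y]; [case: (Dk k b)|ctac].
have c2 x : continuous_at (x, 0) q2.
  by apply: quot_cts => [k b|y]; [case: (Dk k b)|ctac].
have c3 x : continuous_at (x, 0) q3.
  by apply: quot_cts => [k b|y]; [case: (Dk k b)|ctac].
pose E y : vec := (q1 y, q2 y, q3 y).
pose sh (y : (R * R) * R) := (y.1.1 + y.2, y.1.2).
(* The triple product is split at the sum of the two derivatives. In the first term the far vector
   is expanded around the near one, in the second the near one around the far one; the repeated
   vectors drop out. *)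
pose psi y := - 2^-1 * (det3 (n y.1) (nb y.1) (E y) - det3 (E y) (nb (sh y)) (n (sh y)))
  / (1 + dot (n y.1) (n (sh y))).
(* One positive function encodes both claims, closeness to [beta] and neighbours that are not
   opposite, so that a single radius serves for both. *)
pose f y := Num.min (e ^+ 2 - (psi y - beta y.1) ^+ 2) (1 + dot (n y.1) (n (sh y))).
have E0 x : E (x, 0) = nk x.
  by rewrite /E /q1 /q2 /q3 /quot /= eqxx; case: (nk x) => -[].
have sh0 x : sh (x, 0) = x by rewrite /sh addr0; case: x.
have psi0 x : psi (x, 0) = beta x.
  by rewrite /psi E0 sh0 /= n1 /beta /det3; field.
have csh y : continuous_at y (fun y => n (sh y)).
  by rewrite /sh; ctac.
have cshb y : continuous_at y (fun y => nb (sh y)).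
  by rewrite /sh; ctac.
have cdet (u v w : (R * R) * R -> vec) y : continuous_at y u -> continuous_at y v ->
    continuous_at y w -> continuous_at y (fun y => det3 (u y) (v y) (w y)).
  by move=> cu cv cw; rewrite /det3; ctac.
have [x _|x _|r r0 Hr] := @tube R _ _ f compact_square.
- have cE : continuous_at (x, 0) E.
    by rewrite /E; move: (c1 x) (c2 x) (c3 x) => *; ctac.
  have h1 := csh (x, 0); have h2 := cshb (x, 0).
  have h3 : continuous_at (x, 0 : R) (fun y => n y.1) by ctac.
  have h4 : continuous_at (x, 0 : R) (fun y => nb y.1) by ctac.
  have h5 : continuous_at (x, 0 : R) (fun y => nk y.1) by ctac.
  have hd := ctat_dot h3 h1.
  have g1 := cdet _ _ _ _ h3 h4 cE.
  have g2 := cdet _ _ _ _ cE h2 h1.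
  have g3 := cdet _ _ _ _ h3 h5 h4.
  have hV : continuous_at (x, 0) (fun y => (1 + dot (n y.1) (n (sh y)))^-1).
    by apply: ctatV; [rewrite sh0 n1; apply: lt0r_neq0; lra|ctac].
  by rewrite /f /psi /beta; ctac.
- rewrite /f psi0 sh0 n1 subrr expr0n /= subr0 lt_min exprn_gt0 //=; lra.
exists r => // h /andP[h0 hr] k b hk hb.
have := Hr h _ (k, b) (conj hk hb).
rewrite gtr0_norm // => /(_ hr); rewrite /f /sh /= lt_min => /andP[hf hp]; split => //.
set d := det3 _ _ _.
have -> : - 2^-1 * (d / (1 + dot (n (k, b)) (n (k + h, b)))) = h * psi ((k, b), h).
  rewrite /psi /sh /= mulrA [RHS]mulrA; congr (_ / _).
  have hE : h != 0 by rewrite gt_eqF.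
  have e1 : (n (k + h, b)).1.1 = (n (k, b)).1.1 + h * q1 (k, b, h).
    by rewrite /q1 /quot /= (negPf hE); field.
  have e2 : (n (k + h, b)).1.2 = (n (k, b)).1.2 + h * q2 (k, b, h).
    by rewrite /q2 /quot /= (negPf hE); field.
  have e3 : (n (k + h, b)).2 = (n (k, b)).2 + h * q3 (k, b, h).
    by rewrite /q3 /quot /= (negPf hE); field.
  by rewrite /d /det3 /vadd /= e1 e2 e3; ring.
rewrite -mulrBr normrM [`|h|]gtr0_norm // ler_pM2l // ler_norml.
by move: hf; move: (psi _ - _) => u hf; apply/andP; split; nra.
Qed.

Lemma cts_beta : continuous beta.
Proof. by move=> p; rewrite /beta /det3; ctac. Qed.

Hypothesis per_n : forall b, n (1, b) = n (0, b).

Lemma per_nb b : nb (1, b) = nb (0, b).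
Proof.
have [d1 d2 d3] := Db 1 b; have [d1' d2' d3'] := Db 0 b.
have e : (fun t => n (1, t)) = (fun t => n (0, t)) by apply: funext.
have f1 : (fun t => (n (1, t)).1.1) = (fun t => (n (0, t)).1.1) by apply: funext => t; rewrite per_n.
have f2 : (fun t => (n (1, t)).1.2) = (fun t => (n (0, t)).1.2) by apply: funext => t; rewrite per_n.
have f3 : (fun t => (n (1, t)).2) = (fun t => (n (0, t)).2) by apply: funext => t; rewrite per_n.
rewrite f1 in d1; rewrite f2 in d2; rewrite f3 in d3.
move: (der_uniq d1 d1') (der_uniq d2 d2') (der_uniq d3 d3').
by case: (nb (1, b)) (nb (0, b)) => -[x y] z [[x' y'] z'] /= -> -> ->.
Qed.

Let G_ex : exists G : R -> R -> R, forall k t : R, is_derive t 1 (G k) (beta (k, t)).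
Proof.
have [G HG] := choice (fun k : R => antideriv (g := fun t => beta (k, t))
  (ltac:(have := cts_beta => cb t; ctac))).
by exists G.
Qed.

Section Integral.
Variable G : R -> R -> R.
Hypothesis DG : forall k t : R, is_derive t 1 (G k) (beta (k, t)).
Let I k := G k 1 - G k 0.

Lemma inner_diff (e k k' : R) : (forall t, unitI t -> `|beta (k, t) - beta (k', t)| <= e) ->
  `|I k - I k'| <= e.
Proof.
move=> H.
have := @mvt_le R (fun t => G k t - G k' t) (fun t => beta (k, t) - beta (k', t)) 0 1 e ler01.
rewrite subr0 mulr1 /I (_ : G k 1 - G k' 1 - _ = G k 1 - G k 0 - (G k' 1 - G k' 0)); last by ring.
apply; last exact: H.
by move=> t _; exact: der_cts (derB (DG k t) (DG k' t)).
Qed.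

Lemma inner_cts : continuous I.
Proof.
move=> k0; apply/cvgrPdist_le => e e0.
have cb := cts_beta.
have [t _|t _|r r0 Hr] := @tube R R `[0, 1]%classic
  (fun y => e ^+ 2 - (beta (k0, y.1) - beta (k0 + y.2, y.1)) ^+ 2) (@segment_compact _ _ _).
- by ctac.
- by rewrite /= addr0 subrr expr0n subr0 exprn_gt0.
apply: filterS (nbhsx_ballx k0 r r0) => k /= hk.
apply: inner_diff => t t1.
have := Hr (k - k0) _ t _; rewrite /= addrCA subrr addr0 in_itv /= distrC => /(_ hk t1).
by move: (beta _ - beta _) => u hu; rewrite ler_norml; apply/andP; split; nra.
Qed.

Lemma inner_unif (e : R) : 0 < e -> exists2 r : R, 0 < r &
  forall h, `|h| < r -> forall k, unitI k -> `|I (k + h) - I k| <= e.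
Proof.
move=> e0; have cb := cts_beta.
have [x _|x _|r r0 Hr] := @tube R _ _
  (fun y : (R * R) * R => e ^+ 2 - (beta (y.1.1 + y.2, y.1.2) - beta y.1) ^+ 2) compact_square.
- by ctac.
- by rewrite /= addr0 -surjective_pairing subrr expr0n subr0 exprn_gt0.
exists r => // h hr k hk; apply: inner_diff => t t1.
have := Hr h hr (k, t) (conj hk t1); rewrite /=.
by move: (beta _ - beta _) => u hu; rewrite ler_norml; apply/andP; split; nra.
Qed.

(** Both sides are compared with the same Riemann sum of [I] in the first variable: the total change
    of a lift through [link_estimate], and [J 1 - J 0] through the mean value theorem on each
    cell. *)
Lemma HasDeg_inner (J : R -> R) al : (forall k : R, is_derive k 1 J (I k)) -> HasDeg n al ->
  al = J 1 - J 0.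
Proof.
move=> DJ [M0 HM0].
apply/eqP; rewrite -subr_eq0 -normr_le0; apply/ler_addgt0Pl => e' e'0.
rewrite addr0; pose e := e' / 2.
have e0 : 0 < e by rewrite divr_gt0.
have [r r0 Hr] := link_estimate e0.
have [s s0 Hs] := inner_unif e0.
have [N HN] : exists N : nat, N.+1%:R^-1 < Num.min r s.
  have rs0 : 0 < Num.min r s by rewrite lt_min r0.
  have [N _ /(_ N) H] := near_infty_natSinv_lt (PosNum rs0).
  by exists N; apply: H => /=.
pose M := maxn M0 N.
pose h : R := M.+1%:R^-1.
have Mp : 0 < M.+1%:R :> R by rewrite ltr0Sn.
have h0 : 0 < h by rewrite invr_gt0.
have hN : h <= N.+1%:R^-1.
  by rewrite lef_pV2 ?posrE ?ltr0Sn // ler_nat ltnS leq_maxr.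
have [hr hs] : h < r /\ h < s.
  by have := le_lt_trans hN HN; rewrite lt_min => /andP[].
have hM : M.+1%:R * h = 1 by rewrite mulfV // gt_eqF.
have [th [cth <-] Hth] := HM0 M.+1 (leqW (leq_maxl _ _)).
pose k (a : nat) : R := a%:R * h.
have kS a : k a.+1 = k a + h by rewrite /k mulrSr mulrDl mul1r.
have ku a : (a <= M.+1)%N -> unitI (k a).
  move=> aM; rewrite /unitI /k mulr_ge0 ?(ltW h0) //=.
  have : a%:R * h <= M.+1%:R * h by rewrite ler_wpM2r ?(ltW h0) // ler_nat.
  by rewrite hM.
pose dth (b : R) : R := \sum_(a < M.+1) - 2^-1 * (det3 (n (k a, b)) (vadd (nb (k a, b)) (nb (k a.+1, b))) (n (k a.+1, b))
   / (1 + dot (n (k a, b)) (n (k a.+1, b)))).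
(* Only in the open interval, since [th] is known to be an argument of the Wilson loop on the unit
   interval alone. *)
have Dth (b : R) : 0 < b < 1 -> is_derive b 1 th (dth b).
  move=> hb; have ub : unitI b by rewrite /unitI; lra.
  apply: (@lift_wilson_der R (fun a t => n (k a, t)) (fun a => nb (k a, b)) th b M).
  - by [].
  - by move=> a; exact: Db.
  - move=> a aM; rewrite kS; apply: (proj1 (Hr h _ _ _ _ _)) => //; first by rewrite h0.
    exact/ku/ltnW.
  - by apply: funext => t; rewrite /k hM mul0r per_n.
  - by rewrite /k hM mul0r per_nb.
  - exact: cth.
  near=> t; have ht : unitI t.
    rewrite /unitI; apply/andP; split; apply: ltW; near: t.
      by apply: lt_nbhsr; case/andP: hb.
    by apply: lt_nbhsl; case/andP: hb.
  exact: Hth.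
(* The derivative of the difference is a sum of [M.+1] link errors of size at most [h * e] each, and
   [M.+1] times [h] is 1. *)
have S1 : `|(th 1 - \sum_(a < M.+1) h * G (k a) 1) - (th 0 - \sum_(a < M.+1) h * G (k a) 0)| <= e.
  have := @mvt_le R (fun t => th t - \sum_(a < M.+1) h * G (k a) t)
    (fun t => dth t - \sum_(a < M.+1) h * beta (k a, t)) 0 1 e ler01.
  have DS : forall t : R, is_derive t 1 (fun u => \sum_(a < M.+1) h * G (k a) u) (\sum_(a < M.+1) h * beta (k a, t)).
    move=> t; apply: (@der_sum R M.+1 (fun a t => h * G (k a) t) (fun a => h * beta (k a, t))).
  rewrite subr0 mulr1; apply.
  - by move=> t _; apply: ctatD; [exact: cth|apply: ctatN; exact: der_cts (DS t)].
  - by move=> t ht; have D1 := Dth t ht; have D2 := DS t; exact: derB.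
  move=> t ht; rewrite /dth -sumrB.
  apply: le_trans (ler_norm_sum _ _ _) _.
  have -> : e = \sum_(a < M.+1) h * e.
    by rewrite sumr_const card_ord -mulr_natl mulrA hM mul1r.
  apply: ler_sum => a _; rewrite kS; apply: (proj2 (Hr h _ _ _ _ _)) => //; first by rewrite h0.
  exact/ku/ltnW.
have S2 : `|(J 1 - J 0) - \sum_(a < M.+1) h * I (k a)| <= e.
  have -> : J 1 - J 0 = \sum_(a < M.+1) (J (k a.+1) - J (k a)).
    rewrite -(big_mkord xpredT (fun a => J (k a.+1) - J (k a))) telescope_sumr //.
    by rewrite /k hM mul0r.
  rewrite -sumrB; apply: le_trans (ler_norm_sum _ _ _) _.
  have -> : e = \sum_(a < M.+1) h * e.
    by rewrite sumr_const card_ord -mulr_natl mulrA hM mul1r.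
  apply: ler_sum => a _; have [c hc ->] := mvt_any (k a) (k a.+1) DJ.
  rewrite kS addrAC subrr add0r mulrC -mulrBr normrM gtr0_norm // ler_pM2l //.
  rewrite kS addrAC subrr add0r [`|h|]gtr0_norm // in hc.
  have := Hs (c - k a) (le_lt_trans hc hs) (k a); rewrite addrCA subrr addr0; apply.
  exact/ku/ltnW.
have E : \sum_(a < M.+1) h * I (k a) =
   \sum_(a < M.+1) h * G (k a) 1 - \sum_(a < M.+1) h * G (k a) 0.
  by rewrite -sumrB; apply: eq_bigr => a _; rewrite mulrBr.
rewrite E in S2; move: S1 S2; rewrite !ler_norml /e; lra.
Unshelve. all: by end_near. Qed.

End Integral.

Lemma HasDeg_integral al : HasDeg n al ->
  Rintegral lebesgue_measure `[0, 1] (fun k =>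
    Rintegral lebesgue_measure `[0, 1] (fun b => beta (k, b))) = al.
Proof.
move=> Hal; have [G DG] := G_ex.
have [J DJ] := antideriv (inner_cts DG).
rewrite (HasDeg_inner DG DJ Hal) -(Rint_FTC (inner_cts DG) DJ ltr01).
congr Rintegral; apply: funext => k.
have cb := cts_beta.
have ck : continuous (fun b => beta (k, b)) by move=> b; ctac.
exact: (Rint_FTC ck (DG k) ltr01).
Qed.

Lemma cts_inner_integral :
  continuous (fun k => Rintegral lebesgue_measure `[0, 1] (fun b => beta (k, b))).
Proof.
have [G DG] := G_ex; have cb := cts_beta.
have -> : (fun k => Rintegral lebesgue_measure `[0, 1] (fun b => beta (k, b))) =
    (fun k => G k 1 - G k 0).
  apply: funext => k; have ck : continuous (fun b => beta (k, b)) by move=> b; ctac.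
  exact: (Rint_FTC ck (DG k) ltr01).
exact: inner_cts.
Qed.

End GaussBonnet.

Lemma ctatDv {R : realType} {V : normedModType R} {X : topologicalType} (f g : X -> V) x :
  continuous_at x f -> continuous_at x g -> continuous_at x (fun y => f y + g y).
Proof. by move=> cf cg; apply: cvgD. Qed.

Lemma ctatZv {R : realType} {V : normedModType R} {X : topologicalType} (f : X -> R) (v : V) x :
  continuous_at x f -> continuous_at x (fun y => f y *: v).
Proof. by move=> cf; apply: cvgZr_tmp. Qed.

(** * Bloch vectors of C^1 projections and the Chern integral *)

Section ProjectionFamily.
Context {R : realType}.
Local Notation vec := (R * R * R)%type.
Implicit Types (Q : 'rV[R]_3 -> 'M[R[i]]_2) (x : 'rV[R]_3) (A : 'M[R[i]]_2).

(** Solves A = (1 - m.sigma)/2 for m, using the first column of A. *)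
Definition blochA A : vec :=
  (- (2 * complex.Re (A 1 0)), - (2 * complex.Im (A 1 0)), 1 - 2 * complex.Re (A 0 0)).

(** The point is that the trace is 1. Otherwise idempotency kills the off-diagonal entry and leaves
    two equal diagonal entries from {0, 1}, so the matrix would be 0 or the identity, against rank
    one. *)
Lemma proj_bloch A : A *m A = A -> adjoint A = A -> \rank A = 1%N ->
  [/\ dot (blochA A) (blochA A) = 1, A 0 1 = (A 1 0)^*%C, complex.Im (A 0 0) = 0,
    complex.Im (A 1 1) = 0 & complex.Re (A 1 1) = 1 - complex.Re (A 0 0)].
Proof.
move=> AA hA rA.
have a00 := congr1 (fun B : 'M[R[i]]_2 => B 0 0) hA; rewrite !mxE in a00.
have a11 := congr1 (fun B : 'M[R[i]]_2 => B 1 1) hA; rewrite !mxE in a11.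
have a01 := congr1 (fun B : 'M[R[i]]_2 => B 0 1) hA; rewrite !mxE in a01.
have e00 := congr1 (fun B : 'M[R[i]]_2 => B 0 0) AA; rewrite mulmx2E in e00.
have e10 := congr1 (fun B : 'M[R[i]]_2 => B 1 0) AA; rewrite mulmx2E in e10.
have e11 := congr1 (fun B : 'M[R[i]]_2 => B 1 1) AA; rewrite mulmx2E in e11.
have nz : A != 0 by apply/eqP => h; move: rA; rewrite h mxrank0.
have n1 : A != 1%:M by apply/eqP => h; move: rA; rewrite h mxrank1.
have A2 := mx2_eta A.
rewrite -a01 in e00 e10 e11 A2; rewrite -a01 /blochA /dot.
move: (A 0 0) (A 1 0) (A 1 1) a00 a11 e00 e10 e11 A2 {a01} => [p p'] [x y] [q q'] /=.
move=> /eqP; rewrite eq_complex /= => /andP[_ /eqP hp'].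
move=> /eqP; rewrite eq_complex /= => /andP[_ /eqP hq'].
have {hp'} p0 : p' = 0 by lra.
have {hq'} q0 : q' = 0 by lra.
rewrite {}p0 {}q0.
move=> /eqP; rewrite eq_complex /= => /andP[/eqP e1 _].
move=> /eqP; rewrite eq_complex /= => /andP[/eqP e2 /eqP e3].
move=> /eqP; rewrite eq_complex /= => /andP[/eqP e4 _] A2.
have [s|s] := eqVneq (p + q) 1; first by split => //; nra.
have s' : p + q - 1 != 0 by rewrite subr_eq0.
have x0 : x = 0 by apply: (mulIf s'); lra.
have y0 : y = 0 by apply: (mulIf s'); lra.
exfalso; move: s; rewrite x0 y0 in A2 e1 e4.
have hp : p * (p - 1) = 0 by lra.
have hq : q * (q - 1) = 0 by lra.
move/eqP: hp; rewrite mulf_eq0 subr_eq0 => /orP[] /eqP hp;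
  move/eqP: hq; rewrite mulf_eq0 subr_eq0 => /orP[] /eqP hq; rewrite hp hq ?add0r ?addr0 ?eqxx //.
- by move: nz; rewrite A2 hp hq => /eqP []; apply: mx2P; rewrite !mxE //=;
    apply/eqP; rewrite eq_complex /= ?oppr0 ?eqxx.
by move: n1; rewrite A2 hp hq => /eqP []; apply: mx2P; rewrite !mxE //=;
    apply/eqP; rewrite eq_complex /= ?oppr0 ?eqxx.
Qed.

Lemma pdP j (g : 'rV[R]_3 -> R) x : C1fun g ->
  is_derive (0 : R) 1 (fun s : R => g (x + s *: ev j)) (pd j g x).
Proof. by case=> _ h _; rewrite /pd derive1E; apply/derivableP. Qed.

Lemma pd_line j (g : 'rV[R]_3 -> R) x (c s : R) : C1fun g ->
  is_derive s 1 (fun t : R => g (x + (c * t) *: ev j)) (c * pd j g (x + (c * s) *: ev j)).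
Proof.
move=> hg; have h := pdP j (x + (c * s) *: ev j) hg.
have D : is_derive s 1 (fun t => c * t - c * s) c.
  by have D := derB (derM (derC c s) (der_id s)) (derC (c * s) s); apply: der_eq D; ring.
have e : c * s - c * s = 0 by rewrite subrr.
have := @der_comp _ (fun t => c * t - c * s) (fun u => g (x + (c * s) *: ev j + u *: ev j)) s _ _ D.
rewrite e => /(_ _ h) H; rewrite mulrC.
by apply: der_funeq H => t; congr g; rewrite -addrA -scalerDl [c * s + _]addrC subrK.
Qed.

Lemma pd_uniq j (g : 'rV[R]_3 -> R) x (d : R) :
  is_derive (0 : R) 1 (fun s : R => g (x + s *: ev j)) d -> pd j g x = d.
Proof. by case=> _ <-; rewrite /pd derive1E. Qed.

Lemma RintZ (c : R) (g : R -> R) : continuous g ->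
  Rintegral lebesgue_measure `[0, 1] (fun t => c * g t) =
  c * Rintegral lebesgue_measure `[0, 1] g.
Proof.
move=> cg; have [G DG] := antideriv cg.
have DcG (t : R) : is_derive t 1 (fun t => c * G t) (c * g t).
  by apply: der_eq (derM (derC c t) (DG t)); rewrite mul0r add0r.
have ccg : continuous (fun t => c * g t) by move=> t; ctac.
by rewrite (Rint_FTC ccg DcG ltr01) (Rint_FTC cg DG ltr01) mulrBr.
Qed.

Lemma per_gt0 (T : R) j : 0 < T -> 0 < per T j.
Proof. by move=> T0; rewrite /per; case: ifP => // _; rewrite mulr_gt0 ?pi_gt0. Qed.

Section Slice.
Variables (T : R) (Q : 'rV[R]_3 -> 'M[R[i]]_2).
Hypotheses (T0 : 0 < T) (HQ : smooth_proj_family T Q).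

Definition bl x := blochA (Q x).
Definition dbl j x : vec :=
  (- (2 * pd j (reM Q 1 0) x), - (2 * pd j (imM Q 1 0) x), - (2 * pd j (reM Q 0 0) x)).

Let PB x : [/\ dot (blochA (Q x)) (blochA (Q x)) = 1, Q x 0 1 = (Q x 1 0)^*%C,
  complex.Im (Q x 0 0) = 0, complex.Im (Q x 1 1) = 0 &
  complex.Re (Q x 1 1) = 1 - complex.Re (Q x 0 0)].
Proof. by have [_ _ /(_ x) [h1 h2 h3]] := HQ; exact: proj_bloch. Qed.

Let C1r a b : C1fun (reM Q a b). Proof. by have [h _ _] := HQ; case: (h a b). Qed.
Let C1i a b : C1fun (imM Q a b). Proof. by have [h _ _] := HQ; case: (h a b). Qed.

Lemma bl_unit x : dot (bl x) (bl x) = 1.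
Proof. by have [] := PB x. Qed.

Lemma Q_bloch x : Q x = rc 2^-1 *: pmx (bl x).
Proof.
have [_ h1 h2 h3 h4] := PB x.
rewrite [LHS]mx2_eta h1; apply: mx2P; rewrite !mxE /=; apply/eqP; rewrite eq_complex /=.
- by rewrite h2; apply/andP; split; apply/eqP; field.
- by case: (Q x 1 0) => a b /=; apply/andP; split; apply/eqP; field.
- by case: (Q x 1 0) => a b /=; apply/andP; split; apply/eqP; field.
by rewrite h3 h4; apply/andP; split; apply/eqP; field.
Qed.

Lemma pdM_bloch j x : pdM j Q x = rc 2^-1 *: lmx (dbl j x).
Proof.
have Im0 a : imM Q a a = fun=> 0.
  apply: funext => y; have [_ _ h2 h3 _] := PB y.
  by case: (I2P a) => ->.
have e1 : pd j (imM Q 0 0) x = 0 by rewrite Im0; apply: pd_uniq; exact: derC.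
have e2 : pd j (imM Q 1 1) x = 0 by rewrite Im0; apply: pd_uniq; exact: derC.
have e3 : pd j (reM Q 0 1) x = pd j (reM Q 1 0) x.
  congr (pd j _ x); apply: funext => y; have [_ h _ _ _] := PB y.
  by rewrite /reM h; case: (Q y 1 0).
have e4 : pd j (imM Q 0 1) x = - pd j (imM Q 1 0) x.
  apply: pd_uniq; apply: der_funeq (derN (pdP j x (C1i 1 0))) => s.
  by have [_ h _ _ _] := PB (x + s *: ev j); rewrite /imM h; case: (Q _ 1 0).
have e5 : pd j (reM Q 1 1) x = - pd j (reM Q 0 0) x.
  apply: pd_uniq; have D := derB (derC 1 0) (pdP j x (C1r 0 0)); rewrite sub0r in D.
  apply: der_funeq D => s.
  by have [_ _ _ _ h] := PB (x + s *: ev j); rewrite /reM h.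
apply: mx2P; rewrite !mxE ?e1 ?e2 ?e3 ?e4 ?e5 /=; apply/eqP; rewrite eq_complex /=;
  apply/andP; split; apply/eqP; by field.
Qed.

(** The three halves in [Q] and its derivatives give 1/8 and the trace of the commutator gives -4i
    times the triple product; multiplication by i leaves the factor 1/2 of [beta]. *)
Lemma curv_bloch j n x :
  curv Q j n x = 2^-1 * det3 (bl x) (dbl j x) (dbl n x) / (2 * pi).
Proof.
rewrite /curv !pdM_bloch Q_bloch mxtrace_commZ; congr (_ / _).
have Im3 v a b : \tr (pmx v *m lmx a *m lmx b) - \tr (pmx v *m lmx b *m lmx a) =
    Complex 0 (- (4 * det3 v a b)).
  rewrite !mx2_mul !mx2_tr /det3; apply/eqP; rewrite eq_complex /=.
  by apply/andP; split; apply/eqP; ring.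
have k3 : rc 2^-1 ^+ 3 = rc 8^-1 :> R[i].
  rewrite !exprS expr0 mulr1; apply/eqP; rewrite eq_complex /=.
  by apply/andP; split; apply/eqP; field.
by rewrite Im3 k3 /=; field.
Qed.

(** On the unit square the chain rule puts the two periods into [beta], and the substitution in the
    integrals brings the same factors, so they cancel and only 2 pi remains. *)
Lemma chern_slice_deg j n x0 al :
  HasDeg (fun p => bl (x0 + (per T j * p.1) *: ev j + (per T n * p.2) *: ev n)) al ->
  chern_slice Q T j n x0 = al / (2 * pi).
Proof.
set L := per T j; set B := per T n.
have L0 : 0 < L by exact: per_gt0.
have B0 : 0 < B by exact: per_gt0.
pose X (p : R * R) := x0 + (L * p.1) *: ev j + (B * p.2) *: ev n.
pose nn p := bl (X p).
pose nk p : vec := (L * (dbl j (X p)).1.1, L * (dbl j (X p)).1.2, L * (dbl j (X p)).2).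
pose nb p : vec := (B * (dbl n (X p)).1.1, B * (dbl n (X p)).1.2, B * (dbl n (X p)).2).
have cX : continuous X.
  by move=> p; apply: ctatDv; [apply: ctatDv; [ctac|apply: ctatZv; ctac]|apply: ctatZv; ctac].
have cr a b : continuous (reM Q a b) by case: (C1r a b).
have ci a b : continuous (imM Q a b) by case: (C1i a b).
have cdr i a b : continuous (pd i (reM Q a b)) by case: (C1r a b).
have cdi i a b : continuous (pd i (imM Q a b)) by case: (C1i a b).
have cnn : continuous nn.
  move=> p; rewrite /nn /bl /blochA.
  have h1 := ctat_comp (cr 1 0) (cX p); have h2 := ctat_comp (ci 1 0) (cX p).
  have h3 := ctat_comp (cr 0 0) (cX p).
  by rewrite /reM in h1 h3; rewrite /imM in h2; ctac.
have cdbl i : continuous (fun p => dbl i (X p)).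
  move=> p; rewrite /dbl.
  have h1 := ctat_comp (cdr i 1 0) (cX p); have h2 := ctat_comp (cdi i 1 0) (cX p).
  have h3 := ctat_comp (cdr i 0 0) (cX p).
  apply: ctat_pair; first (apply: ctat_pair).
  - by apply: ctatN; apply: ctatM; [exact: ctat_cst|exact: h1].
  - by apply: ctatN; apply: ctatM; [exact: ctat_cst|exact: h2].
  by apply: ctatN; apply: ctatM; [exact: ctat_cst|exact: h3].
have cnk : continuous nk by move=> p; rewrite /nk; have h := cdbl j p; ctac.
have cnb : continuous nb by move=> p; rewrite /nb; have h := cdbl n p; ctac.
have Dline i (c : R) y s : vder (fun t => bl (y + (c * t) *: ev i)) s
    (c * (dbl i (y + (c * s) *: ev i)).1.1, c * (dbl i (y + (c * s) *: ev i)).1.2,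
     c * (dbl i (y + (c * s) *: ev i)).2).
  have h1 := pd_line i y c s (C1r 1 0); have h2 := pd_line i y c s (C1i 1 0).
  have h3 := pd_line i y c s (C1r 0 0).
  split => /=.
  - by apply: der_eq (derN (derM (derC 2 s) h1)); ring.
  - by apply: der_eq (derN (derM (derC 2 s) h2)); ring.
  - by apply: der_eq (derB (derC 1 s) (derM (derC 2 s) h3)); ring.
have Dk k b : vder (fun t => nn (t, b)) k (nk (k, b)).
  have D := Dline j L (x0 + (B * b) *: ev n) k.
  have e : X (k, b) = x0 + (B * b) *: ev n + (L * k) *: ev j by rewrite /X addrAC.
  have e' : (fun t => nn (t, b)) = (fun t => bl (x0 + (B * b) *: ev n + (L * t) *: ev j)).
    by apply: funext => t; rewrite /nn /X addrAC.
  by rewrite e' /nk e.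
have Db k b : vder (fun t => nn (k, t)) b (nb (k, b)) := Dline n B (x0 + (L * k) *: ev j) b.
have per_nn b : nn (1, b) = nn (0, b).
  rewrite /nn /X /= mulr1 mulr0 scale0r addr0 /bl addrAC.
  by have [_ h _] := HQ; rewrite h.
move=> Hdeg.
have := HasDeg_integral (fun p => bl_unit _) cnn cnk cnb Dk Db per_nn Hdeg.
have cI := cts_inner_integral cnn cnk cnb.
set I := fun k => _ in cI.
move=> EI.
have cb := cts_beta cnn cnk cnb.
have L1 : L != 0 by rewrite gt_eqF.
have B1 : B != 0 by rewrite gt_eqF.
have pi1 : pi != 0 :> R by rewrite gt_eqF // pi_gt0.
have bE p : curv Q j n (X p) = (L * B * (2 * pi))^-1 * beta nn nk nb p.
  rewrite curv_bloch /beta /nn /nk /nb; move: (bl _) (dbl j _) (dbl n _) (@pi R) pi1 => u v w P P1.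
  by rewrite /det3 /=; field; rewrite L1 B1 P1.
have XE a b : x0 + a *: ev j + b *: ev n = X (a / L, b / B).
  by rewrite /X /= [L * _]mulrC [B * _]mulrC !divfK.
have cc a : continuous (fun b : R => curv Q j n (x0 + a *: ev j + b *: ev n)).
  move=> b.
  have h : continuous_at b (fun b => (L * B * (2 * pi))^-1 * beta nn nk nb (a / L, b / B)).
    by ctac.
  by apply: ctat_eq h => t; rewrite XE bE.
have E1 a : Rintegral lebesgue_measure `[0, B] (fun b => curv Q j n (x0 + a *: ev j + b *: ev n))
    = (L * (2 * pi))^-1 * I (a / L).
  rewrite (Rint_scale (cc a) B0) /I -RintZ; last by move=> b; ctac.
  congr Rintegral; apply: funext => t.
  rewrite XE bE [B * t]mulrC mulfK //; move: (beta _ _ _ _) (@pi R) pi1 => u P P1.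
  by field; rewrite L1 B1 P1.
rewrite /chern_slice -/L -/B.
have -> : (fun a => Rintegral lebesgue_measure `[0, B] (fun b => curv Q j n (x0 + a *: ev j + b *: ev n)))
   = fun a => (L * (2 * pi))^-1 * I (a / L) by apply: funext.
rewrite Rint_scale //; last by move=> a; ctac.
have -> : (fun t => L * ((L * (2 * pi))^-1 * I (L * t / L))) = fun t => (2 * pi)^-1 * I t.
  apply: funext => t; rewrite [L * t]mulrC mulfK //; move: (I t) (@pi R) pi1 => u P P1.
  by field; rewrite L1 P1.
by rewrite RintZ // /I EI mulrC.
Qed.

End Slice.

End ProjectionFamily.

(** * The Bloch projection and its smooth approximation *)

Section SpectralProjection.
Context {R : realType}.
Local Notation vec := (R * R * R)%type.
Implicit Types (v m : vec) (q : 'rV[R]_3).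

Definition hvec (k1 k2 : R) q : vec :=
  (complex.Re (varpi k1 k2 q), complex.Im (varpi k1 k2 q), crd q i2).

Lemma Hmat_lmx k1 k2 q : Hmat k1 k2 q = - lmx (hvec k1 k2 q).
Proof.
rewrite /Hmat /hvec; case: (varpi _ _ _) => x y /=.
by apply: mx2P; rewrite !mxE /=; apply/eqP; rewrite eq_complex /=; apply/andP; split; apply/eqP; ring.
Qed.

Lemma rcM (a b : R) : rc a * rc b = rc (a * b).
Proof. by apply/eqP; rewrite eq_complex /=; apply/andP; split; apply/eqP; ring. Qed.

Definition bandproj v : 'M[R[i]]_2 := rc (2 * vnorm v)^-1 *: nmx v.

Lemma nmxE v : nmx v = (rc (vnorm v))%:M + lmx v.
Proof.
by apply: mx2P; rewrite !mxE /=; apply/eqP; rewrite eq_complex /=; apply/andP; split; apply/eqP; ring.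
Qed.

Lemma lmx_sqr v : lmx v *m lmx v = (rc (vnorm v ^+ 2))%:M.
Proof.
rewrite sqr_vnorm /dot mx2_mul; apply: mx2P; rewrite !mxE /=; apply/eqP; rewrite eq_complex /=;
  apply/andP; split; apply/eqP; ring.
Qed.

Lemma bandprojE v : 0 < dot v v ->
  bandproj v = rc 2^-1 *: (1%:M + rc (vnorm v)^-1 *: lmx v).
Proof.
move=> v0; have r0 := vnorm_gt0 v0.
rewrite /bandproj nmxE !scalerDr scalerA [rc _ * rc _]rcM -invfM; congr (_ + _).
rewrite !scale_scalar_mx mulr1 [rc _ * rc _]rcM; congr _%:M; congr rc.
by field; rewrite gt_eqF.
Qed.

Lemma adjointZ (s : R) (A : 'M[R[i]]_2) : adjoint (rc s *: A) = rc s *: adjoint A.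
Proof.
apply/matrixP => i j; rewrite !mxE; case: (A j i) => a b.
by apply/eqP; rewrite eq_complex /=; apply/andP; split; apply/eqP; ring.
Qed.

(** The square of H is |v|^2, so every eigenvalue is |v| or -|v|. On these two values the indicator
    of the negative axis is the affine function (1 - d/|v|)/2, whence the result depends on H alone
    and not on the diagonalisation. *)
Lemma negproj_spec v (P U : 'M[R[i]]_2) (d : 'I_2 -> R) : 0 < dot v v ->
  U *m adjoint U = 1%:M -> - lmx v = U *m diag_mx (\row_a rc (d a)) *m adjoint U ->
  P = U *m diag_mx (\row_a (if d a < 0 then 1 else 0)) *m adjoint U -> P = bandproj v.
Proof.
move=> v0 UU HE ->; have r0 := vnorm_gt0 v0; set r := vnorm v in r0 *.
have UU' := mulmx1C UU.
set D := diag_mx _ in HE.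
have DD : D *m D = (rc (r ^+ 2))%:M.
  have : adjoint U *m (- lmx v *m - lmx v) *m U = D *m D.
    rewrite {1 2}HE !mulmxA UU' mul1mx -!mulmxA UU' mulmx1 !mulmxA.
    by rewrite -[D *m adjoint U *m U]mulmxA UU' mulmx1.
  have -> : - lmx v *m - lmx v = lmx v *m lmx v by rewrite mulNmx mulmxN opprK.
  by move=> <-; rewrite lmx_sqr -/r scalar_mxC -mulmxA UU' mulmx1.
have dE a : (if d a < 0 then 1 else 0) = rc 2^-1 * (1 - rc r^-1 * rc (d a)).
  have := congr1 (fun B : 'M[R[i]]_2 => B a a) DD.
  rewrite mul_diag_mx !mxE eqxx mulr1n rcM => /eqP; rewrite eq_complex /= eqxx andbT.
  rewrite -expr2 eqf_sqr => /orP[] /eqP ->.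
    rewrite ltNge ltW //= rcM mulVf ?gt_eqF //.
    by apply/eqP; rewrite eq_complex /=; apply/andP; split; apply/eqP; ring.
  rewrite oppr_lt0 r0 rcM mulrN mulVf ?gt_eqF //.
  by apply/eqP; rewrite eq_complex /=; apply/andP; split; apply/eqP; field.
have -> : diag_mx (\row_a (if d a < 0 then 1 else 0)) = rc 2^-1 *: (1%:M - rc r^-1 *: D).
  apply/matrixP => a b; rewrite !mxE; case: eqP => [->|ne].
    by rewrite !mulr1n dE.
  by rewrite !mulr0n mulr0 subr0 mulr0.
rewrite -scalemxAr mulmxBr mulmx1 -!scalemxAl mulmxBl UU -scalemxAr -scalemxAl -HE.
by rewrite bandprojE // scalerN opprK.
Qed.

Lemma negproj_ex v : 0 < dot v v -> exists (U : 'M[R[i]]_2) (d : 'I_2 -> R),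
  [/\ U *m adjoint U = 1%:M, - lmx v = U *m diag_mx (\row_a rc (d a)) *m adjoint U &
   bandproj v = U *m diag_mx (\row_a (if d a < 0 then 1 else 0)) *m adjoint U].
Proof.
move=> v0; have r0 := vnorm_gt0 v0; have [[u w] hu] := nmx_outer v.
have hl : lmx v = outer (u, w) (u, w) - (rc (vnorm v))%:M by rewrite -hu nmxE addrC addKr.
set r := vnorm v in r0 hl *.
have ww : w * w^*%C = rc (2 * r) - u * u^*%C.
  have := tr_outer (u, w) (u, w); rewrite -hu {1}/nmx mx2_tr -/r /ip /=.
  have -> : rc (r - v.2) + rc (r + v.2) = rc (2 * r).
    by apply/eqP; rewrite eq_complex /=; apply/andP; split; apply/eqP; ring.
  by move=> ->; ring.
(* The spinor has squared length 2 |v|, by the trace of [nmx v]. *)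
pose s := Num.sqrt (2 * r)^-1.
have sE : rc s * rc s = rc (2 * r)^-1.
  by rewrite rcM -expr2 sqr_sqrtr // invr_ge0 mulr_ge0 // ltW.
have rs : rc s * rc s * rc (2 * r) = 1.
  rewrite sE rcM mulVf //; apply: lt0r_neq0; exact: mulr_gt0.
(* The first column is the spinor, belonging to the eigenvalue -|v|; the second is its orthogonal
   companion. *)
pose V := mx2 u (- w^*%C) w (u^*%C).
have Vad : adjoint V = mx2 (u^*%C) (w^*%C) (- w) u.
  by apply: mx2P; rewrite !mxE //=; case: (u) (w) => a b [c e]; apply/eqP;
    rewrite eq_complex /= ?opprK ?eqxx.
exists (rc s *: V), (fun a => if a == 0 then - r else r).
have dia (f : 'I_2 -> R[i]) : rc s *: V *m diag_mx (\row_a f a) *m adjoint (rc s *: V) =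
    (rc s * rc s) *: (V *m mx2 (f 0) 0 0 (f 1) *m adjoint V).
  rewrite adjointZ -[rc s *: V *m _]scalemxAl mulmxZZ; congr (_ *: (_ *m _ *m _)).
  by apply: mx2P; rewrite !mxE /= ?mulr1n ?mulr0n.
split.
- rewrite adjointZ mulmxZZ Vad mx2_mul.
  have -> : mx2 (u * u^*%C + - w^*%C * - w) (u * w^*%C + - w^*%C * u)
     (w * u^*%C + u^*%C * - w) (w * w^*%C + u^*%C * u) = rc (2 * r) *: 1%:M.
    apply: mx2P; rewrite !mxE /= ?mulr1n ?mulr0n ?mulr1 ?mulr0.
    + by rewrite mulrNN [w^*%C * w]mulrC ww; ring.
    + by ring.
    + by ring.
    by rewrite ww; ring.
  by rewrite scalerA rs scale1r.
- rewrite (dia (fun a => rc (if a == 0 then - r else r))) Vad !mx2_mul /=.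
  apply: (@scalerI _ _ (rc (2 * r))).
    by apply/eqP => h; move: rs; rewrite h mulr0 => /eqP; rewrite eq_sym oner_eq0.
  rewrite scalerA [rc (2 * r) * _]mulrC rs scale1r hl.
  have r2 : rc (2 * r) = rc r + rc r    by apply/eqP; rewrite eq_complex /=; apply/andP; split; apply/eqP; ring.
  have rN : rc (- r) = - rc r by apply/eqP; rewrite eq_complex /= oppr0 !eqxx.
  rewrite rN; apply: mx2P; rewrite !mxE /= ?mulr1n ?mulr0n.
  + have -> : u * - rc r + - w^*%C * 0 = - (rc r * u) by ring.
    have -> : u * 0 + - w^*%C * rc r = - (w^*%C * rc r) by ring.
    rewrite mulrNN -[w^*%C * rc r * w]mulrA [rc r * w]mulrC mulrA [w^*%C * w]mulrC ww r2.
    by ring.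
  + by rewrite r2; ring.
  + by rewrite r2; ring.
  rewrite r2 in ww *.
  transitivity (- (rc r) * (w * w^*%C) + rc r * (u * u^*%C)); last by ring.
  rewrite ww; ring.
rewrite (dia (fun a => if (if a == 0 then - r else r) < 0 then 1 else 0)) Vad !mx2_mul /=.
rewrite oppr_lt0 r0 ltNge ltW //= sE /bandproj hu -/r; congr (_ *: _).
by apply: mx2P; rewrite !mxE /=; ring.
Qed.

Lemma negprojE v : 0 < dot v v -> negproj (- lmx v) = bandproj v.
Proof.
move=> v0; rewrite /negproj; apply: xget_unique => /=; first exact: negproj_ex.
by move=> P [U [d [h1 h2 h3]]]; exact: negproj_spec h1 h2 h3.
Qed.

Lemma hs2_bandproj v m : 0 < dot v v -> dot m m = 1 ->
  hs2 (bandproj v - rc 2^-1 *: pmx m) = 1 - dot v m / vnorm v.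
Proof.
move=> v0 m1; have r0 := vnorm_gt0 v0.
have := sqr_vnorm v; rewrite bandprojE // /hs2; set r := vnorm v in r0 *.
move: m1; rewrite /dot; case: v v0 @r r0 => -[x y] z v0 r r0; case: m => -[a b] c /= m1 hr.
rewrite !big_ord_recl !big_ord0 /= !mxE /=.
have hi : r^-1 ^+ 2 * (x * x + y * y + z * z) = 1.
  by rewrite -hr exprVn mulVf // expf_neq0 // gt_eqF.
transitivity (2^-1 * (r^-1 ^+ 2 * (x * x + y * y + z * z)) + 2^-1 * (a * a + b * b + c * c)
  - (x * a + y * b + z * c) / r).
  by move: (r^-1) => i; field.
by rewrite hi m1; field; rewrite gt_eqF.
Qed.

(** The bound 1 in [smooth_approx] thus means an acute angle between the Bloch vectors, which keeps
    the straight segment between them away from 0. *)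
Lemma hs2_lt1 v m : 0 < dot v v -> dot m m = 1 ->
  (hs2 (bandproj v - rc 2^-1 *: pmx m) < 1) = (0 < dot v m).
Proof.
move=> v0 m1; rewrite hs2_bandproj // ltrBlDr ltrDl pmulr_lgt0 // invr_gt0.
exact: vnorm_gt0.
Qed.

Lemma negproj_Hmat k1 k2 q : 0 < dot (hvec k1 k2 q) (hvec k1 k2 q) ->
  negproj (Hmat k1 k2 q) = bandproj (hvec k1 k2 q).
Proof. by move=> h; rewrite Hmat_lmx negprojE. Qed.

(** A zero of the vector would make the Hamiltonian the zero matrix, which has eigenvalue 0. *)
Lemma Q0_gap q : Q0 q -> [/\ 0 <= crd q i0, 0 <= crd q i1 &
  forall k1 k2, 0 < dot (hvec k1 k2 q) (hvec k1 k2 q)].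
Proof.
move=> [[/andP[h0 _] /andP[h1 _] _] gap _]; split=> // k1 k2.
rewrite lt_neqAle dot_ge0 andbT eq_sym; apply/negP => /eqP e.
have := gap k1 k2; rewrite Hmat_lmx => /negP; apply.
have {e} : [/\ (hvec k1 k2 q).1.1 = 0, (hvec k1 k2 q).1.2 = 0 & (hvec k1 k2 q).2 = 0].
  by move: e; rewrite /dot; case: (hvec _ _ _) => -[x y] z /= e; split; nra.
case: (hvec _ _ _) => -[x y] z /= [-> -> ->].
have -> : lmx (0, 0, 0) = 0 :> 'M[R[i]]_2.
  by apply: mx2P; rewrite !mxE /=; apply/eqP; rewrite eq_complex /= ?oppr0 !eqxx.
apply/eigenvalueP; exists (delta_mx 0 0); first by rewrite oppr0 mulmx0 scale0r.
by apply/eqP => /matrixP/(_ 0 0); rewrite !mxE /= => /eqP; rewrite oner_eq0.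
Qed.

End SpectralProjection.

Section Periodicity.
Context {R : realType}.

Lemma per_int (S : Type) (f : R -> S) (p : R) (n : int) x :
  (forall x, f (x + p) = f x) -> f (x + p * n%:~R) = f x.
Proof.
move=> hf.
have H (m : nat) y : f (y + p * m%:R) = f y.
  by elim: m => [|m IH]; rewrite ?mulr0 ?addr0 // mulrSr mulrDr mulr1 addrA hf.
case: n => n; first exact: H.
by rewrite NegzE mulrNz mulrN -[in RHS](subrK (p * n.+1%:R) x) H.
Qed.

Lemma per_unit (S : Type) (f : R -> S) (p x : R) : 0 < p ->
  (forall x, f (x + p) = f x) -> exists2 t, unitI t & f x = f (p * t).
Proof.
move=> p0 hf; exists (x / p - (Num.floor (x / p))%:~R).
  have h1 : (Num.floor (x / p))%:~R <= x / p by exact: floor_le_tmp.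
  have h2 := floorD1_gt (x / p); rewrite intrD in h2.
  by rewrite /unitI; apply/andP; split; lra.
by rewrite mulrBr [p * (x / p)]mulrC divfK ?gt_eqF // -mulrN -mulrNz per_int.
Qed.

Lemma cos_2pi (x : R) : cos (x + 2 * pi) = cos x.
Proof. by rewrite mulr_natl cosD2pi. Qed.

Lemma sin_2pi (x : R) : sin (x + 2 * pi) = sin x.
Proof. by rewrite mulr_natl sinD2pi. Qed.

Lemma hvecE k1 k2 (q : 'rV[R]_3) : hvec k1 k2 q =
  (1 + crd q i0 * cos k1 + crd q i1 * cos k2,
   - (crd q i0 * sin k1 + crd q i1 * sin k2), crd q i2).
Proof.
rewrite /hvec /varpi /expi !Re_add !Im_add !Re_mul !Im_mul /= !cosN !sinN.
by congr (_, _, _); ring.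
Qed.

Lemma hvec_per1 k1 k2 (q : 'rV[R]_3) : hvec (k1 + 2 * pi) k2 q = hvec k1 k2 q.
Proof. by rewrite !hvecE cos_2pi sin_2pi. Qed.

Lemma hvec_per2 k1 k2 (q : 'rV[R]_3) : hvec k1 (k2 + 2 * pi) q = hvec k1 k2 q.
Proof. by rewrite !hvecE cos_2pi sin_2pi. Qed.

Lemma ctat_hvec (X : topologicalType) (k1 k2 : X -> R) (q : X -> 'rV[R]_3) x :
  continuous_at x k1 -> continuous_at x k2 -> continuous_at x q ->
  continuous_at x (fun y => hvec (k1 y) (k2 y) (q y)).
Proof.
move=> c1 c2 cq; apply: (ctat_eq (fun y => esym (hvecE (k1 y) (k2 y) (q y)))).
by ctac.
Qed.

End Periodicity.

(** * Closure properties of C^1 functions *)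

Section ContinuouslyDifferentiable.
Context {R : realType}.
Implicit Types (g h : 'rV[R]_3 -> R).

(** Carries the partial derivatives as witnesses, so that sums, products and compositions are
    handled by giving formulas. *)
Definition C1x g := exists2 dg : 'I_3 -> 'rV[R]_3 -> R, continuous g /\ (forall j, continuous (dg j)) &
  forall j x, is_derive (0 : R) 1 (fun s : R => g (x + s *: ev j)) (dg j x).

Lemma C1x_C1fun g : C1x g -> C1fun g.
Proof.
case=> dg [cg cdg] D.
have e j : pd j g = dg j by apply: funext => x; exact: pd_uniq (D j x).
by split; [exact: cg|move=> j x; case: (D j x)|move=> j; rewrite e].
Qed.

Let ev0 g j x : g (x + (0 : R) *: ev j) = g x.
Proof. by rewrite scale0r addr0. Qed.

Lemma C1x_cst (c : R) : C1x (fun=> c).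
Proof.
exists (fun _ _ => 0); first by split => [x|j x]; exact: ctat_cst.
by move=> j x; exact: derC.
Qed.

Lemma C1x_eq g h : g =1 h -> C1x g -> C1x h.
Proof. by move=> /funext ->. Qed.

Lemma C1xD g h : C1x g -> C1x h -> C1x (fun x => g x + h x).
Proof.
move=> [dg [cg cdg] Dg] [dh [ch cdh] Dh].
exists (fun j x => dg j x + dh j x).
  by split => [x|j x]; [ctac|have := cdg j; have := cdh j => *; ctac].
by move=> j x; exact: derD (Dg j x) (Dh j x).
Qed.

Lemma C1xM g h : C1x g -> C1x h -> C1x (fun x => g x * h x).
Proof.
move=> [dg [cg cdg] Dg] [dh [ch cdh] Dh].
exists (fun j x => dg j x * h x + g x * dh j x).
  by split => [x|j x]; [ctac|have := cdg j; have := cdh j => *; ctac].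
by move=> j x; have := derM (Dg j x) (Dh j x); rewrite !ev0.
Qed.

Lemma C1x_comp (f df : R -> R) g : C1x g ->
  (forall x, is_derive (g x) 1 f (df (g x))) ->
  (forall x, continuous_at (g x) df) -> C1x (fun x => f (g x)).
Proof.
move=> [dg [cg cdg] Dg] Df cdf.
exists (fun j x => df (g x) * dg j x).
  split=> [x|j x].
    exact: (@continuous_comp _ _ _ g f x (cg x) (der_cts (Df x))).
  have h : continuous_at x (fun x => df (g x)).
    exact: (@continuous_comp _ _ _ g df x (cg x) (cdf x)).
  by have := cdg j => *; ctac.
move=> j x; have := Df x; rewrite -{1}(ev0 g j x) => D.
exact: der_comp (Dg j x) D.
Qed.

Lemma C1x_crd i : C1x (crd^~ i).
Proof.
exists (fun j _ => (i == j)%:R).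
  split=> [x|j x]; last exact: ctat_cst.
  exact: coord_continuous.
move=> j x.
have D := derD (derC (crd x i) (0 : R)) (derM (der_id (0 : R)) (derC (i == j)%:R (0 : R))).
have -> : (i == j)%:R = 0 + (1 * (i == j)%:R + 0 * 0) :> R by ring.
by apply: der_funeq D => s; rewrite /crd /ev !mxE.
Qed.

Lemma C1x_rsqrt g : C1x g -> (forall x, 0 < g x) -> C1x (fun x => (Num.sqrt (g x))^-1).
Proof.
move=> cg g0.
pose df y : R := - (2 * Num.sqrt y)^-1 / Num.sqrt y ^+ 2.
have s0 x : Num.sqrt (g x) != 0 by rewrite gt_eqF // sqrtr_gt0.
apply: (C1x_comp (f := fun y => (Num.sqrt y)^-1) (df := df)) => // x.
  exact: derV (s0 x) (is_derive1_sqrt (g0 x)).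
rewrite /df; apply: ctatM.
  by apply: ctatN; apply: ctatV; [rewrite mulf_neq0 ?pnatr_eq0|ctac].
by apply: ctatV; [rewrite expf_neq0|ctac].
Qed.

End ContinuouslyDifferentiable.

Section SmoothApproximation.
Context {R : realType}.
Local Notation vec := (R * R * R)%type.

(* E t is the mean of e over a short interval [t, t + h]. *)
Lemma steklov (e : R -> R) (T del : R) : 0 < T -> 0 < del -> continuous e ->
  (forall t, e (t + T) = e t) -> exists E dE : R -> R,
  [/\ continuous dE, forall t : R, is_derive t 1 E (dE t), forall t, E (t + T) = E t &
      forall t, `|E t - e t| <= del].
Proof.
move=> T0 d0 ce pe.
have [x _|x _|r r0 Hr] := @tube R R `[0, 1]%classic
  (fun y => del ^+ 2 - (e (T * y.1 + y.2) - e (T * y.1)) ^+ 2) (@segment_compact _ _ _).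
- by ctac.
- by rewrite /= addr0 subrr expr0n subr0 exprn_gt0.
have close h t : `|h| < r -> `|e (t + h) - e t| <= del.
  move=> hr.
  have pf x : e (x + T + h) - e (x + T) = e (x + h) - e x by rewrite addrAC !pe.
  have [s hs ->] := per_unit t T0 pf.
  have := Hr h hr s; rewrite /= in_itv /= => /(_ hs).
  by move: (e _ - e _) => u hu; rewrite ler_norml; apply/andP; split; nra.
pose h := r / 2.
have h0 : 0 < h by rewrite divr_gt0.
have hr : h < r by rewrite /h; lra.
have [G DG] := antideriv ce.
have DGh (t : R) : is_derive t 1 (fun t => G (t + h)) (e (t + h)).
  have D := der_comp (derD (der_id t) (derC h t)) (DG (t + h)).
  by apply: der_eq D; rewrite addr0 mulr1.
exists (fun t => (G (t + h) - G t) * h^-1), (fun t => (e (t + h) - e t) * h^-1); split.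
- by move=> t; ctac.
- move=> t; have D := derM (derB (DGh t) (DG t)) (derC h^-1 t).
  by apply: der_eq D; rewrite mulr0 addr0.
(* As [e] is periodic, the increment of its antiderivative over one period is constant. *)
- move=> t; congr (_ * _).
  have DT (x : R) : is_derive x 1 (fun x => G (x + T) - G x) 0.
    have D := derB (der_comp (derD (der_id x) (derC T x)) (DG (x + T))) (DG x).
    by apply: der_eq D; rewrite addr0 mulr1 pe subrr.
  have := is_derive_0_is_cst (t + h) t (fun x => DT x).
  by rewrite addrAC => H; lra.
move=> t; have [c hc E] := mvt_any t (t + h) DG.
rewrite E addrAC subrr add0r mulfK ?gt_eqF //.
rewrite addrAC subrr add0r [`|h|]gtr0_norm // in hc.
by have := close (c - t) t (le_lt_trans hc hr); rewrite addrCA subrr addr0.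
Qed.

Lemma gap_bound (q : R -> 'rV[R]_3) (T : R) : 0 < T -> continuous q ->
  (forall t, q (t + T) = q t) ->
  (forall k1 k2 t, 0 < dot (hvec k1 k2 (q t)) (hvec k1 k2 (q t))) ->
  exists2 c : R, 0 < c & forall k1 k2 t, c <= dot (hvec k1 k2 (q t)) (hvec k1 k2 (q t)).
Proof.
move=> T0 cq pq gq.
pose d k1 k2 t := dot (hvec k1 k2 (q t)) (hvec k1 k2 (q t)).
have pi2 : 0 < 2 * pi :> R by rewrite mulr_gt0 ?pi_gt0.
(* The tube parameter is itself subtracted, so that the width of the tube becomes a lower bound for
   the gap. *)
have [x _|x _|r r0 Hr] := @tube R _ _ (fun y : (R * R * R) * R =>
   d (2 * pi * y.1.1.1) (2 * pi * y.1.1.2) (T * y.1.2) - y.2) compact_cube.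
- have H : continuous_at (x, 0 : R) (fun y : (R * R * R) * R =>
    hvec (2 * pi * y.1.1.1) (2 * pi * y.1.1.2) (q (T * y.1.2))).
    by apply: ctat_hvec; ctac.
  by have H' := ctat_dot H H; rewrite /d; ctac.
- by rewrite /= subr0; exact: gq.
exists (r / 2); first by rewrite divr_gt0.
move=> k1 k2 t.
have [s1 h1 e1] := per_unit (f := fun k => d k k2 t) k1 pi2 (fun x => ltac:(by rewrite /d hvec_per1)).
have [s2 h2 e2] := per_unit (f := fun k => d (2 * pi * s1) k t) k2 pi2 (fun x => ltac:(by rewrite /d hvec_per2)).
have [s3 h3 e3] := per_unit (f := fun t => d (2 * pi * s1) (2 * pi * s2) t) t T0 (fun x => ltac:(by rewrite /d pq)).
rewrite -[dot _ _]/(d k1 k2 t) e1 e2 e3.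
have hr : `|r / 2| < r by rewrite gtr0_norm ?divr_gt0 //; lra.
have := Hr (r / 2) hr (s1, s2, s3); rewrite /= subr_gt0 => H.
by apply: ltW; apply: H; split.
Qed.

Definition vunit (v : vec) : vec := (v.1.1 / vnorm v, v.1.2 / vnorm v, v.2 / vnorm v).

Lemma vunit_unit v : 0 < dot v v -> dot (vunit v) (vunit v) = 1.
Proof.
move=> v0; have r0 := vnorm_gt0 v0; have := sqr_vnorm v.
rewrite /vunit /dot /=; move: (vnorm v) r0; case: v {v0} => -[x y] z /= r r0 hr.
have r1 : r != 0 by rewrite gt_eqF.
transitivity ((x * x + y * y + z * z) / r ^+ 2); first by field.
by rewrite -hr divff // expf_neq0.
Qed.

Lemma bandproj_vunit (v : vec) : 0 < dot v v -> bandproj v = rc 2^-1 *: pmx (vunit v).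
Proof.
move=> v0; rewrite bandprojE // /vunit; move: (vnorm v) => r; congr (_ *: _).
by apply: mx2P; rewrite !mxE /=; apply/eqP; rewrite eq_complex /=; apply/andP; split; apply/eqP; ring.
Qed.

Section Family.
Variables (T : R) (d : 'rV[R]_3 -> vec).
Hypotheses (d0 : forall x, 0 < dot (d x) (d x))
  (C1 : C1x (fun x => (d x).1.1)) (C2 : C1x (fun x => (d x).1.2)) (C3 : C1x (fun x => (d x).2))
  (per_d : forall x j, d (x + per T j *: ev j) = d x).

Let C1dot : C1x (fun x => dot (d x) (d x)).
Proof. by apply: C1xD; [apply: C1xD|]; exact: C1xM. Qed.

Let C1unit : [/\ C1x (fun x => (vunit (d x)).1.1), C1x (fun x => (vunit (d x)).1.2) &
  C1x (fun x => (vunit (d x)).2)].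
Proof. by have h := C1x_rsqrt C1dot d0; split; exact: C1xM. Qed.

Lemma smooth_bandproj : smooth_proj_family T (fun x => bandproj (d x)).
Proof.
have [u1 u2 u3] := C1unit.
have E x : bandproj (d x) = rc 2^-1 *: pmx (vunit (d x)) by rewrite bandproj_vunit.
have H (a b : 'I_2) : C1x (fun x => complex.Re (bandproj (d x) a b)) /\
    C1x (fun x => complex.Im (bandproj (d x) a b)).
  have K (u v : 'rV[R]_3 -> R) : (forall x, bandproj (d x) a b = Complex (u x) (v x)) ->
      C1x u -> C1x v -> C1x (fun x => complex.Re (bandproj (d x) a b)) /\
    C1x (fun x => complex.Im (bandproj (d x) a b)).
    by move=> e cu cv; split; [apply: C1x_eq cu|apply: C1x_eq cv] => x; rewrite e.
  case: (I2P a) (I2P b) K => -> [] -> K.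
  - apply: (K (fun x => 2^-1 + - 2^-1 * (vunit (d x)).2) (fun=> 0)).
    + by move=> x; rewrite E !mxE /=; apply/eqP; rewrite eq_complex /=; apply/andP; split; apply/eqP; ring.
    + by apply: C1xD; [exact: C1x_cst|apply: C1xM => //; exact: C1x_cst].
    exact: C1x_cst.
  - apply: (K (fun x => - 2^-1 * (vunit (d x)).1.1) (fun x => 2^-1 * (vunit (d x)).1.2)).
    + by move=> x; rewrite E !mxE /=; apply/eqP; rewrite eq_complex /=; apply/andP; split; apply/eqP; ring.
    + by apply: C1xM => //; exact: C1x_cst.
    by apply: C1xM => //; exact: C1x_cst.
  - apply: (K (fun x => - 2^-1 * (vunit (d x)).1.1) (fun x => - 2^-1 * (vunit (d x)).1.2)).
    + by move=> x; rewrite E !mxE /=; apply/eqP; rewrite eq_complex /=; apply/andP; split; apply/eqP; ring.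
    + by apply: C1xM => //; exact: C1x_cst.
    by apply: C1xM => //; exact: C1x_cst.
  apply: (K (fun x => 2^-1 + 2^-1 * (vunit (d x)).2) (fun=> 0)).
  + by move=> x; rewrite E !mxE /=; apply/eqP; rewrite eq_complex /=; apply/andP; split; apply/eqP; ring.
  + by apply: C1xD; [exact: C1x_cst|apply: C1xM => //; exact: C1x_cst].
  exact: C1x_cst.
split=> [a b|x j|x].
- by have [h1 h2] := H a b; split; exact: C1x_C1fun.
- by rewrite per_d.
have m1 := vunit_unit (d0 x); rewrite E; split.
- rewrite mulmxZZ pmx_sqr // scalerA; congr (_ *: _).
  by rewrite -mulrA rc_half2 mulr1.
- rewrite adjointZ; congr (_ *: _).
  by apply: mx2P; rewrite !mxE /=; apply/eqP; rewrite eq_complex /= ?oppr0 ?opprK !eqxx.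
have [p hp] := nmx_outer (vunit (d x)); rewrite nmx_unit // in hp.
have h0 : rc 2^-1 != 0 :> R[i].
  by apply/eqP => h; have := @rc_half2 R; rewrite h mul0r => /eqP; rewrite eq_sym oner_eq0.
rewrite mxrank_scale_nz // hp.
(* The rank is at most one because the matrix is a column times a row, and it is not zero because
   its trace is 2 before the scaling. *)
apply/eqP; rewrite eqn_leq; apply/andP; split.
  have -> : outer p p = (\col_a (if a == 0 then p.1 else p.2)) *m
     (\row_b (if b == 0 then p.1^*%C else p.2^*%C)).
    by apply: mx2P; rewrite !mxE big_ord1 !mxE.
  by apply: leq_trans (mxrankM_maxl _ _) _; exact: rank_leq_col.
rewrite lt0n mxrank_eq0; apply/eqP => h.
have := tr_outer p p; rewrite h mxtrace0 -tr_outer -hp.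
rewrite mx2_tr => /eqP; rewrite eq_complex /= => /andP[/eqP e _]; lra.
Qed.

End Family.

End SmoothApproximation.

Section Existence.
Context {R : realType}.
Local Notation vec := (R * R * R)%type.

Lemma I3P (j : 'I_3) : [\/ j = i0, j = i1 | j = i2].
Proof.
by case: j => -[|[|[|//]]] p; [constructor 1|constructor 2|constructor 3]; exact: val_inj.
Qed.

Lemma crd_shift (x : 'rV[R]_3) (s : R) i j : crd (x + s *: ev j) i = crd x i + s * (i == j)%:R.
Proof. by rewrite /crd /ev !mxE. Qed.

Lemma C1x_cos g : C1x g -> C1x (fun x => cos (g x) : R).
Proof.
move=> cg; apply: (C1x_comp (f := cos) (df := fun y => - sin y)) => // x.
by ctac.
Qed.

Lemma C1x_sin g : C1x g -> C1x (fun x => sin (g x) : R).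
Proof.
move=> cg; apply: (C1x_comp (f := sin) (df := cos)) => // x.
exact: continuous_cos.
Qed.

Variables (eta : R -> 'rV[R]_3) (T : R).
Hypotheses (T0 : 0 < T) (Heta : loop_in_Q0 eta).

Definition tloop t := eta (2 * pi * t / T).

Lemma tloop_cts : continuous tloop.
Proof. by have [ce _ _] := Heta; move=> t; rewrite /tloop; ctac. Qed.

Lemma tloop_per t : tloop (t + T) = tloop t.
Proof.
have [_ pe _] := Heta; rewrite /tloop -[RHS]pe; congr eta.
by rewrite mulrDr mulrDl mulfK // gt_eqF.
Qed.

Lemma tloop_gap t k1 k2 : 0 < dot (hvec k1 k2 (tloop t)) (hvec k1 k2 (tloop t)).
Proof. by have [_ _ /(_ (2 * pi * t / T))/Q0_gap [_ _]] := Heta; exact. Qed.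

Definition hx (x : 'rV[R]_3) : vec := hvec (crd x i0) (crd x i1) (tloop (crd x i2)).

Lemma PblochE x : Pbloch eta T x = bandproj (hx x).
Proof. by rewrite /Pbloch negproj_Hmat //; exact: tloop_gap. Qed.

Lemma hx_per x j : hx (x + per T j *: ev j) = hx x.
Proof.
rewrite /hx !crd_shift; case: (I3P j) => ->; rewrite /per /= ?mulr1 ?mulr0 ?addr0.
- by rewrite hvec_per1.
- by rewrite hvec_per2.
by rewrite tloop_per.
Qed.

(** Only the dependence on time has to be smoothed, because the momenta enter through sines and
    cosines. *)
Lemma smooth_approx_ex : exists Q, smooth_approx (Pbloch eta T) T Q.
Proof.
have [c c0 Hc] := gap_bound T0 tloop_cts tloop_per (fun k1 k2 t => tloop_gap t k1 k2).
have ct := tloop_cts.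
(* The components of the smoothed field are off by at most 2 [del], 2 [del] and [del]. As
   [del <= 1], the squared error is at most 9 [del], which is below the gap [c]; twice the scalar
   product with the original field is then at least [c] - 9 [del]. *)
pose del : R := Num.min 1 (c / 10).
have d0 : 0 < del by rewrite lt_min ltr01 divr_gt0.
have d1 : del <= 1 by rewrite ge_min lexx.
have dc : 10 * del <= c.
  have : del <= c / 10 by rewrite ge_min lexx orbT.
  lra.
have St i : exists E dE : R -> R, [/\ continuous dE, forall t : R, is_derive t 1 E (dE t),
    forall t, E (t + T) = E t & forall t, `|E t - crd (tloop t) i| <= del].
  apply: steklov => // [t|t]; first by ctac.
  by rewrite tloop_per.
have [E0 [dE0 [cE0 DE0 pE0 hE0]]] := St i0.
have [E1 [dE1 [cE1 DE1 pE1 hE1]]] := St i1.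
have [E2 [dE2 [cE2 DE2 pE2 hE2]]] := St i2.
pose dt (x : 'rV[R]_3) : vec :=
  (1 + E0 (crd x i2) * cos (crd x i0) + E1 (crd x i2) * cos (crd x i1),
   -1 * (E0 (crd x i2) * sin (crd x i0) + E1 (crd x i2) * sin (crd x i1)), E2 (crd x i2)).
have pos x : 0 < dot (hx x) (dt x).
  have := Hc (crd x i0) (crd x i1) (crd x i2).
  rewrite -/(hx x) /hx hvecE /dt /dot /=.
  move: (crd x i2) (crd x i0) (crd x i1) => t k1 k2.
  have b (x1 : R) : -1 <= cos x1 <= 1 by rewrite cos_geN1 cos_le1.
  have b' (x1 : R) : -1 <= sin x1 <= 1 by rewrite sin_geN1 sin_le1.
  move: (hE0 t) (hE1 t) (hE2 t) (b k1) (b k2) (b' k1) (b' k2).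
  rewrite !ler_norml.
  set e0 := crd _ _; set e1 := crd _ _; set e2 := crd _ _.
  move: (cos k1) (cos k2) (sin k1) (sin k2) => c1 c2 s1 s2 h0 h1 h2 hc1 hc2 hs1 hs2 hd.
  pose w1 := (E0 t - e0) * c1 + (E1 t - e1) * c2.
  pose w2 := - ((E0 t - e0) * s1 + (E1 t - e1) * s2).
  pose w3 := E2 t - e2.
  pose v1 := 1 + e0 * c1 + e1 * c2; pose v2 := - (e0 * s1 + e1 * s2).
  have prod_b (a s : R) : - del <= a <= del -> -1 <= s <= 1 -> - del <= a * s <= del.
    by move=> /andP[? ?] /andP[? ?]; apply/andP; split; nra.
  have p1 := prod_b _ _ h0 hc1; have p2 := prod_b _ _ h1 hc2.
  have p3 := prod_b _ _ h0 hs1; have p4 := prod_b _ _ h1 hs2.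
  have q1 : - (2 * del) <= w1 <= 2 * del by rewrite /w1; lra.
  have q2 : - (2 * del) <= w2 <= 2 * del by rewrite /w2; lra.
  have sq (w D : R) : - D <= w <= D -> w ^+ 2 <= D ^+ 2.
    by move=> /andP[? ?]; nra.
  have r1 := sq _ _ q1; have r2 := sq _ _ q2; have r3 : w3 ^+ 2 <= del ^+ 2 by exact: sq.
  have dd : del ^+ 2 <= del by nra.
  have hd' : c <= v1 ^+ 2 + v2 ^+ 2 + e2 ^+ 2 by rewrite !expr2.
  have am (u w : R) : - (u * w) <= 2^-1 * (u ^+ 2 + w ^+ 2).
    by have := sqr_ge0 (u + w); rewrite !expr2; lra.
  have a1 := am v1 w1; have a2 := am v2 w2; have a3 := am e2 w3.
  rewrite (_ : _ + _ = (v1 ^+ 2 + v2 ^+ 2 + e2 ^+ 2) + (v1 * w1 + v2 * w2 + e2 * w3)); last first.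
    by rewrite /v1 /v2 /w1 /w2 /w3; ring.
  by move: r1 r2; rewrite !exprMn; lra.
have dt0 x : 0 < dot (dt x) (dt x).
  rewrite lt_neqAle dot_ge0 andbT eq_sym; apply/negP => /eqP e.
  have := pos x; move: e; rewrite /dot; move: (dt x) (hx x) => [[a b] e] [[a' b'] e'] /= h.
  have -> : a = 0 by nra.
  have -> : b = 0 by nra.
  have -> : e = 0 by nra.
  by rewrite !mulr0 !addr0 ltxx.
have CE (E dE : R -> R) : continuous dE -> (forall t : R, is_derive t 1 E (dE t)) ->
    C1x (fun x => E (crd x i2)).
  by move=> cdE D; apply: (C1x_comp (f := E) (df := dE)) => //; exact: C1x_crd.
have CE0 := CE _ _ cE0 DE0; have CE1 := CE _ _ cE1 DE1; have CE2 := CE _ _ cE2 DE2.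
have Cc i : C1x (fun x => cos (crd x i) : R) by apply: C1x_cos; exact: C1x_crd.
have Cs i : C1x (fun x => sin (crd x i) : R) by apply: C1x_sin; exact: C1x_crd.
exists (fun x => bandproj (dt x)); split.
  apply: smooth_bandproj => //.
  - by apply: C1xD; [apply: C1xD; [exact: C1x_cst|exact: C1xM]|exact: C1xM].
  - by apply: C1xM; [exact: C1x_cst|apply: C1xD; exact: C1xM].
  move=> x j; rewrite /dt !crd_shift; case: (I3P j) => ->; rewrite /per /= ?mulr1 ?mulr0 ?addr0.
  - by rewrite cos_2pi sin_2pi.
  - by rewrite cos_2pi sin_2pi.
  by rewrite pE0 pE1 pE2.
move=> x; rewrite PblochE (bandproj_vunit (dt0 x)) hs2_lt1; last exact: vunit_unit.
  have -> : dot (hx x) (vunit (dt x)) = dot (hx x) (dt x) / vnorm (dt x).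
    by rewrite /dot /vunit /=; ring.
  by rewrite divr_gt0 ?vnorm_gt0.
exact: tloop_gap.
Qed.

End Existence.

(** * The model field near a gap closing *)

Section Model.
Context {R : realType}.
Local Notation vec := (R * R * R)%type.
Implicit Types (x y k : R).

(* The Bloch vector (a e^{-2 pi i k} + b, y). *)
Definition circ (a b y k : R) : vec :=
  (a * cos (2 * pi * k) + b, - (a * sin (2 * pi * k)), y).

(** Since [a * b] is nonnegative, the modulus of the planar part is smallest where the cosine is -1,
    and there it is |a - b|. *)
Lemma circ_gap a b y k : 0 <= a -> 0 <= b -> 0 < (a - b) ^+ 2 + y ^+ 2 ->
  0 < dot (circ a b y k) (circ a b y k).
Proof.
move=> a0 b0; rewrite /circ /dot /=.
have := cos2Dsin2 (2 * pi * k); have := cos_geN1 (2 * pi * k).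
move: (cos _) (sin _) => c s c1 cs g.
have -> : (a * c + b) * (a * c + b) + - (a * s) * - (a * s) + y * y =
   a ^+ 2 * (c ^+ 2 + s ^+ 2) + b ^+ 2 + 2 * (a * b) * c + y ^+ 2 by ring.
have ab : 0 <= a * b by exact: mulr_ge0.
have : 0 <= a * b * (c + 1) by rewrite mulr_ge0 //; lra.
move: g; rewrite cs mulr1 sqrrB; lra.
Qed.

Lemma circ_per a b y : circ a b y 1 = circ a b y 0.
Proof.
by rewrite /circ mulr1 mulr0 -[2 * pi]add0r cos_2pi sin_2pi.
Qed.

(** The straight homotopy to the positive and negative parts keeps both coefficients nonnegative and
    does not change their difference, which is all that [circ_gap] looks at. *)
Lemma deg_circ (A B Y : R -> R) al : continuous A -> continuous B -> continuous Y ->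
  (forall t, unitI t -> 0 <= A t) -> (forall t, unitI t -> 0 <= B t) ->
  (forall t, unitI t -> 0 < (A t - B t) ^+ 2 + Y t ^+ 2) ->
  A 0 = A 1 -> B 0 = B 1 -> Y 0 = Y 1 ->
  HasDeg (fun p => circ (Num.max (A p.2 - B p.2) 0) (Num.max (B p.2 - A p.2) 0) (Y p.2) p.1) al ->
  HasDeg (fun p => circ (A p.2) (B p.2) (Y p.2) p.1) al.
Proof.
move=> cA cB cY A0 B0 g eA eB eY.
pose a (s t : R) := (1 - s) * Num.max (A t - B t) 0 + s * A t.
pose b (s t : R) := (1 - s) * Num.max (B t - A t) 0 + s * B t.
have H := @HasDeg_homotopy R (fun w => circ (a w.1.1 w.2) (b w.1.1 w.2) (Y w.2) w.1.2) al.
move=> h; apply: HasDeg_eq (H _ _ _ _ _) => //=.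
- by move=> k t hk ht; rewrite /a /b !subrr !mul0r !add0r !mul1r.
- by move=> x; rewrite /circ /a /b; ctac.
- move=> s k t /andP[s0 s1] hk ht.
  have hA : 0 <= Num.max (A t - B t) 0 by rewrite le_max lexx orbT.
  have hB : 0 <= Num.max (B t - A t) 0 by rewrite le_max lexx orbT.
  have s1' : 0 <= 1 - s by lra.
  apply: circ_gap => /=.
  + by rewrite addr_ge0 // mulr_ge0 // A0.
  + by rewrite addr_ge0 // mulr_ge0 // B0.
  have -> : a s t - b s t = A t - B t; last exact: g.
  rewrite /a /b; case: (leP (A t) (B t)) => hAB.
    by rewrite (max_idPr _) ?subr_le0 // (max_idPl _) ?subr_ge0 //; ring.
  by rewrite (max_idPl _) ?subr_ge0 ?ltW // (max_idPr _) ?subr_le0 ?ltW //; ring.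
- by move=> s t _ _; exact: circ_per.
- by move=> s k _ _; rewrite /a /b eA eB eY.
apply: HasDeg_eq h => k t hk ht /=.
by rewrite /a /b !subr0 !mul1r !mul0r !addr0.
Qed.

Definition wcirc (M : nat) x y : R[i] :=
  wilson (fun a => circ (Num.max x 0) (Num.max (- x) 0) y (a%:R / M%:R)) M.

(** For [x <= 0] the rotating coefficient vanishes, the chain is constant, and the Wilson loop is a
    power of 2 |v|. *)
Lemma wcirc_le0 M x y : x <= 0 -> 0 < x ^+ 2 + y ^+ 2 -> isarg 0 (wcirc M.+1 x y).
Proof.
move=> x0 g; pose v : vec := (- x, 0, y).
have -> : wcirc M.+1 x y = wilson (fun=> v) M.+1.
  rewrite /wcirc /circ (max_idPr x0) (max_idPl _) ?oppr_ge0 //.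
  by congr wilson; apply: funext => a; rewrite !mul0r oppr0 add0r.
have [p hp] := nmx_outer v.
rewrite (wilson_outer (u := fun=> p)) //.
have pp : ip p p = rc (2 * vnorm v).
  rewrite -tr_outer -hp mx2_tr; apply/eqP; rewrite eq_complex /=.
  by apply/andP; split; apply/eqP; ring.
have v0 : 0 < dot v v by rewrite /v /dot /= mulrNN mul0r addr0 -!expr2.
have h : isarg 0 (ip p p) by rewrite pp; apply: isarg_pos; rewrite mulr_gt0 ?vnorm_gt0.
rewrite prodr_const card_ord -exprSr.
by have := isarg_exp M.+1 h; rewrite mul0rn.
Qed.

Lemma wcirc_ge0 M x y : 0 <= x -> let r := Num.sqrt (x ^+ 2 + y ^+ 2) in
  let de := 2 * pi / M.+1%:R in
  wcirc M.+1 x y = Complex ((r - y) + (r + y) * cos de) (- ((r + y) * sin de)) ^+ M.+1.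
Proof.
move=> x0 r de.
have r0 : 0 <= r by exact: sqrtr_ge0.
have rE : r ^+ 2 = x ^+ 2 + y ^+ 2 by rewrite sqr_sqrtr // addr_ge0 ?sqr_ge0.
have ry : 0 <= r - y by nra.
have ry' : 0 <= r + y by nra.
pose S := Num.sqrt (r - y); pose S' := Num.sqrt (r + y).
have SE : S * S = r - y by rewrite -expr2 sqr_sqrtr.
have SE' : S' * S' = r + y by rewrite -expr2 sqr_sqrtr.
have S0 : 0 <= S by exact: sqrtr_ge0.
have S0' : 0 <= S' by exact: sqrtr_ge0.
have SS : S * S' = x.
  apply/eqP; rewrite -(eqrXn2 (n := 2)) ?mulr_ge0 // exprMn !expr2 SE SE'.
  by apply/eqP; rewrite -[x * x]expr2; lra.
pose ph (a : nat) : R := 2 * pi * (a%:R / M.+1%:R).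
(* The gauge with real first component. It returns to itself after [M.+1] steps, and consecutive
   overlaps are all equal because only the phase difference enters. *)
pose u (a : nat) : R[i] * R[i] := (rc S, Complex (- (S' * cos (ph a))) (S' * sin (ph a))).
have hu a : nmx (circ (Num.max x 0) (Num.max (- x) 0) y (a%:R / M.+1%:R)) = outer (u a) (u a).
  rewrite /circ (max_idPl x0) (max_idPr _) ?oppr_le0 // addr0 -/(ph a).
  have cs := cos2Dsin2 (ph a).
  have vr : vnorm (x * cos (ph a), - (x * sin (ph a)), y) = r.
    rewrite /vnorm /r /dot /=; congr Num.sqrt.
    by rewrite mulrNN -!expr2 !exprMn -mulrDr cs mulr1.
  rewrite /nmx vr /outer /u /=; move: (cos (ph a)) (sin (ph a)) cs => c s cs.
  apply: mx2P; rewrite !mxE /=; apply/eqP; rewrite eq_complex /=; apply/andP; split; apply/eqP.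
  - by rewrite -SE; ring.
  - by ring.
  - by rewrite -SS; ring.
  - by rewrite -SS; ring.
  - by rewrite -SS; ring.
  - by rewrite -SS; ring.
  - transitivity (S' * S' * (c ^+ 2 + s ^+ 2)); last by ring.
    by rewrite SE' cs mulr1.
  by ring.
set z := Complex _ _.
have hip a : ip (u a) (u a.+1) = z.
  have phS : ph a.+1 = ph a + de by rewrite /ph /de -(@natr1 _ a); move: (M.+1%:R^-1) (@pi R) => i P; ring.
  rewrite /ip /u phS /z -SE -SE' cosD sinD /=; have := cos2Dsin2 (ph a).
  move: (cos (ph a)) (sin (ph a)) (cos de) (sin de) => c s c' s' cs.
  apply/eqP; rewrite eq_complex /=; apply/andP; split; apply/eqP.
    transitivity (S * S + S' * S' * ((c ^+ 2 + s ^+ 2) * c')); first by ring.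
    by rewrite cs mul1r.
  transitivity (- (S' * S' * ((c ^+ 2 + s ^+ 2) * s'))); first by ring.
  by rewrite cs mul1r.
have uM : u M.+1 = u 0.
  by rewrite /u /ph divff ?pnatr_eq0 // mulr1 mul0r mulr0 -[2 * pi]add0r cos_2pi sin_2pi.
rewrite /wcirc (wilson_outer _ hu) -uM hip.
rewrite (eq_bigr (fun=> z)) => [|a _]; last exact: hip.
by rewrite prodr_const card_ord -exprSr.
Qed.

(** The common overlap of [wcirc_ge0] divided by r, with y = - r s. *)
Let zeta (de s : R) : R[i] := Complex ((1 + s) + (1 - s) * cos de) (- ((1 - s) * sin de)).

Let zeta_pos de s : -1 <= s <= 1 -> 0 < cos de -> 0 < complex.Re (zeta de s).
Proof. by rewrite /zeta /= => /andP[? ?] ?; nra. Qed.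

Lemma wcirc_arg M x y : (4 < M.+1)%N -> 0 <= x -> 0 < x ^+ 2 + y ^+ 2 ->
  let de := 2 * pi / M.+1%:R in
  isarg (parg (zeta de (- y / Num.sqrt (x ^+ 2 + y ^+ 2))) *+ M.+1) (wcirc M.+1 x y).
Proof.
move=> M4 x0 g de; rewrite (wcirc_ge0 M y x0) -/de.
set r := Num.sqrt _; have r0 : 0 < r by rewrite sqrtr_gt0.
have r1 : r != 0 by rewrite gt_eqF.
apply: isarg_exp.
have rE : r ^+ 2 = x ^+ 2 + y ^+ 2 by rewrite sqr_sqrtr // ltW.
have sb : -1 <= - y / r <= 1.
  by rewrite ler_pdivlMr // ler_pdivrMr //; apply/andP; split; nra.
(* Five or more points make the step smaller than pi/2, which keeps [zeta] in the right
   half-plane. *)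
have dc : 0 < cos de.
  apply: cos_gt0_pihalf; have p0 := @pi_gt0 R.
  have M0 : 0 < M.+1%:R :> R by rewrite ltr0Sn.
  have M4' : 4 < M.+1%:R :> R by rewrite ltr_nat.
  have d0 : 0 < de by rewrite divr_gt0 // mulr_gt0.
  have : de < pi / 2 by rewrite /de ltr_pdivrMr // mulrAC ltr_pdivlMr //; nra.
  by move=> ?; apply/andP; split => //; lra.
have h := isarg_parg (zeta_pos sb dc).
have hr := isarg_pos r0.
have -> : Complex (r - y + (r + y) * cos de) (- ((r + y) * sin de)) = rc r * zeta de (- y / r).
  apply/eqP; rewrite eq_complex /=; move: (cos de) (sin de) => c s.
  by apply/andP; split; apply/eqP; field.
by rewrite -[parg _]add0r; exact: isargM.
Qed.

Lemma wcirc_neq0 M x y : (4 < M.+1)%N -> 0 < x ^+ 2 + y ^+ 2 -> wcirc M.+1 x y != 0.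
Proof.
move=> M4 g; case: (leP x 0) => hx; first exact: isarg_neq0 (wcirc_le0 M hx g).
by have := wcirc_arg M4 (ltW hx) g; exact: isarg_neq0.
Qed.

Lemma IsAng_wcirc_le0 M (x y : R -> R) :
  (forall t, unitI t -> x t <= 0) -> (forall t, unitI t -> 0 < x t ^+ 2 + y t ^+ 2) ->
  IsAng (fun t => wcirc M.+1 (x t) (y t)) 0.
Proof.
move=> hx g; exists (fun=> 0); first by split; [move=> t; ctac|rewrite subrr].
by move=> t ht; apply: wcirc_le0; [exact: hx|exact: g].
Qed.

Lemma isarg_2pi (z : R[i]) t : isarg t z -> isarg (t + 2 * pi) z.
Proof. by case=> r r0 ->; exists r => //; rewrite cos_2pi sin_2pi. Qed.

(* On the arc cos >= 0 the Wilson loop turns once; on cos <= 0 it is positive. *)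
Lemma IsAng_wcirc_circle M (eps : R) : (4 < M.+1)%N -> 0 < eps ->
  IsAng (fun t => wcirc M.+1 (eps * cos (2 * pi * t)) (- (eps * sin (2 * pi * t)))) (2 * pi).
Proof.
move=> M4 e0; pose de : R := 2 * pi / M.+1%:R.
have p0 := @pi_gt0 R.
have M0 : 0 < M.+1%:R :> R by rewrite ltr0Sn.
have M4' : 4 < M.+1%:R :> R by rewrite ltr_nat.
have d0 : 0 < de by rewrite divr_gt0 // mulr_gt0.
have dp : de < pi / 2 by rewrite /de ltr_pdivrMr // mulrAC ltr_pdivlMr //; nra.
have dM : de *+ M.+1 = 2 * pi by rewrite -[LHS]mulr_natr divfK // gt_eqF.
have dc : 0 < cos de by apply: cos_gt0_pihalf; apply/andP; split => //; lra.
pose A s := parg (zeta de s).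
have A1 : A 1 = 0 by rewrite /A /parg /zeta /= subrr !mul0r oppr0 mul0r atan0.
have AN1 : A (-1) = - de.
  rewrite /A /parg /zeta /= opprK subrr add0r.
  have -> : - ((1 + 1) * sin de) / ((1 + 1) * cos de) = - tan de.
    rewrite /tan; move: dc; move: (sin de) (cos de) => s c c0.
    by field; rewrite gt_eqF.
  by rewrite atanN tanK // in_itv /=; apply/andP; split => //; lra.
have sb (u : R) : -1 <= sin u <= 1 by rewrite sin_geN1 sin_le1.
have sN : sin (pi * (3 / 2)) = -1 :> R.
  have -> : pi * (3 / 2) = pi / 2 + pi :> R by move: (@pi R) => P; field.
  by rewrite sinDpi sin_pihalf.
(* The clamps freeze each summand outside its own arc, at [A 1 = 0] or at [A (-1) = - de]. Since
   [M.+1] steps of [de] make 2 pi, the lift is an argument of the overlap power on the first arc, is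
   0 on the middle one, and is shifted by 2 pi on the last. *)
pose th (t : R) := (A (sin (Num.min (2 * pi * t) (pi / 2)))
  + A (sin (Num.max (2 * pi * t) (pi * (3 / 2))))) *+ M.+1 + 2 * pi.
have cA (f : R -> R) (t : R) : continuous_at t f -> continuous_at t (fun t => A (sin (f t))).
  move=> cf; apply: ctat_parg; first exact: zeta_pos.
  by split; rewrite /zeta /=; ctac.
exists th; first split.
- move=> t; rewrite /th.
  apply: (ctat_eq (f := fun t => M.+1%:R * (A (sin (Num.min (2 * pi * t) (pi / 2)))
    + A (sin (Num.max (2 * pi * t) (pi * (3 / 2))))) + 2 * pi)).
    by move=> u; rewrite mulr_natl.
  have h1 := cA (fun t => Num.min (2 * pi * t) (pi / 2)) t (ltac:(ctac)).
  have h2 := cA (fun t => Num.max (2 * pi * t) (pi * (3 / 2))) t (ltac:(ctac)).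
  by apply: ctatD; [apply: ctatM; [exact: ctat_cst|exact: ctatD]|exact: ctat_cst].
- rewrite /th mulr1 mulr0 (min_idPr _); last lra.
  rewrite (max_idPl _); last lra.
  rewrite (min_idPl _); last lra.
  rewrite (max_idPr _); last lra.
  rewrite sin_pihalf sN A1 AN1 add0r -[2 * pi]add0r sin_2pi add0r sin0 mulrnDl mulNrn dM.
  by ring.
move=> t /andP[t0 t1]; rewrite /th.
have {t0 t1} [f0 f1] : 0 <= 2 * pi * t /\ 2 * pi * t <= 2 * pi by split; nra.
move: (2 * pi * t) f0 f1 => f f0 f1.
have g : (eps * cos f) ^+ 2 + (- (eps * sin f)) ^+ 2 = eps ^+ 2.
  by rewrite sqrrN !exprMn -mulrDr cos2Dsin2 mulr1.
have g0 : 0 < (eps * cos f) ^+ 2 + (- (eps * sin f)) ^+ 2 by rewrite g exprn_gt0.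
have sq : - - (eps * sin f) / Num.sqrt ((eps * cos f) ^+ 2 + (- (eps * sin f)) ^+ 2) = sin f.
  by rewrite g sqrtr_sqr gtr0_norm // opprK mulrC mulKf // gt_eqF.
have [fl|fl] := leP f (pi / 2).
  rewrite (max_idPr _); last lra.
  rewrite sN AN1 mulrnDl mulNrn dM subrK.
  have c0 : 0 <= eps * cos f by rewrite mulr_ge0 ?(ltW e0) // cos_ge0_pihalf; lra.
  by have := wcirc_arg M4 c0 g0; rewrite /= sq.
rewrite sin_pihalf A1 add0r.
have [fm|fm] := leP f (pi * (3 / 2)).
  rewrite sN AN1 mulNrn dM addNr; apply: wcirc_le0 => //.
  have -> : f = (f - pi) + pi by rewrite subrK.
  rewrite cosDpi mulrN oppr_le0 mulr_ge0 ?(ltW e0) // cos_ge0_pihalf; lra.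
apply: isarg_2pi.
have c0 : 0 <= eps * cos f.
  have -> : f = (f - 2 * pi) + 2 * pi by rewrite subrK.
  by rewrite cos_2pi mulr_ge0 ?(ltW e0) // cos_ge0_pihalf; lra.
by have := wcirc_arg M4 c0 g0; rewrite /= sq.
Qed.

End Model.

(** * Homotopies *)

Section Segment.
Context {R : realType}.
Local Notation vec := (R * R * R)%type.
Implicit Types v w : vec.

Definition vseg (s : R) v w : vec :=
  ((1 - s) * v.1.1 + s * w.1.1, (1 - s) * v.1.2 + s * w.1.2, (1 - s) * v.2 + s * w.2).

Lemma vseg0 v w : vseg 0 v w = v.
Proof. by rewrite /vseg subr0 !mul1r !mul0r !addr0; case: v => -[]. Qed.

Lemma vseg1 v w : vseg 1 v w = w.
Proof. by rewrite /vseg subrr !mul1r !mul0r !add0r; case: w => -[]. Qed.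

Lemma vseg_gap s v w : unitI s -> 0 < dot v v -> 0 < dot w w -> 0 <= dot v w ->
  0 < dot (vseg s v w) (vseg s v w).
Proof.
move=> /andP[s0 s1] hv hw hvw.
have -> : dot (vseg s v w) (vseg s v w) =
    (1 - s) ^+ 2 * dot v v + s ^+ 2 * dot w w + 2 * (s * (1 - s)) * dot v w.
  by rewrite /vseg /dot /=; ring.
have [->|sn] := eqVneq s 0.
  by rewrite subr0 expr1n mul1r expr0n /= !(mul0r, mulr0) !addr0.
have s0' : 0 < s by rewrite lt_neqAle eq_sym sn.
have s1' : 0 <= 1 - s by lra.
apply: ltr_pwDl; last by rewrite mulr_ge0 // mulr_ge0 // mulr_ge0.
by apply: ltr_wpDl; [rewrite mulr_ge0 ?sqr_ge0 ?(ltW hv)|rewrite mulr_gt0 // exprn_gt0].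
Qed.

Lemma ctat_vseg (X : topologicalType) (s : X -> R) (f g : X -> vec) x :
  continuous_at x s -> continuous_at x f -> continuous_at x g ->
  continuous_at x (fun y => vseg (s y) (f y) (g y)).
Proof. by move=> cs cf cg; rewrite /vseg; ctac. Qed.

End Segment.

(** * From an approximating projection to the Bloch field *)

Section Transfer.
Context {R : realType}.
Local Notation vec := (R * R * R)%type.
Variables (eta : R -> 'rV[R]_3) (T : R).
Hypotheses (T0 : 0 < T) (Heta : loop_in_Q0 eta).

Lemma hx_cts : continuous (hx eta T).
Proof.
have ct := tloop_cts (T := T) Heta.
by move=> x; rewrite /hx; apply: ctat_hvec; ctac.
Qed.

Lemma bl_cts (Q : 'rV[R]_3 -> 'M[R[i]]_2) : smooth_proj_family T Q -> continuous (bl Q).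
Proof.
move=> [HC _ _] x; rewrite /bl /blochA.
have [[h1 _ _] [h2 _ _]] := HC 1 0; have [[h3 _ _] _] := HC 0 0.
have := h1 x; have := h2 x; have := h3 x; rewrite /reM /imM => *.
by ctac.
Qed.

(** Two homotopies: the slice is first moved from the origin to [x0] for the Bloch field, which
    vanishes nowhere, and then the field is joined to the Bloch vector of [Q] by segments, along
    which [hs2_lt1] prevents zeros. *)
Lemma HasDeg_hx (Q : 'rV[R]_3 -> 'M[R[i]]_2) j n al x0 : smooth_approx (Pbloch eta T) T Q ->
  HasDeg (fun p => hx eta T ((per T j * p.1) *: ev j + (per T n * p.2) *: ev n)) al ->
  HasDeg (fun p => bl Q (x0 + (per T j * p.1) *: ev j + (per T n * p.2) *: ev n)) al.
Proof.
move=> [HQ close] h0.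
have ch := hx_cts; have cb := bl_cts HQ.
have gap x : 0 < dot (hx eta T x) (hx eta T x) by exact: tloop_gap.
have pos x : 0 < dot (hx eta T x) (bl Q x).
  rewrite -hs2_lt1; [|exact: gap|exact: bl_unit HQ x].
  by rewrite -(Q_bloch HQ) -(PblochE T Heta).
pose X (s : R) (p : R * R) := s *: x0 + (per T j * p.1) *: ev j + (per T n * p.2) *: ev n.
have cX (w : R * R * R) : continuous_at w (fun w => X w.1.1 (w.1.2, w.2)).
  by rewrite /X; apply: ctatDv; [apply: ctatDv|]; apply: ctatZv; ctac.
have X1 s k : X s (1, k) = X s (0, k) + per T j *: ev j.
  by rewrite /X /= mulr1 mulr0 scale0r addr0 addrAC.
have X2 s k : X s (k, 1) = X s (k, 0) + per T n *: ev n.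
  by rewrite /X /= mulr1 mulr0 scale0r addr0.
have h1 : HasDeg (fun p => hx eta T (X 1 p)) al.
  apply: HasDeg_eq (@HasDeg_homotopy R (fun w => hx eta T (X w.1.1 (w.1.2, w.2))) al _ _ _ _ _).
  - by move=> k b _ _.
  - by move=> w; exact: (ctat_comp ch (cX w)).
  - by move=> s k b _ _ _; exact: gap.
  - by move=> s b _ _ /=; rewrite X1 hx_per.
  - by move=> s k _ _ /=; rewrite X2 hx_per.
  by apply: HasDeg_eq h0 => k b _ _; rewrite /X /= scale0r add0r.
have [_ perQ _] := HQ.
pose D (w : R * R * R) := vseg w.1.1 (hx eta T (X 1 (w.1.2, w.2))) (bl Q (X 1 (w.1.2, w.2))).
apply: HasDeg_eq (@HasDeg_homotopy R D al _ _ _ _ _).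
- by move=> k b _ _; rewrite [LHS]vseg1 /X scale1r.
- move=> w; have cX1 : continuous_at w (fun w : R * R * R => X 1 (w.1.2, w.2)).
    by rewrite /X; apply: ctatDv; [apply: ctatDv|]; [exact: ctat_cst| |]; apply: ctatZv; ctac.
  by apply: ctat_vseg; [ctac|exact: (ctat_comp ch cX1)|exact: (ctat_comp cb cX1)].
- move=> s k b hs _ _; apply: vseg_gap => //; first by rewrite (bl_unit HQ).
  exact/ltW/pos.
- move=> s b _ _.
  have -> : D (s, 1, b) = vseg s (hx eta T (X 1 (1, b))) (bl Q (X 1 (1, b))) by [].
  by rewrite X1 hx_per // /bl perQ.
- move=> s k _ _.
  have -> : D (s, k, 1) = vseg s (hx eta T (X 1 (k, 1))) (bl Q (X 1 (k, 1))) by [].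
  by rewrite X2 hx_per // /bl perQ.
by apply: HasDeg_eq h1 => k b _ _; rewrite [RHS]vseg0.
Qed.

Lemma chern_number_deg j n (m : int) :
  HasDeg (fun p => hx eta T ((per T j * p.1) *: ev j + (per T n * p.2) *: ev n)) (2 * pi * m%:~R) ->
  chern_number_is (Pbloch eta T) T j n m.
Proof.
move=> hd; split; first exact: smooth_approx_ex.
move=> Q HQ x0; have [HS _] := HQ.
rewrite (chern_slice_deg T0 HS (HasDeg_hx x0 HQ hd)) mulrC mulKf //.
by rewrite gt_eqF // mulr_gt0 // pi_gt0.
Qed.

Lemma tloop_scale b : tloop eta T (T * b) = eta (2 * pi * b).
Proof. by rewrite /tloop mulrCA mulrC mulKf // gt_eqF. Qed.

(* At fixed t the vector field is homotopic to a constant one along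
   ((1 - s) w, (1 - s) q3 + s sg) with sg the sign of q3. *)
Lemma HasDeg_12 :
  HasDeg (fun p => hx eta T ((per T i0 * p.1) *: ev i0 + (per T i1 * p.2) *: ev i1)) 0.
Proof.
set q := tloop eta T 0.
have gap k1 k2 : 0 < dot (hvec k1 k2 q) (hvec k1 k2 q) by exact: tloop_gap.
pose sg : R := if 0 <= crd q i2 then 1 else -1.
(* The choice of 1 at [q3 = 0] does no harm: [vseg_gap] needs a nonnegative scalar product only. *)
have sg0 : 0 <= sg * crd q i2 by rewrite /sg; case: (leP 0 (crd q i2)) => h; lra.
have sg1 : sg ^+ 2 = 1 by rewrite /sg; case: ifP => _; ring.
pose D (w : R * R * R) := vseg w.1.1 (0, 0, sg) (hvec (2 * pi * w.1.2) (2 * pi * w.2) q).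
apply: HasDeg_eq (@HasDeg_homotopy R D 0 _ _ _ _ _).
- move=> k b _ _; rewrite [LHS]vseg1 /hx !crd_shift.
  by rewrite /crd /per !mxE /= !mulr1 !mulr0 !addr0 add0r.
- move=> w; apply: ctat_vseg; [by ctac|exact: ctat_cst|].
  by apply: ctat_hvec; ctac.
- move=> s k b hs _ _; apply: vseg_gap => //.
  + by rewrite /dot /= !mul0r !add0r -expr2 sg1.
  by rewrite /dot /= !mul0r !add0r.
- move=> s b _ _; congr (vseg _ _ _).
  by rewrite /= mulr1 mulr0 -[2 * pi]add0r hvec_per1.
- move=> s k _ _; congr (vseg _ _ _).
  by rewrite /= mulr1 mulr0 -[2 * pi]add0r hvec_per2.
apply: HasDeg_eq (@HasDeg_const R (0, 0, sg) _) => [k b _ _|].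
  by rewrite [RHS]vseg0.
by rewrite /dot /= !mul0r !add0r -expr2 sg1.
Qed.

End Transfer.

(** * Evaluation on a class of the fundamental group *)

Section LoopClass.
Context {R : realType}.
Local Notation vec := (R * R * R)%type.

Let Z0 : unitI (0 : R). Proof. by rewrite /unitI; lra. Qed.
Let Z1 : unitI (1 : R). Proof. by rewrite /unitI; lra. Qed.

(** [A] and [B] stand for the rotating and the constant coefficient on a slice. After the reduction
    to positive and negative parts the Wilson loop of each mesh is a function of the parameter q
    alone, so its winding along the word is the combination of the windings along the generators. *)
Lemma HasDeg_class (A B : 'rV[R]_3 -> R) (eta : R -> 'rV[R]_3) (eps : R) (n1 n2 : int) (a1 a2 : R) :
  continuous A -> continuous B ->
  (forall q, Q0 q -> [/\ 0 <= A q, 0 <= B q & 0 < (A q - B q) ^+ 2 + crd q i2 ^+ 2]) ->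
  (forall M, (4 < M.+1)%N ->
    IsAng (fun t => wcirc M.+1 (A (eta1 eps (2 * pi * t)) - B (eta1 eps (2 * pi * t)))
      (crd (eta1 eps (2 * pi * t)) i2)) a1) ->
  (forall M, (4 < M.+1)%N ->
    IsAng (fun t => wcirc M.+1 (A (eta2 eps (2 * pi * t)) - B (eta2 eps (2 * pi * t)))
      (crd (eta2 eps (2 * pi * t)) i2)) a2) ->
  in_class eta eps n1 n2 ->
  HasDeg (fun p => circ (A (eta (2 * pi * p.2))) (B (eta (2 * pi * p.2)))
    (crd (eta (2 * pi * p.2)) i2) p.1) (a1 * n1%:~R + a2 * n2%:~R).
Proof.
move=> cA cB gap ang1 ang2 [b [g1 [g2 [[_ g10 g11 _] [_ g20 g21 _] [h [ch hb hper hQ]]]]]].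
have h1Q t : unitI t -> Q0 (h (1, t)) by move=> ht; exact: hQ.
set c := _ + _.
have step : HasDeg (fun p => circ (A (h (1, p.2))) (B (h (1, p.2))) (crd (h (1, p.2)) i2) p.1) c.
  apply: (@deg_circ R (fun t => A (h (1, t))) (fun t => B (h (1, t))) (fun t => crd (h (1, t)) i2)).
  - by move=> t; ctac.
  - by move=> t; ctac.
  - by move=> t; ctac.
  - by move=> t /h1Q/gap [].
  - by move=> t /h1Q/gap [].
  - by move=> t /h1Q/gap [].
  - by rewrite hper.
  - by rewrite hper.
  - by rewrite hper.
  exists 5%N => -[//|M] M5.
  have E t : wloop (fun p => circ (Num.max (A (h (1, p.2)) - B (h (1, p.2))) 0)
     (Num.max (B (h (1, p.2)) - A (h (1, p.2))) 0) (crd (h (1, p.2)) i2) p.1) M.+1 t =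
     wcirc M.+1 (A (h (1, t)) - B (h (1, t))) (crd (h (1, t)) i2).
    by rewrite /wcirc opprB.
  apply: (IsAng_eq (f := fun t => wcirc M.+1 (A (h (1, t)) - B (h (1, t))) (crd (h (1, t)) i2))).
    by move=> t _; rewrite E.
  pose G (q : 'rV[R]_3) := wcirc M.+1 (A q - B q) (crd q i2).
  have [|t ht|al Hal] := @IsAng_ex R (fun t => G (h (1, t))).
  - by move=> t; apply: cctat_wilson => a; rewrite /circ; ctac.
  - by apply: wcirc_neq0 => //; case: (gap _ (h1Q t ht)).
  (* The angle exists for the end of the homotopy, by its continuity, and passes to the word, with
     which that end agrees on the unit interval. *)
  have Hw : IsAng (fun t => G (concat (zpow (conjloop g1 (fun t => eta1 eps (2 * pi * t))) n1)
       (zpow (conjloop g2 (fun t => eta2 eps (2 * pi * t))) n2) t)) al.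
    by apply: IsAng_eq Hal => t ht; rewrite (proj2 (hb t ht)).
  have e (i : R -> 'rV[R]_3) : (forall t, i (t + 2 * pi) = i t) -> i (2 * pi * 0) = i (2 * pi * 1).
    by move=> hi; rewrite mulr0 mulr1 -[2 * pi]add0r hi.
  have per1 t : eta1 eps (t + 2 * pi) = eta1 eps t by rewrite /eta1 cos_2pi sin_2pi.
  have per2 t : eta2 eps (t + 2 * pi) = eta2 eps t by rewrite /eta2 cos_2pi sin_2pi.
  have <- // : al = c.
  apply: (IsAng_word (G := G) _ _ _ _ _ (ang1 M M5) (ang2 M M5) Hw).
  - by rewrite g10 g20.
  - by rewrite g11 mulr0.
  - by rewrite g21 mulr0.
  - exact: e.
  exact: e.
(* The homotopy leads from [eta] to the word, whereas the degree is known for the word; hence the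
   reversed parameter. *)
apply: HasDeg_eq (@HasDeg_homotopy R (fun w => circ (A (h (1 - w.1.1, w.2)))
  (B (h (1 - w.1.1, w.2))) (crd (h (1 - w.1.1, w.2)) i2) w.1.2) c _ _ _ _ _).
- by move=> k t _ ht /=; rewrite subrr (proj1 (hb t ht)).
- by move=> w; rewrite /circ; ctac.
- move=> s k t hs _ ht /=; have hs' : unitI (1 - s) by move: hs; rewrite /unitI; lra.
  by have [? ? ?] := gap _ (hQ _ _ hs' ht); exact: circ_gap.
- by move=> s t _ _; exact: circ_per.
- move=> s k hs _ /=; have hs' : unitI (1 - s) by move: hs; rewrite /unitI; lra.
  by rewrite hper.
by apply: HasDeg_eq step => k t _ _ /=; rewrite subr0.
Qed.

Lemma circ_hvec1 k (q : 'rV[R]_3) :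
  circ (crd q i0) (1 + crd q i1) (crd q i2) k = hvec (2 * pi * k) 0 q.
Proof. by rewrite hvecE cos0 sin0 /circ; congr (_, _, _); ring. Qed.

Lemma circ_hvec2 k (q : 'rV[R]_3) :
  circ (crd q i1) (1 + crd q i0) (crd q i2) k = hvec 0 (2 * pi * k) q.
Proof. by rewrite hvecE cos0 sin0 /circ; congr (_, _, _); ring. Qed.

(** The gap condition evaluated at the momenta (pi, 0), where the planar part is 1 + q_2 - q_1. *)
Lemma Q0_gap1 (q : 'rV[R]_3) : Q0 q ->
  [/\ 0 <= crd q i0, 0 <= 1 + crd q i1 & 0 < (crd q i0 - (1 + crd q i1)) ^+ 2 + crd q i2 ^+ 2].
Proof.
move=> /Q0_gap [h0 h1 /(_ pi 0)]; rewrite hvecE cospi sinpi cos0 sin0 /dot /= => g; split => //.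
  by rewrite addr_ge0.
by move: g; rewrite !expr2; nra.
Qed.

Lemma Q0_gap2 (q : 'rV[R]_3) : Q0 q ->
  [/\ 0 <= crd q i1, 0 <= 1 + crd q i0 & 0 < (crd q i1 - (1 + crd q i0)) ^+ 2 + crd q i2 ^+ 2].
Proof.
move=> /Q0_gap [h0 h1 /(_ 0 pi)]; rewrite hvecE cospi sinpi cos0 sin0 /dot /= => g; split => //.
  by rewrite addr_ge0.
by move: g; rewrite !expr2; nra.
Qed.

Lemma crd_mkv (a b c : R) : [/\ crd (mkv a b c) i0 = a, crd (mkv a b c) i1 = b &
  crd (mkv a b c) i2 = c].
Proof. by split; rewrite /crd /mkv mxE. Qed.

Lemma IsAng_crossing M (eps : R) : 0 < eps -> (4 < M.+1)%N ->
  IsAng (fun t => wcirc M.+1 (1 + eps * cos (2 * pi * t) - (1 + 0))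
    (- (eps * sin (2 * pi * t)))) (2 * pi).
Proof.
move=> e0 M4; apply: IsAng_eq (IsAng_wcirc_circle M4 e0) => t _.
by rewrite addr0 [1 + _]addrC addrK.
Qed.

(** With [eps < 1] the first argument stays below -1, so the loop never reaches the half-plane where
    the Wilson loop can turn. *)
Lemma IsAng_no_crossing M (eps : R) : 0 < eps < 1 -> (4 < M.+1)%N ->
  IsAng (fun t => wcirc M.+1 (0 - (1 + (1 + eps * cos (2 * pi * t))))
    (- (eps * sin (2 * pi * t)))) 0.
Proof.
move=> /andP[e0 e1] M4.
have neg t : 0 - (1 + (1 + eps * cos (2 * pi * t))) < 0.
  by have := cos_geN1 (2 * pi * t); nra.
apply: IsAng_wcirc_le0 => t _; first exact: ltW.
by rewrite ltr_pwDl ?sqr_ge0 // exprn_even_gt0 //= lt_eqF.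
Qed.

Lemma hx_13 (eta : R -> 'rV[R]_3) (T : R) (p : R * R) : 0 < T ->
  hx eta T ((per T i0 * p.1) *: ev i0 + (per T i2 * p.2) *: ev i2) =
  hvec (2 * pi * p.1) 0 (eta (2 * pi * p.2)).
Proof.
move=> T0; rewrite -(tloop_scale eta T0) /hx !crd_shift /crd /ev /per !mxE /=.
by rewrite !mulr1 !mulr0 !addr0 add0r.
Qed.

Lemma hx_23 (eta : R -> 'rV[R]_3) (T : R) (p : R * R) : 0 < T ->
  hx eta T ((per T i1 * p.1) *: ev i1 + (per T i2 * p.2) *: ev i2) =
  hvec 0 (2 * pi * p.1) (eta (2 * pi * p.2)).
Proof.
move=> T0; rewrite -(tloop_scale eta T0) /hx !crd_shift /crd /ev /per !mxE /=.
by rewrite !mulr1 !mulr0 !addr0 add0r.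
Qed.

End LoopClass.

Theorem theorem5p3 (R : realType) (eps T : R) (eta : R -> 'rV[R]_3)
    (n1 n2 : int) :
  0 < eps < 1 -> 0 < T ->
  loop_in_Q0 eta -> in_class eta eps n1 n2 ->
  [/\ chern_number_is (Pbloch eta T) T i0 i1 0,
      chern_number_is (Pbloch eta T) T i0 i2 n1 &
      chern_number_is (Pbloch eta T) T i1 i2 n2].
Proof.
move=> heps T0 Heta Hcl; have e0 : 0 < eps by case/andP: heps.
have cc i : continuous (fun q : 'rV[R]_3 => crd q i) by move=> q; ctac.
have c1 i : continuous (fun q : 'rV[R]_3 => 1 + crd q i) by move=> q; ctac.
split; apply: chern_number_deg => //.
- by rewrite mulr0; exact: HasDeg_12.
(* On the slice with k_2 = 0 the critical set is q_1 = 1 + q_2, q_3 = 0: [eta1] encircles it once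
   and [eta2] stays on the side q_1 < 1 + q_2. On the slice with k_1 = 0 the two generators exchange
   roles. *)
- have := HasDeg_class (a1 := 2 * pi) (a2 := 0) (cc i0) (c1 i1) (@Q0_gap1 R) _ _ Hcl.
  rewrite mul0r addr0 => H; apply: HasDeg_eq (H _ _) => [k b _ _|M M4|M M4].
  + by rewrite hx_13 // circ_hvec1.
  + apply: IsAng_eq (IsAng_crossing e0 M4) => t _.
    by rewrite /eta1; have [-> -> ->] := crd_mkv (1 + eps * cos (2 * pi * t)) 0 (- (eps * sin (2 * pi * t))).
  apply: IsAng_eq (IsAng_no_crossing heps M4) => t _.
  by rewrite /eta2; have [-> -> ->] := crd_mkv 0 (1 + eps * cos (2 * pi * t)) (- (eps * sin (2 * pi * t))).
have := HasDeg_class (a1 := 0) (a2 := 2 * pi) (cc i1) (c1 i0) (@Q0_gap2 R) _ _ Hcl.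
rewrite mul0r add0r => H; apply: HasDeg_eq (H _ _) => [k b _ _|M M4|M M4].
- by rewrite hx_23 // circ_hvec2.
- apply: IsAng_eq (IsAng_no_crossing heps M4) => t _.
  by rewrite /eta1; have [-> -> ->] := crd_mkv (1 + eps * cos (2 * pi * t)) 0 (- (eps * sin (2 * pi * t))).
apply: IsAng_eq (IsAng_crossing e0 M4) => t _.
by rewrite /eta2; have [-> -> ->] := crd_mkv 0 (1 + eps * cos (2 * pi * t)) (- (eps * sin (2 * pi * t))).
Qed.
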